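(* Let $n\ge2$, $1\le k\le n-1$, and $\mathfrak q=\mathfrak{sl}_n\ltimes(k(\mathbb C^n)^*\oplus k\mathbb C^n)$. Then $\mathbb C[\mathfrak q^*]^{\mathfrak q}$ is a polynomial ring if and only if $k\in\{n-2,n-1\}$. In the case $k=n-2$, $\mathfrak q$ has the ''codim-2'' property, i.e. $\mathbf p_{\mathfrak q}=1$.
   Context: $\mathfrak q=\mathfrak g\ltimes V$ with $\mathfrak g=\mathfrak{sl}_n$ and $V=k(\mathbb C^n)^*\oplus k\mathbb C^n$ ($k$ copies each of the dual and defining representations) an abelian ideal; $\mathbb C[\mathfrak q^*]^{\mathfrak q}=\mathcal S(\mathfrak q)^{\mathfrak q}$ is the algebra of symmetric invariants. ''Codim-2'' property: the set $\{\gamma\in\mathfrak q^*:\dim\mathfrak q_\gamma>\operatorname{ind}\mathfrak q\}$ has codimension at least $2$ in $\mathfrak q^*$, where $\operatorname{ind}\mathfrak q=\min_{\gamma\in\mathfrak q^*}\dim\mathfrak q_\gamma$; equivalently, the fundamental semi-invariant $\mathbf p_{\mathfrak q}$ (gcd of the Pfaffians of the principal minors of size $\dim\mathfrak q-\operatorname{ind}\mathfrak q$ of the structure matrix $([\xi_i,\xi_j])$) equals $1$. *)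

(* Defs.v *)
From HB Require Import structures.
From mathcomp Require Import all_boot all_algebra all_fingroup.
From mathcomp Require Import Rstruct.
From mathcomp Require Import complex mpoly.
Set Implicit Arguments. Unset Strict Implicit. Unset Printing Implicit Defensive.
Import GRing.Theory Num.Theory.
Local Open Scope ring_scope.

Notation CC := (complex Rdefinitions.R).

(* The Lie algebra q = sl_n ⋉ (k dual(C^n) ⊕ k C^n), realised concretely.     *)
(* An element is a triple (A, X, Y) with A : n x n (traceless, in sl_n),    *)
(* X : n x k  (k column vectors = k copies of C^n),                        *)
(* Y : k x n  (k row vectors = k copies of dual(C^n)).                       *)
(* sl_n acts by A.x = A x on columns and A.y = - y A on rows; X and Y       *)
(* together span an abelian ideal.                                          *)
Definition qel (n k : nat) := ('M[CC]_n * 'M[CC]_(n, k) * 'M[CC]_(k, n))%type.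

Definition in_q n k (x : qel n k) : Prop := \tr x.1.1 = 0.

Definition qbr n k (x y : qel n k) : qel n k :=
  (x.1.1 *m y.1.1 - y.1.1 *m x.1.1,
   x.1.1 *m y.1.2 - y.1.1 *m x.1.2,
   x.2 *m y.1.1 - y.2 *m x.1.1).

Definition qcomb n k N (a : 'I_N -> CC) (e : 'I_N -> qel n k) : qel n k :=
  (\sum_(i < N) a i *: (e i).1.1,
   \sum_(i < N) a i *: (e i).1.2,
   \sum_(i < N) a i *: (e i).2).

Definition is_q_basis n k N (e : 'I_N -> qel n k) : Prop :=
  [/\ (forall i, in_q (e i)),
      (forall a : 'I_N -> CC, qcomb a e = (0, 0, 0) -> forall i, a i = 0)
    & (forall x, in_q x -> exists a : 'I_N -> CC, qcomb a e = x)].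

Definition struct_consts n k N (e : 'I_N -> qel n k)
  (c : 'I_N -> 'I_N -> 'I_N -> CC) : Prop :=
  forall i j, qbr (e i) (e j) = qcomb (c i j) e.

(* Generic notions for a Lie algebra with basis e_1..e_N and structure     *)
(* constants c.  S(q) = C[q^*] = C[x_1,...,x_N] with x_l = e_l.             *)

Definition struct_mx N (c : 'I_N -> 'I_N -> 'I_N -> CC) : 'M[{mpoly CC[N]}]_N :=
  \matrix_(i, j) \sum_(l < N) c i j l *: 'X_l.

(* F is a symmetric invariant: {e_i, F} = \sum_j [e_i,e_j] d F/d x_j = 0
   for all i (the coadjoint action of q on S(q) by derivations). *)
Definition sym_invariant N (c : 'I_N -> 'I_N -> 'I_N -> CC)
  (F : {mpoly CC[N]}) : Prop :=
  forall i : 'I_N, \sum_(j < N) struct_mx c i j * F^`M(j) = 0.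

Definition sym_inv_polynomial N (c : 'I_N -> 'I_N -> 'I_N -> CC) : Prop :=
  exists (m : nat) (f : m.-tuple {mpoly CC[N]}),
    [/\ (forall t : 'I_m, sym_invariant c (tnth f t)),
        (forall P : {mpoly CC[m]}, P \mPo f = 0 -> P = 0)
      & (forall F, sym_invariant c F -> exists P : {mpoly CC[m]}, F = P \mPo f)].

Definition struct_mx_at N (c : 'I_N -> 'I_N -> 'I_N -> CC) (g : 'I_N -> CC)
  : 'M[CC]_N := map_mx (meval g) (struct_mx c).

(* r = dim q - ind q, i.e. the maximal rank of the structure matrix
   over q^*  (dim q_gamma = N - rank of the matrix at gamma) *)
Definition max_rank N (c : 'I_N -> 'I_N -> 'I_N -> CC) (r : nat) : Prop :=
  (exists g, \rank (struct_mx_at c g) = r) /\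
  (forall g, (\rank (struct_mx_at c g) <= r)%N).

(* the Pfaffian of a 2m x 2m (here r x r, m = r/2) matrix:
   Pf(A) = 1/(2^m m!) \sum_s sgn(s) \prod_{i<m} A_{s(2i), s(2i+1)}
   (0-based indices; the product runs over the even i < r, paired with i+1) *)
Definition pfaffian (R : fieldType) (A : algType R) r (M : 'M[A]_r) : A :=
  ((2 ^ r./2 * r./2 `!)%:R : R)^-1 *:
  \sum_(s : 'S_r) ((-1) ^+ s *
     \prod_(i < r | ~~ odd i) M (s i) (s (insubd i i.+1))).

Definition principal_submx (T : Type) N r (M : 'M[T]_N) (f : 'I_r -> 'I_N)
  : 'M[T]_r := \matrix_(a, b) M (f a) (f b).

(* p_q = 1: the gcd of the Pfaffians of the principal r x r minors of the
   structure matrix (r = dim q - ind q) is 1, i.e. every common divisor of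
   them in S(q) is a nonzero constant. *)
Definition fund_semi_inv_trivial N (c : 'I_N -> 'I_N -> 'I_N -> CC) : Prop :=
  forall r, max_rank c r ->
  forall d : {mpoly CC[N]},
    (forall f : 'I_r -> 'I_N, {mono f : a b / (a < b)%N} ->
       exists g, pfaffian (principal_submx (struct_mx c) f) = d * g) ->
    exists a : CC, a != 0 /\ d = a%:MP.

(* Main.v *)
Require Import Defs.
From Stdlib Require Import Classical_Prop.
From HB Require Import structures.
From mathcomp Require Import all_boot all_algebra all_fingroup.
From mathcomp Require Import spectral.
From mathcomp Require Import Rstruct.
From mathcomp Require Import complex mpoly.
From mathcomp Require Import ring.
Import GRing.Theory Num.Theory.
Local Open Scope ring_scope.

(* A point of q^* is a triple (A, X, Y) with A taken modulo scalars.  Where Y X is invertible, the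
   group moves it to a slice on which A = diag(0, d), X = (Z, 0), Y = (1, 0), with Z = Y X.

   k = n - 1: d is a scalar, so the entries of Y X generate the invariants.

   k = n - 2: the remaining datum is the discriminant D of the quadratic polynomial
   chi = det [[t - A, X], [Y, 0]].  The entries of Y X and D generate the invariants after inverting
   det (Y X); a relation divisible by det (Y X) is cleared because a polynomial vanishing at generic
   corank-one matrices is divisible by the determinant (monic division along Z + t I).

   k <= n - 3: a derivative of chi is a cubic c0 t^3 + c1 t^2 + ... of discriminant D, whose
   seminvariants satisfy T^2 = 4 H^3 - 27 c0^2 D.  Along a line (lambda A0, X0, Y0) on which c0 = 0
   and c1 is a nonzero multiple of lambda, an invariant has no term of degree one in lambda.  Hence,
   expressed in algebraically independent generators, T would vanish to order 4 at lambda = 0,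
   whereas T = 2 c1^3 there.

   Codimension two (k = n - 2): a common divisor d of the Pfaffians vanishes at no point of maximal
   rank.  A two-dimensional linear space whose nonzero points all have maximal rank shows d(0) <> 0,
   and then d is constant along every line joining 0 to a point of maximal rank. *)

Set Implicit Arguments. Unset Strict Implicit. Unset Printing Implicit Defensive.

(** * Polynomial functions *)

(** All motion takes place along polynomial paths. For [B] with square zero, [1 - t B] has inverse
    [1 + t B]; such matrices generate SL_n and span sl_n, so infinitesimal invariance amounts to
    invariance under explicit substitutions. Density is the absence of zero divisors among
    polynomials.

    For k <= n - 3 neither the number nor the degrees of hypothetical generators are known; only
    their independence is used. The first-order term of an invariant at A = 0 is a
    conjugation-invariant linear form in d, a multiple of the trace, and it vanishes because A
    counts modulo scalars. On the line each generator is thus y + eta lambda^2. The syzygy, an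
    identity in free variables, survives when this lambda^2 becomes a new variable mu. Then c0, H,
    T, D all vanish at mu = 0, so mu^3 divides T^2 and mu^2 divides T.

    For k = n - 2 corank-one matrices are the right test set because over them the discriminant
    still takes every value. For codimension two, the stabiliser bounds for the maximal rank miss
    each other by one; the evenness of the rank of a skew matrix closes the gap. *)

Lemma poly_horner0 (p : {poly CC}) : (forall t, p.[t] = 0) -> p = 0.
Proof.
move=> h; apply/eqP; apply/negPn/negP => p0.
have := @max_poly_roots _ p [seq i%:R | i <- iota 0 (size p)] p0.
rewrite map_inj_uniq ?iota_uniq; last by move=> i j /eqP; rewrite eqr_nat => /eqP.
rewrite size_map size_iota ltnn => H.
suff : false by []. apply: H => //; apply/allP => x _; apply/eqP; exact: h.
Qed.

Lemma poly_deriv0 (p : {poly CC}) : p^`() = 0 -> p = (p`_0)%:P.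
Proof.
move=> h; apply/polyP => -[|i]; rewrite coefC //=.
have : p^`()`_i = 0 by rewrite h coef0.
by rewrite coef_deriv => /eqP; rewrite mulrn_eq0 /= => /eqP.
Qed.

Lemma poly_noroot (p : {poly CC}) : (forall t, p.[t] != 0) -> p = (p`_0)%:P.
Proof.
move=> h; apply: size1_polyC; rewrite leqNgt; apply/negP => s.
have: size p != 1%N by rewrite neq_ltn s orbT.
by case/closed_rootP => x; rewrite rootE (negPf (h x)).
Qed.

Section MpolyEval.
Variable n : nat.
Let widen := widen_ord (leqnSn n).

Lemma meval_muni (p : {mpoly CC[n.+1]}) (v : 'I_n.+1 -> CC) :
  p.@[v] = (map_poly (meval (v \o widen)) (muni p)).[v ord_max].
Proof.
rewrite mevalE muniE rmorph_sum horner_sum; apply: eq_bigr => m _.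
rewrite /= map_polyZ /= map_polyXn hornerZ hornerXn mevalZ mevalX -mulrA big_ord_recr.
by congr (_ * (_ * _)); apply: eq_bigr => i _; rewrite mnmE.
Qed.

Lemma muni_inj (p : {mpoly CC[n.+1]}) : muni p = 0 -> p = 0.
Proof.
move=> h.
have <- : (map_poly (@mwiden n CC) (muni p)).['X_ord_max] = p.
  rewrite {2}[p]mpolyE muniE rmorph_sum horner_sum; apply: eq_bigr => m _.
  rewrite /= map_polyZ /= map_polyXn hornerZ hornerXn mwidenZ mwidenX -scalerAl.
  congr (_ *: _); rewrite mpolyXn -mpolyXD; congr 'X_[_].
  apply/mnmP => i; rewrite mnmDE mulmnE mnm1E.
  have [j ->|->] := unliftP ord_max i; last first.
    by rewrite mnmwiden_ordmax eqxx mul1n.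
  have -> : lift ord_max j = widen j by apply/val_inj; rewrite /= /bump leqNgt ltn_ord.
  by rewrite mnmwiden_widen mnmE -val_eqE /= gtn_eqF ?ltn_ord // mul0n addn0.
by rewrite h rmorph0 horner0.
Qed.
End MpolyEval.

(** Induction on the number of variables: with the other variables fixed, the polynomial in the last
    one vanishes at every scalar, so its coefficients vanish at every point. *)
Lemma mpoly_meval0 n (p : {mpoly CC[n]}) : (forall v, p.@[v] = 0) -> p = 0.
Proof.
elim: n p => [|n IH] p h.
  apply/mpolyP => m; rewrite mcoeff0.
  have e : p = (p@_0)%:MP.
    rewrite {1}[p]mpolyE; apply/mpolyP => m'; rewrite -[in LHS]mpolyE mcoeffC.
    have -> : m' = 0%MM by apply/mnmP => -[].
    by rewrite eqxx mulr1.
  have := h (fun=> 0); rewrite e mevalC => ->.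
  by rewrite mpolyC0 mcoeff0.
apply: muni_inj; apply/polyP => i; rewrite coef0; apply: IH => v.
pose w t (j : 'I_n.+1) : CC := if unlift ord_max j is Some j' then v j' else t.
have e t : w t \o widen_ord (leqnSn n) =1 v.
  move=> j /=; rewrite /w.
  have -> : widen_ord (leqnSn n) j = lift ord_max j.
    by apply/val_inj; rewrite /= /bump leqNgt ltn_ord.
  by rewrite liftK.
have q0 : map_poly (meval v) (muni p) = 0.
  apply: poly_horner0 => t; rewrite -[RHS](h (w t)) meval_muni /w unlift_none.
  congr (_.[_]); apply: eq_map_poly => q; apply: meval_eq => j; by rewrite -(e t).
by rewrite -coef_map /= q0 coef0.
Qed.

(** Being polynomial is a property of a function, stable under composition, matrix products and
    determinants, so it is read off a formula without writing the polynomial down. *)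
Definition polyfun p (f : ('I_p -> CC) -> CC) : Prop :=
  exists P : {mpoly CC[p]}, forall g, f g = P.@[g].

Section Polyfun.
Variable p : nat.
Implicit Types f h : ('I_p -> CC) -> CC.

Lemma polyfun_ext f h : (forall g, f g = h g) -> polyfun f -> polyfun h.
Proof. by move=> e [P hP]; exists P => g; rewrite -e. Qed.
Lemma polyfun_const a : polyfun (fun _ : 'I_p -> CC => a).
Proof. by exists a%:MP => g; rewrite mevalC. Qed.
Lemma polyfun_var i : polyfun (fun g : 'I_p -> CC => g i).
Proof. by exists 'X_i => g; rewrite mevalXU. Qed.
Lemma polyfun_meval P : polyfun (fun g : 'I_p -> CC => P.@[g]).
Proof. by exists P. Qed.
Lemma polyfunD f h : polyfun f -> polyfun h -> polyfun (fun g => f g + h g).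
Proof. by move=> [P hP] [Q hQ]; exists (P + Q) => g; rewrite mevalD hP hQ. Qed.
Lemma polyfunM f h : polyfun f -> polyfun h -> polyfun (fun g => f g * h g).
Proof. by move=> [P hP] [Q hQ]; exists (P * Q) => g; rewrite mevalM hP hQ. Qed.
Lemma polyfunN f : polyfun f -> polyfun (fun g => - f g).
Proof. by move=> [P hP]; exists (- P) => g; rewrite mevalN hP. Qed.
Lemma polyfunB f h : polyfun f -> polyfun h -> polyfun (fun g => f g - h g).
Proof. by move=> hf hh; apply: polyfunD hf (polyfunN hh). Qed.
Lemma polyfunX f k : polyfun f -> polyfun (fun g => f g ^+ k).
Proof. by move=> [P hP]; exists (P ^+ k) => g; rewrite rmorphXn hP. Qed.
Lemma polyfun_sum (I : Type) (r : seq I) (Q : pred I) (F : I -> ('I_p -> CC) -> CC) :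
  (forall i, polyfun (F i)) -> polyfun (fun g => \sum_(i <- r | Q i) F i g).
Proof.
move=> hF; elim: r => [|i r IH].
  by apply: polyfun_ext (polyfun_const 0) => g; rewrite big_nil.
have [Qi|Qi] := boolP (Q i); last first.
  by apply: polyfun_ext IH => g; rewrite big_cons (negPf Qi).
by apply: polyfun_ext (polyfunD (hF i) IH) => g; rewrite big_cons Qi.
Qed.
Lemma polyfun_prod (I : Type) (r : seq I) (Q : pred I) (F : I -> ('I_p -> CC) -> CC) :
  (forall i, polyfun (F i)) -> polyfun (fun g => \prod_(i <- r | Q i) F i g).
Proof.
move=> hF; elim: r => [|i r IH].
  by apply: polyfun_ext (polyfun_const 1) => g; rewrite big_nil.
have [Qi|Qi] := boolP (Q i); last first.
  by apply: polyfun_ext IH => g; rewrite big_cons (negPf Qi).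
by apply: polyfun_ext (polyfunM (hF i) IH) => g; rewrite big_cons Qi.
Qed.
Lemma polyfun_mulmx a b d (A : ('I_p -> CC) -> 'M[CC]_(a, b)) (B : ('I_p -> CC) -> 'M[CC]_(b, d)) :
  (forall i j, polyfun (fun g => A g i j)) -> (forall i j, polyfun (fun g => B g i j)) ->
  forall i j, polyfun (fun g => (A g *m B g) i j).
Proof.
move=> hA hB i j; apply: polyfun_ext (_ : polyfun (fun g => \sum_l A g i l * B g l j)).
  by move=> g; rewrite mxE.
by apply: polyfun_sum => l; apply: polyfunM.
Qed.
Lemma polyfun_det a (A : ('I_p -> CC) -> 'M[CC]_a) :
  (forall i j, polyfun (fun g => A g i j)) -> polyfun (fun g => \det (A g)).
Proof.
move=> hA; apply: polyfun_sum => s; apply: polyfunM; first exact: polyfun_const.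
by apply: polyfun_prod.
Qed.

Lemma polyfun_comp q (f : ('I_q -> CC) -> CC) (h : ('I_p -> CC) -> 'I_q -> CC) :
  polyfun f -> (forall j, polyfun (fun g => h g j)) -> polyfun (fun g => f (h g)).
Proof.
move=> [P hP] hh; have [H hH] := fin_all_exists hh.
exists (P \mPo [tuple H j | j < q]) => g; rewrite hP comp_mpoly_meval.
by apply: meval_eq => j; rewrite tnth_mktuple hH.
Qed.

(** Zariski density in the form used throughout: the product of the two polynomials vanishes at
    every point, hence is zero, and polynomials form a domain. *)
Lemma polyfun_dense f h : polyfun f -> polyfun h -> (exists g, h g != 0) ->
  (forall g, h g != 0 -> f g = 0) -> forall g, f g = 0.
Proof.
move=> [P hP] [Q hQ] [g0 hg0] H.
have /eqP : P * Q = 0.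
  apply: mpoly_meval0 => g; rewrite mevalM -hP -hQ.
  by have [->|/H ->] := eqVneq (h g) 0; rewrite ?mulr0 ?mul0r.
rewrite mulf_eq0 => /orP[]/eqP e; last by rewrite hQ e meval0 eqxx in hg0.
by move=> g; rewrite hP e meval0.
Qed.

Lemma polyfun_common_nonzero f h : polyfun f -> polyfun h ->
  (exists g, f g != 0) -> (exists g, h g != 0) -> exists g, f g != 0 /\ h g != 0.
Proof.
move=> pf ph [g hg] [g' hg']; apply: NNPP => H.
have : f g = 0.
  apply: (polyfun_dense pf ph); first by exists g'.
  move=> x hx; apply/eqP; apply/negPn/negP => fx; apply: H; by exists x.
by move/eqP; rewrite (negPf hg).
Qed.
End Polyfun.

Section PathDerivative.
Variables (N : nat) (G : 'I_N -> {poly CC}).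

Lemma horner_mmap_polyC (F : {mpoly CC[N]}) t :
  (mmap polyC G F).[t] = F.@[fun j => (G j).[t]].
Proof.
rewrite mevalE /mmap horner_sum; apply: eq_bigr => m _.
by rewrite hornerM hornerC horner_prod; congr (_ * _); apply: eq_bigr => i _; rewrite horner_exp.
Qed.

(** Chain rule along the path [G]: both sides are additive and obey the Leibniz rule, so agreement
    on the variables suffices. *)
Lemma deriv_mmap_polyC (F : {mpoly CC[N]}) :
  (mmap polyC G F)^`() = \sum_j mmap polyC G F^`M(j) * (G j)^`().
Proof.
pose D F := (mmap polyC G F)^`() = \sum_j mmap polyC G F^`M(j) * (G j)^`().
have D0 : D 0.
  rewrite /D mmap0 linear0 big1 // => j _; by rewrite linear0 mmap0 mul0r.
have DD p q : D p -> D q -> D (p + q).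
  rewrite /D mmapD linearD /= => -> ->; rewrite -big_split; apply: eq_bigr => j _.
  by rewrite /= mderivD mmapD mulrDl.
have DZ a p : D p -> D (a *: p).
  rewrite /D mmapZ derivM derivC mul0r add0r => ->.
  rewrite mulr_sumr; apply: eq_bigr => j _; by rewrite mderivZ mmapZ mulrA.
have DM p q : D p -> D q -> D (p * q).
  rewrite /D rmorphM derivM => -> ->.
  rewrite mulr_suml mulr_sumr -big_split; apply: eq_bigr => j _ /=.
  by rewrite mderivM rmorphD !rmorphM /= mulrDl; congr (_ + _); rewrite -!mulrA // [_^`() * _]mulrC.
have DU i : D 'X_i.
  rewrite /D mmapX mmap1U (bigD1 i) //= mderivX mnm1E eqxx scale1r.
  have -> : (U_(i) - U_(i))%MM = 0%MM by apply/mnmP => j; rewrite mnmBE mnm0E subnn.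
  rewrite mpolyX0 rmorph1 mul1r.
  rewrite big1 ?addr0 // => j ji; rewrite mderivX mnm1E eq_sym (negPf ji) scale0r mmap0 mul0r //.
have D1 : D 1.
  rewrite /D rmorph1 derivC big1 // => j _; by rewrite -mpolyC1 mderivC mmap0 mul0r.
rewrite -/(D F); clearbody D.
elim/mpolyind: F => // a m p _ _ hp; apply: DD => //; apply: DZ.
rewrite mpolyXE_id; elim/big_rec: _ => // i q _ hq; apply: (DM) => //.
by elim: (m i) => [|k IH]; rewrite ?expr0 // exprS; apply: (DM).
Qed.
End PathDerivative.

(** * The coadjoint representation *)

Section Pairing.
Variables n k : nat.
Implicit Types g x y z : qel n k.

(** Triples also serve as functionals, the rows of one pairing with the columns of the other.
    Traceless matrices do not see scalars, so a functional is a triple modulo [dualshift]. *)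
Definition pairing g x : CC :=
  \tr (g.1.1 *m x.1.1) + \tr (g.2 *m x.1.2) + \tr (x.2 *m g.1.2).

(** Transpose of [ad x], that is, minus the usual coadjoint operator; the sign is harmless for
    invariance. *)
Definition coad x g : qel n k :=
  (g.1.1 *m x.1.1 - x.1.1 *m g.1.1 - x.1.2 *m g.2 + g.1.2 *m x.2,
   - (x.1.1 *m g.1.2), g.2 *m x.1.1).

Lemma pairing_is_linear z : linear_for *%R (pairing z).
Proof.
move=> a x y; rewrite /pairing /= !mulmxDr mulmxDl -!scalemxAr -scalemxAl.
by rewrite !mxtraceD !mxtraceZ; ring.
Qed.

Lemma pairing_linearl a x y z : pairing (a *: x + y) z = a * pairing x z + pairing y z.
Proof.
rewrite /pairing /= !mulmxDl mulmxDr -!scalemxAl -scalemxAr.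
by rewrite !mxtraceD !mxtraceZ; ring.
Qed.

Lemma pairingDl x y z : pairing (x + y) z = pairing x z + pairing y z.
Proof. by rewrite -[x in LHS]scale1r pairing_linearl mul1r. Qed.
Lemma pairing0r x : pairing x 0 = 0.
Proof. by rewrite /pairing /= !(mulmx0, mul0mx) !mxtrace0 !addr0. Qed.
Lemma pairing0l x : pairing 0 x = 0.
Proof. by rewrite /pairing /= !(mulmx0, mul0mx) !mxtrace0 !addr0. Qed.
Lemma pairingZl a x z : pairing (a *: x) z = a * pairing x z.
Proof. by rewrite -[a *: x]addr0 pairing_linearl pairing0l addr0. Qed.
Lemma pairingDr x y z : pairing x (y + z) = pairing x y + pairing x z.
Proof. by rewrite -[y in LHS]scale1r pairing_is_linear mul1r. Qed.
Lemma pairingZr a x z : pairing x (a *: z) = a * pairing x z.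
Proof. by rewrite -[a *: z]addr0 pairing_is_linear pairing0r addr0. Qed.
Lemma pairing_sumr (I : Type) (r : seq I) (P : pred I) x (F : I -> qel n k) :
  pairing x (\sum_(i <- r | P i) F i) = \sum_(i <- r | P i) pairing x (F i).
Proof. by apply: big_morph => [y z|]; rewrite ?pairingDr ?pairing0r. Qed.

Lemma pairing_coad g x y : pairing g (qbr x y) = pairing (coad x g) y.
Proof.
rewrite /pairing /qbr /coad /= !(mulmxBr, mulmxBl, mulmxDl, mulmxN, mulNmx).
have trN (A : 'M[CC]_n) : \tr (- A) = - \tr A by rewrite linearN.
have trN' (A : 'M[CC]_k) : \tr (- A) = - \tr A by rewrite linearN.
rewrite !(mxtraceD, trN, trN') !mulmxA.
have <- : \tr (x.1.1 *m g.1.1 *m y.1.1) = \tr (g.1.1 *m y.1.1 *m x.1.1).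
  by rewrite mxtrace_mulC mulmxA mxtrace_mulC mulmxA.
have <- : \tr (x.1.2 *m g.2 *m y.1.1) = \tr (g.2 *m y.1.1 *m x.1.2).
  by rewrite mxtrace_mulC mulmxA mxtrace_mulC mulmxA.
have <- : \tr (g.1.2 *m x.2 *m y.1.1) = \tr (x.2 *m y.1.1 *m g.1.2).
  by rewrite mxtrace_mulC mulmxA mxtrace_mulC mulmxA.
repeat match goal with |- context [\tr ?A] => move: (\tr A) end; move=> *; ring.
Qed.

Definition dualshift (a : CC) : qel n k := (a%:M, 0, 0).

Lemma pairing_dualshift a x : in_q x -> pairing (dualshift a) x = 0.
Proof.
move=> h; rewrite /pairing /= mul_scalar_mx mxtraceZ h mulr0 mul0mx mulmx0.
by rewrite !mxtrace0 !addr0.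
Qed.

Lemma pairing_nondegenerate g : (0 < n)%N -> (forall x, in_q x -> pairing g x = 0) ->
  exists a, g = dualshift a.
Proof.
move=> n0 h.
have hX : g.1.2 = 0.
  apply/matrixP => i j; have := h (0, 0, delta_mx j i).
  rewrite /in_q /= mxtrace0 => /(_ erefl); rewrite /pairing /= !mulmx0 !mxtrace0 !add0r.
  rewrite /mxtrace (bigD1 j) //= big1 => [|l lj].
    rewrite addr0 !mxE (bigD1 i) //= big1 => [|l li]; rewrite !mxE ?eqxx ?mul1r ?addr0 //.
    by rewrite (negPf li) andbF mul0r.
  by rewrite mxE big1 // => i' _; rewrite mxE (negPf lj) mul0r.
have hY : g.2 = 0.
  apply/matrixP => i j; have := h (0, delta_mx j i, 0).
  rewrite /in_q /= mxtrace0 => /(_ erefl); rewrite /pairing /= !mulmx0 mul0mx !mxtrace0 !add0r addr0.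
  rewrite mxtrace_mulC /mxtrace (bigD1 j) //= big1 => [|l lj].
    rewrite addr0 !mxE (bigD1 i) //= big1 => [|l li]; rewrite !mxE ?eqxx ?mul1r ?addr0 //.
    by rewrite (negPf li) andbF mul0r.
  by rewrite mxE big1 // => i' _; rewrite mxE (negPf lj) mul0r.
have trd (A : 'M[CC]_n) i j : \tr (A *m delta_mx i j) = A j i.
  rewrite mxtrace_mulC /mxtrace (bigD1 i) //= big1 => [|l lj].
    rewrite addr0 !mxE (bigD1 j) //= big1 => [|l li]; rewrite !mxE ?eqxx ?mul1r ?addr0 //.
    by rewrite (negPf li) andbF mul0r.
  by rewrite mxE big1 // => i' _; rewrite mxE (negPf lj) mul0r.
have hP B : \tr B = 0 -> \tr (g.1.1 *m B) = 0.
  move=> tB; have := h (B, 0, 0) tB.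
  by rewrite /pairing /= mulmx0 mul0mx !mxtrace0 !addr0.
pose i0 := Ordinal n0.
exists (g.1.1 i0 i0); case: g hX hY trd hP {h} => -[A X] Y /= -> -> trd hP; congr (_, _, _).
apply/matrixP => i j; rewrite !mxE.
have [->|ij] := eqVneq i j.
  rewrite mulr1n; have := hP (delta_mx j j - delta_mx i0 i0).
  rewrite mulmxBr !linearB /= !trd.
  have tr1 (l : 'I_n) : \tr (delta_mx l l : 'M[CC]_n) = 1.
    by rewrite -[delta_mx l l]mul1mx trd mxE eqxx.
  by rewrite !tr1 subrr => /(_ erefl) /eqP; rewrite subr_eq0 => /eqP.
have := hP (delta_mx j i); rewrite trd mulr0n; apply.
by rewrite -[delta_mx _ _]mul1mx trd mxE (negPf ij).
Qed.
End Pairing.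

Section Basis.
Variables (n k N : nat) (e : 'I_N -> qel n k) (c : 'I_N -> 'I_N -> 'I_N -> CC).
Hypotheses (n_gt0 : (0 < n)%N) (he : is_q_basis e) (hc : struct_consts e c).
Implicit Types g x y z : qel n k.

Definition ev g : 'I_N -> CC := fun l => pairing g (e l).

Lemma qcombE (a : 'I_N -> CC) : qcomb a e = \sum_i a i *: e i.
Proof.
rewrite [RHS]surjective_pairing [X in (X, _)]surjective_pairing.
by congr (_, _, _); apply/esym;
  [apply: (big_morph (fun x => x.1.1)) | apply: (big_morph (fun x => x.1.2)) | apply: (big_morph snd)].
Qed.

Lemma in_q_basis i : in_q (e i). Proof. by case: he. Qed.

Lemma ev_shift g a : ev (g + dualshift _ _ a) =1 ev g.
Proof. by move=> l; rewrite /ev pairingDl pairing_dualshift ?addr0 //; apply: in_q_basis. Qed.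

Lemma evP x g : in_q x -> exists a : 'I_N -> CC,
   x = \sum_i a i *: e i /\ pairing g x = \sum_l a l * ev g l.
Proof.
case: he => _ _ h /h [a]; rewrite qcombE => <-; exists a; split => //.
by rewrite pairing_sumr; apply: eq_bigr => i _; rewrite pairingZr.
Qed.

Lemma ev_inj g g' : ev g =1 ev g' -> exists a, g = g' + dualshift _ _ a.
Proof.
move=> E; have [|a ha] := @pairing_nondegenerate n k (g - g') n_gt0.
  move=> x /(evP (g - g')) [a [_ ->]]; apply: big1 => l _.
  by rewrite /ev pairingDl -scaleN1r pairingZl mulN1r [pairing g _]E subrr mulr0.
by exists a; rewrite -ha addrC subrK.
Qed.

(** The elementary matrices, made traceless by subtracting 1/n on the diagonal, are expanded in [e].
    The coordinates of any element are then linear in its entries, and linear forms in the entries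
    are pairings. *)
Lemma dual_basis : exists d : 'I_N -> qel n k, forall l l', pairing (d l) (e l') = (l' == l)%:R.
Proof.
case: he => hq hf hs.
have ex y : in_q y -> exists a : 'I_N -> CC, y = \sum_l a l *: e l.
  by move=> /hs [a <-]; exists a; rewrite qcombE.
have HA (ij : 'I_n * 'I_n) : exists a : 'I_N -> CC,
    (delta_mx ij.1 ij.2 - ((ij.1 == ij.2)%:R / n%:R)%:M, 0, 0) = \sum_l a l *: e l :> qel n k.
  case: ij => i j /=; apply: ex; rewrite /in_q /= linearB /= mxtrace_scalar.
  rewrite -[_ *+ n]mulr_natr divfK ?pnatr_eq0 -?lt0n //.
  rewrite /mxtrace (bigD1 i) //= !mxE eqxx big1 ?addr0; first by rewrite subrr.
  by move=> l li; rewrite mxE (negPf li).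
have HX (ij : 'I_n * 'I_k) : exists a : 'I_N -> CC,
    (0, delta_mx ij.1 ij.2, 0) = \sum_l a l *: e l :> qel n k.
  by apply: ex; rewrite /in_q /= mxtrace0.
have HY (ij : 'I_k * 'I_n) : exists a : 'I_N -> CC,
    (0, 0, delta_mx ij.1 ij.2) = \sum_l a l *: e l :> qel n k.
  by apply: ex; rewrite /in_q /= mxtrace0.
have [cA hA] := fin_all_exists HA.
have [cX hX] := fin_all_exists HX.
have [cY hY] := fin_all_exists HY.
exists (fun l => (\matrix_(i, j) cA (j, i) l, \matrix_(i, j) cY (j, i) l, \matrix_(i, j) cX (j, i) l)).
pose a (x : qel n k) l := \sum_i \sum_j x.1.1 i j * cA (i, j) l +
   \sum_i \sum_j x.1.2 i j * cX (i, j) l + \sum_i \sum_j x.2 i j * cY (i, j) l.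
have ha x : in_q x -> \sum_l a x l *: e l = x.
  move=> tx.
  transitivity (\sum_i \sum_j x.1.1 i j *: \sum_l cA (i, j) l *: e l +
    \sum_i \sum_j x.1.2 i j *: (\sum_l cX (i, j) l *: e l) +
    \sum_i \sum_j x.2 i j *: (\sum_l cY (i, j) l *: e l)).
    have S p q (M : 'M[CC]_(p, q)) (C : 'I_p * 'I_q -> 'I_N -> CC) :
      \sum_i \sum_j M i j *: (\sum_l C (i, j) l *: e l) =
      \sum_l (\sum_i \sum_j M i j * C (i, j) l) *: e l.
      rewrite [RHS](eq_bigr (fun l => \sum_i \sum_j (M i j * C (i, j) l) *: e l)); last first.
        by move=> l _; rewrite scaler_suml; apply: eq_bigr => i _; rewrite scaler_suml.
      rewrite [RHS]exchange_big; apply: eq_bigr => i _; rewrite exchange_big; apply: eq_bigr => j _.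
      by rewrite scaler_sumr; apply: eq_bigr => l _; rewrite scalerA.
    by rewrite !S -!big_split; apply: eq_bigr => l _; rewrite /= !scalerDl.
  have e1 : \sum_i \sum_j x.1.1 i j *: \sum_l cA (i, j) l *: e l = (x.1.1, 0, 0).
    under eq_bigr do under eq_bigr do rewrite -hA /=.
    rewrite [LHS]surjective_pairing [X in (X, _)]surjective_pairing.
    have p1 (I : finType) (F : I -> qel n k) : (\sum_i F i).1.1 = \sum_i (F i).1.1.
      exact: (big_morph (fun x : qel n k => x.1.1)).
    have p2 (I : finType) (F : I -> qel n k) : (\sum_i F i).1.2 = \sum_i (F i).1.2.
      exact: (big_morph (fun x : qel n k => x.1.2)).
    have p3 (I : finType) (F : I -> qel n k) : (\sum_i F i).2 = \sum_i (F i).2.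
      exact: (big_morph snd).
    rewrite p1 p2 p3; congr (_, _, _).
    - rewrite [RHS]matrix_sum_delta; under eq_bigr do rewrite p1 /=.
      apply/eqP; rewrite -subr_eq0 -sumrB.
      have -> : \sum_i (\sum_j x.1.1 i j *: (delta_mx i j - ((i == j)%:R / n%:R)%:M) -
          \sum_j x.1.1 i j *: delta_mx i j) = - (\tr x.1.1 / n%:R)%:M :> 'M[CC]_n.
        rewrite [\tr _]/mxtrace mulr_suml rmorph_sum -sumrN; apply: eq_bigr => i _.
        rewrite -sumrB (bigD1 i) //= big1 ?addr0 => [|j ji].
          rewrite eqxx scalerBr addrAC subrr sub0r; congr (- _); by rewrite scale_scalar_mx mulrA mulr1.
        by rewrite eq_sym (negPf ji) mul0r rmorph0 subr0 subrr.
      by rewrite [\tr _]tx mul0r rmorph0 oppr0.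
    - by rewrite big1 // => i _; rewrite p2 big1 // => j _; rewrite /= scaler0.
    - by rewrite big1 // => i _; rewrite p3 big1 // => j _; rewrite /= scaler0.
  have e2 : \sum_i \sum_j x.1.2 i j *: (\sum_l cX (i, j) l *: e l) = (0, x.1.2, 0).
    under eq_bigr do under eq_bigr do rewrite -hX /=.
    have E (M M' : 'M[CC]_(n, k)) : (0, M + M', 0) = (0, M, 0) + (0, M', 0) :> qel n k.
      by congr (_, _, _); rewrite /= addr0.
    have E' : \sum_i \sum_j (0, x.1.2 i j *: delta_mx i j, 0) = (0, x.1.2, 0) :> qel n k.
      rewrite {2}[x.1.2]matrix_sum_delta.
      rewrite (big_morph (fun M => (0, M, 0) : qel n k) E erefl); apply: eq_bigr => i _.
      by rewrite (big_morph (fun M => (0, M, 0) : qel n k) E erefl).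
    rewrite -[RHS]E'; apply: eq_bigr => i _; apply: eq_bigr => j _.
    by congr (_, _, _); rewrite /= scaler0.
  have e3 : \sum_i \sum_j x.2 i j *: (\sum_l cY (i, j) l *: e l) = (0, 0, x.2).
    under eq_bigr do under eq_bigr do rewrite -hY /=.
    have E (M M' : 'M[CC]_(k, n)) : (0, 0, M + M') = (0, 0, M) + (0, 0, M') :> qel n k.
      by congr (_, _, _); rewrite /= addr0.
    have E' : \sum_i \sum_j (0, 0, x.2 i j *: delta_mx i j) = (0, 0, x.2) :> qel n k.
      rewrite {2}[x.2]matrix_sum_delta.
      rewrite (big_morph (fun M => (0, 0, M) : qel n k) E erefl); apply: eq_bigr => i _.
      by rewrite (big_morph (fun M => (0, 0, M) : qel n k) E erefl).
    rewrite -[RHS]E'; apply: eq_bigr => i _; apply: eq_bigr => j _.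
    by congr (_, _, _); rewrite /= scaler0.
  rewrite e1 e2 e3 [RHS]surjective_pairing [X in _ = (X, _)]surjective_pairing.
  by congr (_, _, _); rewrite /= ?addr0 ?add0r.
move=> l l'.
have -> : pairing (\matrix_(i, j) cA (j, i) l, \matrix_(i, j) cY (j, i) l, \matrix_(i, j) cX (j, i) l)
    (e l') = a (e l') l.
  have T p q (M : 'M[CC]_(p, q)) (C : 'I_p * 'I_q -> 'I_N -> CC) :
     \tr ((\matrix_(i, j) C (j, i) l) *m M) = \sum_i \sum_j M i j * C (i, j) l.
    rewrite mxtrace_mulC; apply: eq_bigr => i _; rewrite mxE; apply: eq_bigr => j _.
    by rewrite mxE.
  by rewrite /pairing /a /= !T mxtrace_mulC T.
have h : forall i, a (e l') i - (l' == i)%:R = 0.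
  apply: hf; rewrite qcombE; under eq_bigr do rewrite scalerBl.
  rewrite sumrB ha //= (bigD1 l') //= eqxx scale1r big1 ?addr0 ?subrr // => i.
  by rewrite eq_sym => /negPf ->; rewrite scale0r.
by apply/eqP; rewrite -subr_eq0 h.
Qed.

Lemma struct_mx_ev g i j : struct_mx_at c (ev g) i j = pairing g (qbr (e i) (e j)).
Proof.
rewrite hc qcombE pairing_sumr !mxE rmorph_sum; apply: eq_bigr => l _.
by rewrite /= mevalZ mevalXU pairingZr.
Qed.

Lemma ev_surj : exists ga : ('I_N -> CC) -> qel n k, (forall s, ev (ga s) =1 s) /\
  [/\ forall i j, polyfun (fun s => (ga s).1.1 i j), forall i j, polyfun (fun s => (ga s).1.2 i j)
    & forall i j, polyfun (fun s => (ga s).2 i j)].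
Proof.
have [d hd] := dual_basis.
exists (fun s => \sum_l s l *: d l); split.
  move=> s l; rewrite /ev.
  rewrite (big_morph (fun x => pairing x (e l)) (fun x y => pairingDl x y (e l)) (pairing0l (e l))).
  under eq_bigr do rewrite pairingZl hd.
  rewrite (bigD1 l) //= eqxx mulr1 big1 ?addr0 // => i; rewrite eq_sym => /negPf ->.
  by rewrite mulr0.
have p1 (F : 'I_N -> qel n k) : (\sum_i F i).1.1 = \sum_i (F i).1.1.
  exact: (big_morph (fun x : qel n k => x.1.1)).
have p2 (F : 'I_N -> qel n k) : (\sum_i F i).1.2 = \sum_i (F i).1.2.
  exact: (big_morph (fun x : qel n k => x.1.2)).
have p3 (F : 'I_N -> qel n k) : (\sum_i F i).2 = \sum_i (F i).2.
  exact: (big_morph snd).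
have S b : polyfun (fun s : 'I_N -> CC => \sum_l s l * b l).
  by apply: polyfun_sum => l; apply: polyfunM; [exact: polyfun_var|exact: polyfun_const].
split=> i j.
- apply: polyfun_ext (S (fun l => (d l).1.1 i j)) => s.
  by rewrite p1 summxE; apply: eq_bigr => l _; rewrite mxE.
- apply: polyfun_ext (S (fun l => (d l).1.2 i j)) => s.
  by rewrite p2 summxE; apply: eq_bigr => l _; rewrite mxE.
apply: polyfun_ext (S (fun l => (d l).2 i j)) => s.
by rewrite p3 summxE; apply: eq_bigr => l _; rewrite mxE.
Qed.

Definition dirder (F : {mpoly CC[N]}) g g1 := \sum_j pairing g1 (e j) * F^`M(j).@[ev g].

(** Both sides say that the differential of [F] kills the tangent spaces of the coadjoint orbits,
    tested on basis elements or on all of q. Pointwise testing is enough since [ev] is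
    surjective. *)
Lemma sym_invariantP F :
  sym_invariant c F <-> (forall g x, in_q x -> dirder F g (coad x g) = 0).
Proof.
have E g i : (\sum_j struct_mx c i j * F^`M(j)).@[ev g] = dirder F g (coad (e i) g).
  rewrite rmorph_sum; apply: eq_bigr => j _; rewrite -pairing_coad -struct_mx_ev.
  by rewrite rmorphM [struct_mx_at _ _ _ _]mxE.
split=> [h g x|h i].
  case/(evP g) => a [-> _].
  have -> : dirder F g (coad (\sum_i a i *: e i) g) = \sum_i a i * dirder F g (coad (e i) g).
    rewrite /dirder; under [RHS]eq_bigr do rewrite mulr_sumr.
    rewrite [RHS]exchange_big; apply: eq_bigr => j _ /=.
    rewrite -pairing_coad; under [RHS]eq_bigr do rewrite mulrA.
    rewrite -mulr_suml; congr (_ * _).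
    under [RHS]eq_bigr do rewrite -pairing_coad.
    have D x1 y1 z1 : qbr (x1 + y1) z1 = qbr x1 z1 + qbr y1 z1 :> qel n k.
      rewrite /qbr /=; congr (_, _, _); rewrite ?mulmxDl ?mulmxDr.
      + by rewrite opprD addrACA.
      + by rewrite opprD addrACA.
      + by rewrite opprD addrACA.
    have Z b x1 z1 : qbr (b *: x1) z1 = b *: qbr x1 z1 :> qel n k.
      by rewrite /qbr /=; congr (_, _, _); rewrite -!scalemxAl -!scalemxAr -scalerBr.
    rewrite (big_morph (fun x1 => pairing g (qbr x1 (e j))) (id1 := 0) (op1 := +%R)) => [|x1 y1|].
    + by apply: eq_bigr => i _; rewrite Z pairingZr.
    + by rewrite D pairingDr.
    have -> : qbr 0 (e j) = 0 by rewrite /qbr /= !mul0mx !mulmx0 !subrr.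
    exact: pairing0r.
  by apply: big1 => i _; rewrite -E h meval0 mulr0.
apply: mpoly_meval0 => g; have [ga [hga _]] := ev_surj.
by rewrite -(meval_eq _ (hga g)) E h //; apply: in_q_basis.
Qed.

(** Degree two suffices because conjugating by [1 - t B] with [B] of square zero is quadratic in
    t. *)
Definition quadpath g0 g1 g2 t : qel n k := g0 + t *: g1 + t ^+ 2 *: g2.

Lemma path_deriv (F : {mpoly CC[N]}) g0 g1 g2 : exists p : {poly CC},
   (forall t, p.[t] = F.@[ev (quadpath g0 g1 g2 t)]) /\
   (forall t, p^`().[t] = dirder F (quadpath g0 g1 g2 t) (g1 + (2%:R * t) *: g2)).
Proof.
pose G j := (ev g0 j)%:P + ev g1 j *: 'X + ev g2 j *: 'X^2.
have hG t : (fun j => (G j).[t]) =1 ev (quadpath g0 g1 g2 t).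
  move=> j; rewrite /G !hornerE /= /ev !pairingDl !pairingZl; ring.
exists (mmap polyC G F); split=> t; first by rewrite horner_mmap_polyC; apply: meval_eq.
rewrite deriv_mmap_polyC horner_sum; apply: eq_bigr => j _.
rewrite hornerM horner_mmap_polyC mulrC (meval_eq _ (hG t)); congr (_ * _).
rewrite /G !derivD derivC !derivZ derivX derivXn !hornerE /= pairingDl pairingZl /ev; ring.
Qed.

(** The velocity of the path is tangent to the orbit at each of its points, so the polynomial t -> F
    has zero derivative. *)
Lemma path_invariant F g0 g1 g2 x : sym_invariant c F -> in_q x ->
  (forall t, g1 + (2%:R * t) *: g2 = coad x (quadpath g0 g1 g2 t)) ->
  forall t, F.@[ev (quadpath g0 g1 g2 t)] = F.@[ev g0].
Proof.
move=> /sym_invariantP hF hx h t; have [p [hp hd]] := path_deriv F g0 g1 g2.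
have p' : p^`() = 0 by apply: poly_horner0 => s; rewrite hd h hF.
rewrite -hp (poly_deriv0 p') hornerC -horner_coef0 hp /quadpath.
by rewrite expr0n /= !scale0r !addr0.
Qed.

Lemma path_invariant_deriv F g0 g1 g2 :
  (forall t, F.@[ev (quadpath g0 g1 g2 t)] = F.@[ev g0]) -> dirder F g0 g1 = 0.
Proof.
move=> h; have [p [hp hd]] := path_deriv F g0 g1 g2.
have -> : dirder F g0 g1 = p^`().[0].
  by rewrite hd /quadpath mulr0 expr0n /= !scale0r !addr0.
have -> : p = (F.@[ev g0])%:P.
  by apply/eqP; rewrite -subr_eq0; apply/eqP/poly_horner0 => t; rewrite !hornerE hp h subrr.
by rewrite derivC horner0.
Qed.

End Basis.

(** Group-level invariance by polynomial substitutions: the function lives on q^*, is fixed by the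
    abelian normal subgroup, and is fixed by the elements [1 - B] with [B] of square zero, among
    them the transvections generating SL_n. *)
Definition qinvariant n k (f : qel n k -> CC) : Prop :=
  [/\ forall g a, f (g + dualshift n k a) = f g,
      forall A X Y v w, f (A + X *m w + v *m Y, X, Y) = f (A, X, Y)
    & forall B A X Y, B *m B = 0 -> \tr B = 0 ->
       f ((1%:M - B) *m A *m (1%:M + B), (1%:M - B) *m X, Y *m (1%:M + B)) = f (A, X, Y)].

Section Invariance.
Variables (n k N : nat) (e : 'I_N -> qel n k) (c : 'I_N -> 'I_N -> 'I_N -> CC).
Hypotheses (n_gt0 : (0 < n)%N) (he : is_q_basis e) (hc : struct_consts e c).

Lemma sym_invariant_qinvariant F :
  sym_invariant c F -> qinvariant (fun g => F.@[ev e g]).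
Proof.
move=> hF; split.
- by move=> g a; apply: meval_eq; apply: ev_shift.
- move=> A X Y v w.
  (* The element (0, -v, w) of the ideal moves only A, and its velocity depends only on X and Y, so
     the path is a straight line. *)
  have := @path_invariant _ _ _ _ _ n_gt0 he hc F (A, X, Y) (X *m w + v *m Y, 0, 0) 0 (0, - v, w) hF.
  rewrite /in_q /= mxtrace0 => /(_ erefl) H.
  have {}H := H _ 1; rewrite -H.
    by congr (_.@[ev e _]); rewrite /quadpath scaler0 addr0 scale1r /=; congr (_, _, _); rewrite /= ?addr0 ?addrA.
  move=> t; rewrite scaler0 addr0 /quadpath scaler0 addr0 /coad /=; congr (_, _, _); rewrite /= ?scaler0 ?addr0.
  + by rewrite mulmx0 mul0mx subrr sub0r mulNmx opprK addrC.
  + by rewrite mul0mx oppr0.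
  + by rewrite mulmx0.
move=> B A X Y B2 tB.
(* The path is the conjugate of (A, X, Y) by [1 - t B], whose matrix part is A + t (AB - BA) - t^2
   BAB. As B^2 = 0, its velocity is the coadjoint vector of (B, 0, 0) at the current point. *)
pose g1 := (A *m B - B *m A, - (B *m X), Y *m B) : qel n k.
have := @path_invariant _ _ _ _ _ n_gt0 he hc F (A, X, Y) g1 (- (B *m A *m B), 0, 0) (B, 0, 0) hF tB.
have BB p (M : 'M_(n, p)) : B *m (B *m M) = 0 by rewrite mulmxA B2 mul0mx.
have BB' p (M : 'M_(p, n)) : M *m B *m B = 0 by rewrite -mulmxA B2 mulmx0.
move=> H; rewrite -(H _ 1).
  congr (_.@[ev e _]); rewrite /quadpath expr1n !scale1r; congr (_, _, _) => /=.
  + rewrite mulmxBl mul1mx mulmxDr mulmx1 mulmxBl.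
    by apply/matrixP => i j; rewrite !mxE; ring.
  + by rewrite addr0 mulmxBl mul1mx.
  + by rewrite addr0 mulmxDr mulmx1.
move=> t; rewrite /coad /quadpath /=; congr (_, _, _) => /=.
- rewrite mul0mx mulmx0 subr0 addr0 !mulmxDl !mulmxDr -!scalemxAl -!scalemxAr.
  rewrite !mulmxBl !mulmxBr !mulNmx !mulmxN !mulmxA ?BB' ?B2 ?mul0mx ?BB'.
  by apply/matrixP => i j; rewrite !mxE; ring.
- by rewrite !scaler0 !addr0 mulmxDr -scalemxAr mulmxN BB oppr0 scaler0 addr0.
- by rewrite !scaler0 !addr0 mulmxDl -scalemxAl BB' scaler0 addr0.
Qed.

(** Differentiating the substitutions gives the vanishing along square-zero matrices and along the
    ideal; it remains that square-zero matrices span sl_n. *)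
Lemma qinvariant_sym_invariant F :
  qinvariant (fun g => F.@[ev e g]) -> sym_invariant c F.
Proof.
case=> _ hT hS; apply/(sym_invariantP n_gt0 he hc) => g x hx.
have dD g1 g2 : dirder e F g (g1 + g2) = dirder e F g g1 + dirder e F g g2.
  by rewrite /dirder -big_split; apply: eq_bigr => j _; rewrite /= pairingDl mulrDl.
have dZ a g1 : dirder e F g (a *: g1) = a * dirder e F g g1.
  by rewrite /dirder mulr_sumr; apply: eq_bigr => j _; rewrite /= pairingZl mulrA.
case: g x hx dD dZ => -[A X] Y [[B v] w] /=; rewrite /in_q /= => tB dD dZ.
pose D (B : 'M[CC]_n) := dirder e F (A, X, Y) (A *m B - B *m A, - (B *m X), Y *m B).
have DD B1 B2 : D (B1 + B2) = D B1 + D B2.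
  rewrite /D -dD; congr (dirder _ _ _ _); congr (_, _, _); rewrite /= ?mulmxDr ?mulmxDl ?opprD //.
  by rewrite addrACA.
have DZ a B1 : D (a *: B1) = a * D B1.
  rewrite /D -dZ; congr (dirder _ _ _ _); congr (_, _, _); rewrite /= -?scalemxAl -?scalemxAr ?scalerBr //.
  by rewrite scalerN.
have D2 B1 : B1 *m B1 = 0 -> \tr B1 = 0 -> D B1 = 0.
  move=> B2 t1; apply: (@path_invariant_deriv _ _ _ _ _ _ _ (- (B1 *m A *m B1), 0, 0)) => t.
  have tB2 : (t *: B1) *m (t *: B1) = 0 by rewrite -scalemxAl -scalemxAr B2 !scaler0.
  have ttB : \tr (t *: B1) = 0 by rewrite mxtraceZ t1 mulr0.
  rewrite -(hS _ A X Y tB2 ttB); congr (_.@[ev e _]); rewrite /quadpath; congr (_, _, _) => /=.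
  + rewrite !mulmxBl !mulmxDr !mul1mx !mulmx1 -!scalemxAr -!scalemxAl.
    by apply/matrixP => i j; rewrite !mxE; ring.
  + by rewrite scaler0 addr0 mulmxBl mul1mx -scalemxAl scalerN.
  + by rewrite scaler0 addr0 mulmxDr mulmx1 -scalemxAr.
have trd (i j : 'I_n) : \tr (delta_mx i j : 'M[CC]_n) = (i == j)%:R.
  rewrite /mxtrace (bigD1 i) //= big1 ?addr0 ?mxE ?eqxx //= => l /negPf li.
  by rewrite mxE li.
have Dd i j : i != j -> D (delta_mx i j) = 0.
  move=> ij; apply: D2; first by rewrite mul_delta_mx_0 // eq_sym.
  by rewrite trd (negPf ij).
have Ddd i j : D (delta_mx i i - delta_mx j j) = 0.
  have [->|ij] := eqVneq i j; first by rewrite subrr -(scale0r (0 : 'M[CC]_n)) DZ mul0r.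
  (* The matrix with rows (1, 1) and (-1, -1) has square zero; its off-diagonal part is already
     handled, which leaves the diagonal difference. *)
  have : D (delta_mx i i - delta_mx j j + delta_mx i j - delta_mx j i) = 0.
    apply: D2; last first.
      by rewrite linearB /= mxtraceD linearB /= !trd !eqxx (negPf ij) eq_sym (negPf ij) addr0 subrr subr0.
    rewrite !(mulmxBl, mulmxDl, mulmxBr, mulmxDr, mulNmx, mulmxN) !mul_delta_mx_cond.
    rewrite !eqxx (negPf ij) eq_sym (negPf ij) /= !mulr1n !mulr0n.
    by apply/matrixP => a b; rewrite !mxE; ring.
  have E : delta_mx i i - delta_mx j j + delta_mx i j - delta_mx j i =
     (delta_mx i i - delta_mx j j) + (delta_mx i j + (-1) *: delta_mx j i) :> 'M[CC]_n.
    by rewrite scaleN1r addrA.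
  by rewrite E DD [D (delta_mx i j + _)]DD DZ !Dd // 1?eq_sym // mulr0 !addr0.
pose i0 := Ordinal n_gt0.
have Dsum (I : finType) (H : I -> 'M[CC]_n) : D (\sum_i H i) = \sum_i D (H i).
  by apply: big_morph => //; rewrite -(scale0r (0 : 'M[CC]_n)) DZ mul0r.
have DB : D B = 0.
  have -> : B = \sum_i \sum_j B i j *: (delta_mx i j - (i == j)%:R *: delta_mx i0 i0).
    under eq_bigr do under eq_bigr do rewrite scalerBr.
    under eq_bigr do rewrite sumrB.
    rewrite sumrB -matrix_sum_delta.
    suff -> : \sum_i \sum_j B i j *: ((i == j)%:R *: delta_mx i0 i0) = \tr B *: delta_mx i0 i0 :> 'M[CC]_n.
      by rewrite tB scale0r subr0.
    rewrite scaler_suml; apply: eq_bigr => i _; rewrite (bigD1 i) //= eqxx scale1r big1 ?addr0 //.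
    by move=> j; rewrite eq_sym => /negPf ->; rewrite scale0r scaler0.
  rewrite Dsum big1 // => i _; rewrite Dsum big1 // => j _; rewrite DZ.
  have [->|ij] := eqVneq i j; first by rewrite scale1r Ddd mulr0.
  by rewrite scale0r subr0 Dd // mulr0.
have -> : coad (B, v, w) (A, X, Y) = (A *m B - B *m A, - (B *m X), Y *m B) + (X *m w - v *m Y, 0, 0).
  by rewrite /coad /=; congr (_, _, _); rewrite /= ?addr0 // addrA addrAC.
rewrite dD -/(D B) DB add0r.
apply: (@path_invariant_deriv _ _ _ _ _ _ _ 0) => t.
rewrite -(hT A X Y (- (t *: v)) (t *: w)); congr (_.@[ev e _]); rewrite /quadpath scaler0 addr0.
congr (_, _, _) => /=; rewrite ?scaler0 ?addr0 //.
by rewrite scalerBr mulNmx -scalemxAl -scalemxAr addrA.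
Qed.
End Invariance.

(** * Normal form of a point with [Y X] invertible *)

Section Transvections.
Variable F : fieldType.

Inductive transv_gen n : 'M[F]_n -> Prop :=
| transv_gen1 : transv_gen 1%:M
| transv_genM (u : 'cV_n) (v : 'rV_n) g : v *m u = 0 -> transv_gen g ->
    transv_gen ((1%:M - u *m v) *m g).

Lemma det_1sub_mul n (u : 'cV[F]_n) (v : 'rV_n) : \det (1%:M - u *m v) = 1 - (v *m u) 0 0.
Proof.
have E : block_mx 1%:M 0 u 1%:M *m block_mx 1%:M v 0 (1%:M - u *m v) =
         block_mx (1%:M - v *m u) v 0 1%:M *m block_mx 1%:M 0 u 1%:M :> 'M_(1 + n).
  rewrite !mulmx_block !mul1mx !mulmx1 !mul0mx !mulmx0 !addr0 ?add0r ?subrK.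
  by congr block_mx; rewrite addrC subrK.
move/(congr1 determinant): E; rewrite !det_mulmx !det_lblock !det_ublock !det1 !mul1r !mulr1 => ->.
by rewrite det_mx11 !mxE.
Qed.

Lemma transv_gen_mul n (g h : 'M[F]_n) : transv_gen g -> transv_gen h -> transv_gen (g *m h).
Proof.
by move=> gg gh; elim: gg => [|u v g' uv _ IH]; rewrite ?mul1mx // -mulmxA; constructor.
Qed.

Lemma transv_gen_transv n (u : 'cV[F]_n) (v : 'rV_n) : v *m u = 0 -> transv_gen (1%:M - u *m v).
Proof. by move=> uv; rewrite -[_ - _]mulmx1; apply: (transv_genM uv); apply: transv_gen1. Qed.

Lemma transv_gen_det n (g : 'M[F]_n) : transv_gen g -> \det g = 1.
Proof.
elim=> [|u v h uv _ IH]; first exact: det1.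
by rewrite det_mulmx IH det_1sub_mul uv mxE subr0 mulr1.
Qed.

Lemma transv_gen_block n (g : 'M[F]_n) : transv_gen g ->
  transv_gen (block_mx 1%:M 0 0 g : 'M_(1 + n)).
Proof.
elim=> [|u v h uv _ IH]; first by rewrite -scalar_mx_block; constructor.
have -> : block_mx 1%:M 0 0 ((1%:M - u *m v) *m h) =
   (1%:M - col_mx 0 u *m row_mx 0 v) *m block_mx 1%:M 0 0 h :> 'M_(1 + n).
  rewrite mul_col_row !mul0mx mulmx0 scalar_mx_block opp_block_mx add_block_mx !oppr0 !addr0.
  by rewrite mulmx_block !mul1mx !mul0mx !mulmx0 !addr0 !add0r.
by constructor=> //; rewrite mul_row_col mul0mx add0r.
Qed.

(** With v reading the i-th coordinate, scaled to 1 on x, the map 1 - (x - z) v sends x to z. It is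
    a transvection because x - z has i-th coordinate zero. *)
Lemma transv_gen_step n (x z : 'cV[F]_n) i : x i 0 != 0 -> z i 0 = x i 0 ->
  exists2 h, transv_gen h & h *m x = z.
Proof.
move=> xi zi; pose v : 'rV[F]_n := (x i 0)^-1 *: delta_mx 0 i.
have hv (y : 'cV[F]_n) : v *m y = ((x i 0)^-1 * y i 0)%:M.
  rewrite -scalemxAl -rowE; apply/matrixP => a b; rewrite !ord1 !mxE eqxx mulr1n //.
exists (1%:M - (x - z) *m v).
  by apply: transv_gen_transv; rewrite hv !mxE zi subrr mulr0 rmorph0.
by rewrite mulmxBl mul1mx -mulmxA hv mulVf // mulmx1 opprB addrCA subrr addr0.
Qed.

(** Each step must keep some nonzero coordinate fixed. Two steps suffice if x has a nonzero entry
    besides the first; a multiple of the first basis vector needs a detour through the second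
    one. *)
Lemma transv_gen_e0 n (x : 'cV[F]_n.+2) : x != 0 ->
  exists2 h, transv_gen h & h *m delta_mx 0 0 = x.
Proof.
move=> x0; have [[i [i0 xi]]|hx] :
   (exists i, i != 0 /\ x i 0 != 0) \/ (forall i, i != 0 -> x i 0 = 0).
  have [/existsP [i /andP[i0 xi]]|/existsPn H] := boolP [exists i, (i != 0) && (x i 0 != 0)].
    by left; exists i.
  by right=> i i0; move: (H i); rewrite i0 /= negbK => /eqP.
- pose z := delta_mx 0 0 + x i 0 *: delta_mx i 0 : 'cV[F]_n.+2.
  have z0 : z 0 0 = 1 by rewrite !mxE !eqxx [0 == i]eq_sym (negPf i0) /= mulr0 addr0.
  have zi : z i 0 = x i 0 by rewrite !mxE !eqxx (negPf i0) /= mulr1 add0r.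
  have d0 : (delta_mx 0 0 : 'cV[F]_n.+2) 0 0 != 0 by rewrite mxE !eqxx oner_neq0.
  have z0' : z 0 0 = (delta_mx 0 0 : 'cV[F]_n.+2) 0 0 by rewrite z0 mxE !eqxx.
  have [h1 t1 e1] := transv_gen_step d0 z0'.
  have zi' : z i 0 != 0 by rewrite zi.
  have [h2 t2 e2] := transv_gen_step zi' (esym zi).
  by exists (h2 *m h1); [exact: transv_gen_mul|rewrite -mulmxA e1].
have xE : x = x 0 0 *: delta_mx 0 0.
  apply/matrixP => i j; rewrite ord1 !mxE; have [->|i0] := eqVneq i 0; first by rewrite ?eqxx mulr1.
  by rewrite hx // mulr0.
have x00 : x 0 0 != 0 by apply: contraNneq x0 => e; rewrite xE e scale0r.
pose z1 := delta_mx 0 0 + delta_mx 1 0 : 'cV[F]_n.+2.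
pose z2 := x 0 0 *: delta_mx 0 0 + delta_mx 1 0 : 'cV[F]_n.+2.
have d0 : (delta_mx 0 0 : 'cV[F]_n.+2) 0 0 != 0 by rewrite mxE !eqxx oner_neq0.
have d1 : z1 0 0 = (delta_mx 0 0 : 'cV[F]_n.+2) 0 0 by rewrite !mxE /= addr0.
have z1n : z1 1 0 != 0 by rewrite !mxE /= add0r oner_neq0.
have d2 : z2 1 0 = z1 1 0 by rewrite !mxE /= mulr0.
have d3 : z2 0 0 = x 0 0 by rewrite !mxE /= mulr1 addr0.
have z2n : z2 0 0 != 0 by rewrite d3.
have [h1 t1 e1] := transv_gen_step d0 d1.
have [h2 t2 e2] := transv_gen_step z1n d2.
have [h3 t3 e3] := transv_gen_step z2n (esym d3).
exists (h3 *m (h2 *m h1)); first by apply: (transv_gen_mul t3); apply: transv_gen_mul.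
by rewrite -!mulmxA e1 e2 e3.
Qed.

(** Transvections move the first basis vector to the first column of [g]. Dividing by them leaves a
    smaller block of determinant 1 times one transvection that carries the first row. *)
Lemma det1_transv_gen n (g : 'M[F]_n) : \det g = 1 -> transv_gen g.
Proof.
elim: n g => [|n IH] g dg; first by have -> : g = 1%:M; [apply/matrixP => -[]|constructor].
case: n IH g dg => [|n] IH g dg.
  by rewrite [g]mx11_scalar -det_mx11 dg; constructor.
pose x := col 0 g.
have x0 : x != 0.
  apply/eqP => x0; move/eqP: dg; apply/negP; rewrite eq_sym (expand_det_col _ 0) big1 ?oner_neq0 // => i _.
  by move/matrixP/(_ i 0): x0; rewrite !mxE => ->; rewrite mul0r.
have [h th hx] := transv_gen_e0 x0.
have uh : h \in unitmx by rewrite unitmxE (transv_gen_det th) unitr1.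
have [k kh] : exists k : 'M_(1 + n.+1), k = invmx h *m g by exists (invmx h *m g).
have dk : \det k = 1 by rewrite kh det_mulmx det_inv (transv_gen_det th) invr1 mul1r.
have ck : col 0 k = delta_mx 0 0 by rewrite colE kh -mulmxA -colE -/x -hx mulmxA mulVmx // mul1mx.
have e1 : ulsubmx k = 1%:M.
  apply/matrixP => i j; rewrite !ord1; have /matrixP/(_ 0 0) := ck; rewrite !mxE !eqxx /= => <-.
  by congr (k _ _); apply/val_inj.
have e2 : dlsubmx k = 0.
  apply/matrixP => i j; rewrite !ord1 !mxE.
  have -> : lshift n.+1 0 = 0 :> 'I_(1 + n.+1) by apply/val_inj.
  by have /matrixP/(_ (rshift 1 i) 0) := ck; rewrite mxE => ->; rewrite mxE.
have kE : k = block_mx 1%:M 0 0 (drsubmx k) *m block_mx 1%:M (ursubmx k) 0 1%:M.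
  by rewrite mulmx_block !mul1mx !mul0mx !mulmx1 !mulmx0 !addr0 !add0r -{1}[k]submxK e1 e2.
have -> : g = h *m k by rewrite kh mulmxA mulmxV // mul1mx.
apply: transv_gen_mul => //; rewrite kE; apply: transv_gen_mul.
  apply/transv_gen_block/IH; move: dk; rewrite {1}kE det_mulmx det_lblock det_ublock.
  by rewrite !det1 !mul1r mulr1.
have -> : block_mx 1%:M (ursubmx k) 0 1%:M = 1%:M - col_mx 1%:M 0 *m row_mx 0 (- ursubmx k) :> 'M_(1 + n.+1).
  rewrite mul_col_row !mul0mx mulmx0 mul1mx scalar_mx_block opp_block_mx add_block_mx.
  by rewrite !oppr0 opprK !addr0 add0r.
have vu : row_mx 0 (- ursubmx k) *m col_mx 1%:M 0 = 0 :> 'M_1.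
  by rewrite mul_row_col mul0mx mulmx0 addr0.
exact: (transv_gen_transv vu).
Qed.
End Transvections.

Lemma qinvariant_conj n k (f : qel n k -> CC) g h A X Y : qinvariant f ->
  g *m h = 1%:M -> \det g = 1 -> f (g *m A *m h, g *m X, Y *m h) = f (A, X, Y).
Proof.
move=> [_ _ hS] gh /det1_transv_gen tg; move: tg h gh A X Y.
elim=> {g} [|u v g uv _ IH] h; first by rewrite mul1mx => -> A X Y; rewrite !mul1mx !mulmx1.
move=> gh A X Y.
have uvuv : (u *m v) *m (u *m v) = 0 by rewrite mulmxA -(mulmxA u) uv mulmx0 mul0mx.
have tuv : \tr (u *m v) = 0 by rewrite mxtrace_mulC uv mxtrace0.
have inv : (1%:M + u *m v) *m (1%:M - u *m v) = 1%:M.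
  by rewrite mulmxBr mulmx1 mulmxDl mul1mx uvuv addr0 addrK.
have inv' : (1%:M - u *m v) *m (1%:M + u *m v) = 1%:M by apply: mulmx1C.
pose h' := h *m (1%:M - u *m v).
have gh' : g *m h' = 1%:M.
  apply: mulmx1C; rewrite /h' -mulmxA; exact: mulmx1C.
have hE : h = h' *m (1%:M + u *m v) by rewrite /h' -mulmxA inv' mulmx1.
by rewrite hE -(IH _ gh' A X Y) -(hS _ (g *m A *m h') (g *m X) (Y *m h') uvuv tuv) !mulmxA.
Qed.

(* [iota] and [pi] factor the projection [1 - X (Y X)^-1 Y] onto [ker Y] along [im X]. *)
Lemma complement_factor k m (X : 'M[CC]_(k + m, k)) (Y : 'M_(k, k + m)) : Y *m X \in unitmx ->
  exists (iota : 'M_(k + m, m)) (pi : 'M_(m, k + m)),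
   [/\ pi *m X = 0, Y *m iota = 0, pi *m iota = 1%:M
     & iota *m pi = 1%:M - X *m invmx (Y *m X) *m Y].
Proof.
set Z := Y *m X => uZ; set p := 1%:M - X *m invmx Z *m Y.
have Yp : Y *m p = 0 by rewrite mulmxBr mulmx1 !mulmxA -/Z mulmxV // mul1mx subrr.
have pX : p *m X = 0 by rewrite mulmxBl mul1mx -!mulmxA -/Z mulVmx // mulmx1 subrr.
have pp : p *m p = p by rewrite {2}/p mulmxBr mulmx1 !mulmxA pX !mul0mx subr0.
have cr := mulmx_base p.
have rc : row_base p *m col_base p = 1%:M.
  have /row_fullP[L hL] := col_base_full p; have /row_freeP[R hR] := row_base_free p.
  have e : col_base p *m row_base p *m (col_base p *m row_base p) = col_base p *m row_base p.
    by rewrite !cr pp.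
  have {}e : L *m (col_base p *m row_base p *m (col_base p *m row_base p)) *m R =
      L *m (col_base p *m row_base p) *m R by rewrite e.
  move: (col_base p) (row_base p) hL hR e => C R' hL hR.
  by rewrite !mulmxA hL mul1mx -!mulmxA hR !mulmx1.
(* The rank of a projection is its trace, here (k + m) - k, in characteristic zero. *)
have rm : \rank p = m.
  apply/eqP; rewrite -(eqr_nat CC).
  have := mxtrace_mulC (row_base p) (col_base p); rewrite rc cr mxtrace1 => ->.
  rewrite /p linearB /= mxtrace1 -mulmxA mxtrace_mulC -mulmxA -/Z mulVmx // mxtrace1.
  by rewrite natrD addrC addKr.
move: (col_base p) (row_base p) cr rc; rewrite rm => iota pi cr rc.
exists iota, pi; split=> //.
- transitivity (pi *m iota *m pi *m X); first by rewrite rc mul1mx.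
  by rewrite -(mulmxA pi) cr -mulmxA pX mulmx0.
transitivity (Y *m iota *m (pi *m iota)); first by rewrite rc mulmx1.
by rewrite mulmxA -(mulmxA Y) cr Yp mul0mx.
Qed.

(** The rows of Y and [pi] form a frame with inverse (X Z^-1, [iota]). Its determinant is corrected
    by rescaling one coordinate of the complement, which is why the complement has size [m.+1]. *)
Lemma exists_det1_frame k m (X : 'M[CC]_(k + m.+1, k)) (Y : 'M_(k, k + m.+1)) :
  Y *m X \in unitmx -> exists g h : 'M[CC]_(k + m.+1),
  [/\ g *m h = 1%:M, \det g = 1, g *m X = col_mx (Y *m X) 0 & Y *m h = row_mx 1%:M 0].
Proof.
move=> uZ; have [iota [pi [piX Yi pii ipi]]] := complement_factor uZ.
set Z := Y *m X in uZ ipi *.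
pose g0 := col_mx Y pi; pose h0 := row_mx (X *m invmx Z) iota.
have gh0 : g0 *m h0 = 1%:M.
  rewrite mul_col_row !mulmxA -/Z mulmxV // Yi piX mul0mx pii scalar_mx_block //.
have d0 : \det g0 != 0.
  by apply/negP => /eqP d; have /eqP := congr1 determinant gh0; rewrite det_mulmx d mul0r det1 eq_sym oner_eq0.
pose D := diag_mx (\row_(j < m.+1) if j == 0 then (\det g0)^-1 else 1) : 'M[CC]_m.+1.
have dD : \det D = (\det g0)^-1.
  rewrite det_diag (bigD1 0) //= mxE eqxx big1 ?mulr1 // => j /negPf j0; by rewrite mxE j0.
have uD : D \in unitmx by rewrite unitmxE dD unitrV unitfE.
exists (block_mx 1%:M 0 0 D *m g0), (h0 *m block_mx 1%:M 0 0 (invmx D)); split.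
- rewrite mulmxA -(mulmxA _ g0) gh0 mulmx1 mulmx_block !mul1mx !mul0mx !mulmx0 mulmxV //.
  by rewrite !addr0 add0r -scalar_mx_block.
- by rewrite det_mulmx det_lblock det1 mul1r dD mulVf.
- have g0X : g0 *m X = col_mx Z 0 by rewrite mul_col_mx piX.
  by rewrite -mulmxA g0X mul_block_col mul1mx !mul0mx mulmx0 !addr0.
have Yh0 : Y *m h0 = row_mx 1%:M 0 by rewrite mul_mx_row mulmxA -/Z mulmxV // Yi.
by rewrite mulmxA Yh0 mul_row_block mul1mx !mul0mx mulmx0 !addr0.
Qed.

(** In the frame, X w reaches every entry in the first k rows of A because Z is invertible, and v Y
    every entry in the first k columns; only the lower right block d resists. It is chosen before
    [f], so one normal form serves all invariants. *)
Lemma qinvariant_slice k m A (X : 'M[CC]_(k + m.+1, k)) (Y : 'M_(k, k + m.+1)) :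
  Y *m X \in unitmx -> exists d, forall f : qel (k + m.+1) k -> CC, qinvariant f ->
  f (A, X, Y) = f (block_mx 0 0 0 d, col_mx (Y *m X) 0, row_mx 1%:M 0).
Proof.
move=> uZ; have [g [h [gh dg gX Yh]]] := exists_det1_frame uZ.
exists (drsubmx (g *m A *m h)) => f hf.
rewrite -(qinvariant_conj A X Y hf gh dg) gX Yh.
case: hf => _ hT _; set M := g *m A *m h; set Z := Y *m X in uZ *.
pose v := col_mx 0 (- dlsubmx M) : 'M[CC]_(k + m.+1, k).
pose w := row_mx (- (invmx Z *m ulsubmx M)) (- (invmx Z *m ursubmx M)) : 'M[CC]_(k, k + m.+1).
rewrite -(hT M _ _ v w); congr (f (_, _, _)).
rewrite /v /w !mul_col_row !mul0mx !mulmx0 mulmx1 !mulmxN !mulmxA mulmxV // !mul1mx.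
by rewrite -{1}[M]submxK !add_block_mx !addr0 !subrr.
Qed.

(** * The bordered characteristic polynomial *)

Section BlockDet.
Variables (R : comNzRingType) (k m : nat).

(** The permutation exchanging the outer blocks. Its sign is never computed: knowing that it squares
    to 1 is enough. *)
Definition flip_mx : 'M[R]_(k + m + k) :=
  block_mx (block_mx 0 0 0 1%:M) (col_mx 1%:M 0) (row_mx 1%:M 0) 0.

Lemma flip_mx_sqr : flip_mx *m flip_mx = 1%:M.
Proof.
rewrite mulmx_block mulmx_block mul_block_col mul_row_block mul_col_row mul_row_col.
rewrite !mulmx0 !mul0mx !mulmx1 !addr0 !add0r add_block_mx !addr0 !add0r.
by rewrite row_mx0 col_mx0 -!scalar_mx_block.
Qed.

Lemma det_flip_sqr : \det flip_mx ^+ 2 = 1.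
Proof. by rewrite expr2 -det_mulmx flip_mx_sqr det1. Qed.

Lemma det_bordered (T S : 'M[R]_k) (C : 'M[R]_m) (X2 : 'M_(m, k)) :
  \det (block_mx (block_mx T 0 0 C) (col_mx S X2) (row_mx 1%:M 0) 0) =
  \det flip_mx * (\det S * \det C).
Proof.
have E : block_mx (block_mx T 0 0 C) (col_mx S X2) (row_mx 1%:M 0) 0 =
   block_mx 1%:M (col_mx T 0) 0 1%:M *m block_mx (block_mx S 0 X2 C) 0 0 1%:M *m flip_mx :> 'M_(k + m + k).
  rewrite /flip_mx !mulmx_block !mul1mx !mulmx1 !mul0mx !mulmx0 !addr0 !add0r.
  rewrite mulmx_block mul_block_col mul_col_row !mulmx1 !mul1mx !mul0mx !mulmx0 !addr0 !add0r.
  by rewrite add_block_mx !addr0 !add0r.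
by rewrite E !det_mulmx !det_ublock !det_lblock !det1 !mul1r mulr1 mulrC.
Qed.
End BlockDet.

Section Chi.
Variables n k : nat.
Implicit Types g : qel n k.

Definition chi g : {poly CC} := \det (block_mx (char_poly_mx g.1.1)
  (map_mx polyC g.1.2) (map_mx polyC g.2) 0).

(** The added terms are multiples of the border, so row and column operations remove them. *)
Lemma chi_trans A X Y v w : chi (A + X *m w + v *m Y, X, Y) = chi (A, X, Y).
Proof.
rewrite /chi /=; set Xp := map_mx polyC X; set Yp := map_mx polyC Y.
have -> : block_mx (char_poly_mx (A + X *m w + v *m Y)) Xp Yp 0 =
   block_mx 1%:M (- map_mx polyC v) 0 1%:M *m block_mx (char_poly_mx A) Xp Yp 0
    *m block_mx 1%:M 0 (- map_mx polyC w) 1%:M.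
  rewrite !mulmx_block !mul1mx !mulmx1 !mul0mx !mulmx0 !addr0 !add0r !mulNmx !mulmxN.
  rewrite mul0mx oppr0 /char_poly_mx !map_mxD !map_mxM /= -/Xp -/Yp.
  congr block_mx; rewrite ?oppr0 ?addr0 //.
  by rewrite !opprD !addrA addrAC.
by rewrite !det_mulmx det_ublock det_lblock !det1 !mul1r mulr1.
Qed.

Lemma chi_conj A X Y G H : G *m H = 1%:M -> chi (G *m A *m H, G *m X, Y *m H) = chi (A, X, Y).
Proof.
move=> GH; rewrite /chi /=.
have GHp : map_mx polyC G *m map_mx polyC H = 1%:M by rewrite -map_mxM GH map_mx1.
have -> : block_mx (char_poly_mx (G *m A *m H)) (map_mx polyC (G *m X)) (map_mx polyC (Y *m H)) 0 =
   block_mx (map_mx polyC G) 0 0 1%:M *m block_mx (char_poly_mx A) (map_mx polyC X) (map_mx polyC Y) 0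
    *m block_mx (map_mx polyC H) 0 0 1%:M.
  rewrite !mulmx_block !mul1mx !mulmx1 !mul0mx !mulmx0 !addr0 !add0r.
  rewrite /char_poly_mx !map_mxM; congr block_mx; rewrite ?mul0mx //.
  rewrite mulmxBr mulmxBl; congr (_ - _).
  by rewrite -mulmxA mul_scalar_mx -scalemxAr GHp scalemx1.
rewrite !det_mulmx !det_ublock !det1 !mulr1 mulrAC.
by rewrite -det_mulmx GHp det1 mul1r.
Qed.

Lemma chi_shift g a : chi (g + dualshift n k a) = chi g \Po ('X - a%:P).
Proof.
rewrite /chi -[_ \Po _]/((comp_poly _) _) -det_map_mx; congr (\det _).
rewrite map_block_mx map_mx0 /=; congr block_mx.
- apply/matrixP => i j; rewrite !mxE raddfB /= comp_polyC raddfMn /= comp_polyX.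
  by rewrite polyCD mulrnBl polyCMn opprD addrA addrAC.
- by apply/matrixP => i j; rewrite !mxE comp_polyC addr0.
by apply/matrixP => i j; rewrite !mxE comp_polyC addr0.
Qed.
End Chi.

Lemma chi_slice k m (d : 'M[CC]_m) (Z : 'M[CC]_k) :
  chi (block_mx 0 0 0 d, col_mx Z 0, row_mx 1%:M 0) =
  (\det (flip_mx CC k m) * \det Z) *: char_poly d.
Proof.
rewrite /chi /= map_col_mx map_row_mx map_mx1 !map_mx0.
have -> : char_poly_mx (block_mx 0 0 0 d) = block_mx 'X%:M 0 0 (char_poly_mx d) :> 'M_(k + m).
  by rewrite /char_poly_mx map_block_mx !map_mx0 scalar_mx_block opp_block_mx add_block_mx !oppr0 !addr0 ?add0r.
rewrite det_bordered det_map_mx -mul_polyC polyCM -mulrA; congr (_ * _).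
by rewrite -det_map_mx /flip_mx map_block_mx map_block_mx map_col_mx map_row_mx !map_mx1 !map_mx0.
Qed.

(** Serves points with singular Y X, outside the reach of the slice. The power of the variable on
    the left is the determinant of the elimination matrix, which thus needs no division by the
    variable. *)
Lemma chi_degenerate k m (A12 : 'M[CC]_(k, m)) Z X2 :
  'X^k * chi (block_mx 0 A12 0 0, col_mx Z X2, row_mx 1%:M 0) =
  \det (flip_mx CC k m) *: (\det ('X *: map_mx polyC Z + map_mx polyC (A12 *m X2)) * 'X^m).
Proof.
rewrite /chi /= map_col_mx map_row_mx map_mx1 !map_mx0.
have -> : char_poly_mx (block_mx 0 A12 0 0) = block_mx 'X%:M (- map_mx polyC A12) 0 'X%:M :> 'M_(k + m).
  by rewrite /char_poly_mx map_block_mx !map_mx0 scalar_mx_block opp_block_mx add_block_mx !oppr0 !addr0 ?add0r.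
set M := block_mx _ _ _ _.
pose L := block_mx (block_mx 'X%:M (map_mx polyC A12) 0 1%:M) 0 0 1%:M : 'M[{poly CC}]_(k + m + k).
have dL : \det L = 'X^k by rewrite det_ublock det_ublock !det1 !mulr1 det_scalar.
rewrite -dL -det_mulmx.
have -> : L *m M = block_mx (block_mx ('X%:M *m 'X%:M) 0 0 'X%:M)
    (col_mx ('X *: map_mx polyC Z + map_mx polyC (A12 *m X2)) (map_mx polyC X2)) (row_mx 1%:M 0) 0.
  rewrite /L /M mulmx_block mulmx_block mul_block_col !mul1mx !mul0mx !mulmx0 !addr0 !add0r.
  by rewrite mulmxN !mul_scalar_mx mul_mx_scalar addNr -map_mxM.
rewrite det_bordered det_scalar -mul_polyC; congr (_ * _).
by rewrite -det_map_mx /flip_mx map_block_mx map_block_mx map_col_mx map_row_mx !map_mx1 !map_mx0.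
Qed.

(** * Invariant polynomial functions *)

Definition polyfun_coefs p (f : ('I_p -> CC) -> {poly CC}) : Prop :=
  forall i, polyfun (fun g => (f g)`_i).

Section PolyfunCoefs.
Variable p : nat.
Implicit Types f h : ('I_p -> CC) -> {poly CC}.

Lemma polyfun_coefs_ext f h : (forall g, f g = h g) -> polyfun_coefs f -> polyfun_coefs h.
Proof. by move=> e H i; apply: polyfun_ext (H i) => g; rewrite e. Qed.
Lemma polyfun_coefs_const q : polyfun_coefs (fun _ : 'I_p -> CC => q).
Proof. by move=> i; apply: polyfun_const. Qed.
Lemma polyfun_coefsD f h : polyfun_coefs f -> polyfun_coefs h -> polyfun_coefs (fun g => f g + h g).
Proof. by move=> hf hh i; apply: polyfun_ext (polyfunD (hf i) (hh i)) => g; rewrite coefD. Qed.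
Lemma polyfun_coefsM f h : polyfun_coefs f -> polyfun_coefs h -> polyfun_coefs (fun g => f g * h g).
Proof.
move=> hf hh i; apply: polyfun_ext (_ : polyfun (fun g => \sum_(j < i.+1) (f g)`_j * (h g)`_(i - j))).
  by move=> g; rewrite coefM.
by apply: polyfun_sum => j; apply: polyfunM.
Qed.
Lemma polyfun_coefs_polyC (f : ('I_p -> CC) -> CC) : polyfun f -> polyfun_coefs (fun g => (f g)%:P).
Proof.
move=> hf [|i]; first by apply: polyfun_ext hf => g; rewrite coefC.
by apply: polyfun_ext (polyfun_const _ 0) => g; rewrite coefC.
Qed.
Lemma polyfun_coefs_derivn f j : polyfun_coefs f -> polyfun_coefs (fun g => (f g)^`(j)).
Proof.
move=> hf i; apply: polyfun_ext (polyfunM (hf (j + i)%N) (polyfun_const _ ((j + i) ^_ j)%:R)) => g.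
by rewrite coef_derivn mulr_natr.
Qed.
Lemma polyfun_coefs_det a (A : ('I_p -> CC) -> 'M[{poly CC}]_a) :
  (forall i j, polyfun_coefs (fun g => A g i j)) -> polyfun_coefs (fun g => \det (A g)).
Proof.
move=> hA i; apply: polyfun_ext
   (_ : polyfun (fun g => \sum_(s : 'S_a) ((-1) ^+ s * \prod_j A g j (s j))`_i)).
  by move=> g; rewrite /determinant coef_sum.
apply: polyfun_sum => s; apply: polyfun_coefsM; first exact: polyfun_coefs_const.
have: forall r : seq 'I_a, polyfun_coefs (fun g => \prod_(j <- r) A g j (s j)).
  elim=> [|j r IH].
    by apply: polyfun_coefs_ext (polyfun_coefs_const 1) => g; rewrite big_nil.
  by apply: polyfun_coefs_ext (polyfun_coefsM (hA j (s j)) IH) => g; rewrite big_cons.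
exact.
Qed.
End PolyfunCoefs.

Section Realize.
Variables (n k N : nat) (e : 'I_N -> qel n k) (c : 'I_N -> 'I_N -> 'I_N -> CC).
Hypotheses (n_gt0 : (0 < n)%N) (he : is_q_basis e) (hc : struct_consts e c).

Definition polyfun_qel p (G : ('I_p -> CC) -> qel n k) : Prop :=
  [/\ forall i j, polyfun (fun s => (G s).1.1 i j), forall i j, polyfun (fun s => (G s).1.2 i j)
    & forall i j, polyfun (fun s => (G s).2 i j)].

Lemma polyfun_chi p (G : ('I_p -> CC) -> qel n k) : polyfun_qel G -> polyfun_coefs (fun s => chi (G s)).
Proof.
move=> [hA hX hY]; apply: polyfun_coefs_det => i j.
case: (split_ordP i) => i' ->; case: (split_ordP j) => j' ->.
- apply: polyfun_coefs_ext (polyfun_coefsD (polyfun_coefs_const _ ('X *+ (i' == j')))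
    (polyfun_coefs_polyC (polyfunN (hA i' j')))) => s.
  by rewrite block_mxEul !mxE polyCN.
- by apply: polyfun_coefs_ext (polyfun_coefs_polyC (hX i' j')) => s; rewrite block_mxEur mxE.
- by apply: polyfun_coefs_ext (polyfun_coefs_polyC (hY i' j')) => s; rewrite block_mxEdl mxE.
by apply: polyfun_coefs_ext (polyfun_coefs_const _ 0) => s; rewrite block_mxEdr mxE.
Qed.

Lemma polyfun_ev p (G : ('I_p -> CC) -> qel n k) l : polyfun_qel G -> polyfun (fun s => ev e (G s) l).
Proof.
move=> [hA hX hY]; rewrite /ev /pairing; apply: polyfunD; [apply: polyfunD|];
  apply: polyfun_sum => i; apply: polyfun_mulmx => a b; (try exact: polyfun_const).
- exact: hA.
- exact: hY.
exact: hX.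
Qed.

(** A polynomial section of [ev] turns the function on triples into an element of S(q); invariance
    under scalar shifts makes the choice of representative immaterial. *)
Lemma realize_invariant (f : qel n k -> CC) : qinvariant f ->
  (forall p (G : ('I_p -> CC) -> qel n k), polyfun_qel G -> polyfun (fun s => f (G s))) ->
  exists2 F : {mpoly CC[N]}, sym_invariant c F & forall g, F.@[ev e g] = f g.
Proof.
move=> hf pf; have [ga [hga pga]] := ev_surj n_gt0 he.
have [F hF] := pf _ ga pga.
have FE g : F.@[ev e g] = f g.
  have [a ->] := ev_inj n_gt0 he (fun l => esym (hga (ev e g) l)).
  by case: (hf) => -> _ _; rewrite hF; apply: meval_eq => l; rewrite (ev_shift he) hga.
exists F => //; apply: (qinvariant_sym_invariant n_gt0 he hc).
case: hf => h1 h2 h3; split=> [g a|A X Y v w|B A X Y B2 tB]; rewrite !FE.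
- exact: h1.
- exact: h2.
exact: h3.
Qed.

Lemma mpoly_ev_eq (F F' : {mpoly CC[N]}) : (forall g, F.@[ev e g] = F'.@[ev e g]) -> F = F'.
Proof.
move=> h; apply/eqP; rewrite -subr_eq0; apply/eqP/mpoly_meval0 => s.
have [ga [hga _]] := ev_surj n_gt0 he.
by rewrite -(meval_eq _ (hga s)) mevalB h subrr.
Qed.
End Realize.

Lemma qinvariant_fun_chi n k (phi : {poly CC} -> CC) :
  (forall g a, phi (chi (g : qel n k) \Po ('X - a%:P)) = phi (chi g)) ->
  qinvariant (fun g : qel n k => phi (chi g)).
Proof.
move=> h; split=> [g a|A X Y v w|B A X Y B2 tB]; first by rewrite chi_shift h.
  by rewrite chi_trans.
rewrite chi_conj // mulmxDr mulmx1 mulmxBl mul1mx B2 subr0 subrK //.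
Qed.

(** * Seminvariants of a cubic *)

Section Cubic.
Implicit Type p : {poly CC}.

(** Up to constants, [cubic_H] and [cubic_T] are the leading coefficients of the Hessian and of the
    cubic covariant, and [cubic_disc] is the discriminant; all are unchanged by translations of the
    variable. *)
Definition cubic_H p := p`_2 ^+ 2 - 3%:R * p`_3 * p`_1.
Definition cubic_T p := 2%:R * p`_2 ^+ 3 - 9%:R * p`_3 * p`_2 * p`_1 + 27%:R * p`_3 ^+ 2 * p`_0.
Definition cubic_disc p := p`_2 ^+ 2 * p`_1 ^+ 2 - 4%:R * p`_3 * p`_1 ^+ 3
  - 4%:R * p`_2 ^+ 3 * p`_0 + 18%:R * p`_3 * p`_2 * p`_1 * p`_0 - 27%:R * p`_3 ^+ 2 * p`_0 ^+ 2.

Lemma cubic_syzygy p :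
  cubic_T p ^+ 2 = 4%:R * cubic_H p ^+ 3 - 27%:R * p`_3 ^+ 2 * cubic_disc p.
Proof. rewrite /cubic_T /cubic_H /cubic_disc; ring. Qed.

Lemma cubic_shift p a : (size p <= 4)%N -> let q := p \Po ('X - a%:P) in
  [/\ q`_3 = p`_3, q`_2 = p`_2 - 3%:R * a * p`_3,
      q`_1 = p`_1 - 2%:R * a * p`_2 + 3%:R * a ^+ 2 * p`_3
    & q`_0 = p`_0 - a * p`_1 + a ^+ 2 * p`_2 - a ^+ 3 * p`_3].
Proof.
move=> sp q.
have pE : p = (p`_0)%:P + p`_1 *: 'X + p`_2 *: 'X^2 + p`_3 *: 'X^3.
  apply/polyP => i; rewrite !coefD coefC !coefZ coefX !coefXn.
  case: i => [|[|[|[|i]]]] /=; rewrite ?mulr0 ?mulr1 ?addr0 ?add0r //.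
  by rewrite nth_default // (leq_trans sp).
have -> : q = (p`_0 - a * p`_1 + a ^+ 2 * p`_2 - a ^+ 3 * p`_3)%:P +
    (p`_1 - 2%:R * a * p`_2 + 3%:R * a ^+ 2 * p`_3) *: 'X +
    (p`_2 - 3%:R * a * p`_3) *: 'X^2 + p`_3 *: 'X^3.
  rewrite /q {1}pE; move: (p`_0) (p`_1) (p`_2) (p`_3) => p0 p1 p2 p3.
  rewrite !comp_polyD !comp_polyZ comp_polyC comp_polyX !comp_Xn_poly -!mul_polyC.
  rewrite !(polyCD, polyCB, polyCN, polyCM, polyC_exp, polyC_natr) /=; ring.
by split; rewrite !coefD coefC !coefZ coefX !coefXn /= ?mulr0 ?mulr1 ?addr0 ?add0r.
Qed.

Lemma cubic_shift_inv p a : (size p <= 4)%N -> let q := p \Po ('X - a%:P) in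
  [/\ q`_3 = p`_3, cubic_H q = cubic_H p, cubic_T q = cubic_T p & cubic_disc q = cubic_disc p].
Proof.
move=> sp q; have [h3 h2 h1 h0] := cubic_shift a sp.
rewrite /cubic_H /cubic_T /cubic_disc h3 h2 h1 h0; split; ring.
Qed.

Lemma derivn_shift p a j : (p \Po ('X - a%:P))^`(j) = p^`(j) \Po ('X - a%:P).
Proof.
elim: j p => [|j IH] p //; rewrite !derivSn -IH; congr (_^`(_)).
by rewrite deriv_comp derivB derivX derivC subr0 mulr1.
Qed.
End Cubic.

Lemma qel_chart n k : exists p (G : ('I_p -> CC) -> qel n k),
  polyfun_qel G /\ forall g, exists s, G s = g.
Proof.
pose T := [the finType of ('I_n * 'I_n + 'I_n * 'I_k + 'I_k * 'I_n)%type].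
pose G (s : 'I_#|T| -> CC) : qel n k := (\matrix_(i, j) s (enum_rank (inl (inl (i, j)) : T)),
  \matrix_(i, j) s (enum_rank (inl (inr (i, j)) : T)), \matrix_(i, j) s (enum_rank (inr (i, j) : T))).
exists #|T|, G; split.
  by split=> i j; [apply: polyfun_ext (polyfun_var (enum_rank (inl (inl (i, j)) : T)))
    |apply: polyfun_ext (polyfun_var (enum_rank (inl (inr (i, j)) : T)))
    |apply: polyfun_ext (polyfun_var (enum_rank (inr (i, j) : T)))] => s; rewrite mxE.
move=> g; exists (fun l => match enum_val l with
  | inl (inl (i, j)) => g.1.1 i j | inl (inr (i, j)) => g.1.2 i j | inr (i, j) => g.2 i j end).
case: g => -[A X] Y; congr (_, _, _); apply/matrixP => i j; by rewrite mxE enum_rankK.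
Qed.

Definition polyfun_on n k (f : qel n k -> CC) : Prop :=
  forall p (G : ('I_p -> CC) -> qel n k), polyfun_qel G -> polyfun (fun s => f (G s)).

Lemma qel_dense n k (f h : qel n k -> CC) : polyfun_on f -> polyfun_on h ->
  (exists g, h g != 0) -> (forall g, h g != 0 -> f g = 0) -> forall g, f g = 0.
Proof.
move=> pf ph [g0 hg0] H g; have [p [G [pG sG]]] := qel_chart n k; have [s <-] := sG g.
apply: (polyfun_dense (pf _ _ pG) (ph _ _ pG)) => [|s']; last exact: H.
by have [s0 e0] := sG g0; exists s0; rewrite e0.
Qed.

Lemma polyfun_on_detYX n k : polyfun_on (fun g : qel n k => \det (g.2 *m g.1.2)).
Proof. by move=> p G [_ hX hY]; apply: polyfun_det => i j; apply: polyfun_mulmx. Qed.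

Lemma polyfun_on_chi n k i : polyfun_on (fun g : qel n k => (chi g)`_i).
Proof. by move=> p G pG; apply: polyfun_chi. Qed.

Lemma exists_detYX k m : exists g : qel (k + m) k, \det (g.2 *m g.1.2) != 0.
Proof.
exists (0, col_mx 1%:M 0, row_mx 1%:M 0) => /=.
by rewrite mul_row_col mul1mx mul0mx addr0 det1 oner_neq0.
Qed.

Lemma size_chi k m (g : qel (k + m.+1) k) : (size (chi g) <= m.+2)%N.
Proof.
apply/leq_sizeP => i im; move: g.
apply: (qel_dense (@polyfun_on_chi _ _ i) (@polyfun_on_detYX _ _) (exists_detYX _ _)).
move=> [[A X] Y] /= uZ; apply: nth_default; apply: leq_trans im.
(* Invariant functions take values in [CC], so the size is cast to a scalar in order to be carried
   to the slice. *)
have hf : qinvariant (fun g : qel (k + m.+1) k => (size (chi g))%:R : CC).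
  apply: (@qinvariant_fun_chi _ _ (fun p => (size p)%:R)) => g a.
  by rewrite size_comp_poly2 // size_XsubC.
have {}uZ : Y *m X \in unitmx by rewrite unitmxE unitfE.
have [d /(_ _ hf)/eqP] := qinvariant_slice A uZ.
rewrite eqr_nat => /eqP ->; rewrite chi_slice.
by rewrite (leq_trans (size_scale_leq _ _)) // size_char_poly.
Qed.

Lemma two_relations (x y z : CC) :
  - x + y - z = 0 -> x - y - z = 0 -> z = 0 /\ y = x.
Proof.
move=> h1 h2; have z0 : z = 0.
  have : 2%:R * z = 0.
    have -> : 2%:R * z = - ((- x + y - z) + (x - y - z)) by ring.
    by rewrite h1 h2 addr0 oppr0.
  by move/eqP; rewrite mulf_eq0 pnatr_eq0 => /eqP.
by split=> //; move/eqP: h1; rewrite z0 subr0 addrC subr_eq0 => /eqP.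
Qed.

Lemma qelD n k A X Y A' X' Y' :
  (A, X, Y) + (A', X', Y') = (A + A', X + X', Y + Y') :> qel n k.
Proof. by []. Qed.

Lemma qelZ n k a A X Y : a *: (A, X, Y) = (a *: A, a *: X, a *: Y) :> qel n k.
Proof. by []. Qed.

(** * The first-order term of an invariant at A = 0 *)

Section LinearPart.
Variables (k m N : nat) (e : 'I_N -> qel (k + m.+2) k) (c : 'I_N -> 'I_N -> 'I_N -> CC).
Hypotheses (he : is_q_basis e) (hc : struct_consts e c).
Let n_gt0 : (0 < k + m.+2)%N. Proof. by rewrite addnS. Qed.

Lemma polyfun_on_dirder (F : {mpoly CC[N]}) (g1 : qel (k + m.+2) k) :
  polyfun_on (fun g : qel (k + m.+2) k => dirder e F (0, g.1.2, g.2) g1).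
Proof.
move=> p G [hA hX hY]; apply: polyfun_sum => j; apply: polyfunM; first exact: polyfun_const.
apply: (polyfun_comp (f := fun s => F^`M(j).@[s])); first exact: polyfun_meval.
move=> l; apply: (@polyfun_ev _ _ _ e p (fun s => (0, (G s).1.2, (G s).2))); split=> //= a b.
by apply: polyfun_ext (polyfun_const _ 0) => s; rewrite mxE.
Qed.

(** The derivative is a linear form in A, killed by scalars and by all X w + v Y. Where Y X is
    invertible it factors through the compression [pi A iota], and the group fixing X and Y acts on
    the latter by conjugation, so the form is a multiple of the trace. The identity matrix shows the
    multiple to be zero. *)
Lemma sym_invariant_linear_part F A X Y : sym_invariant c F ->
  dirder e F (0, X, Y) (A, 0, 0) = 0.
Proof.
move=> hF.
have hq := sym_invariant_qinvariant n_gt0 he hc hF.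
have H := qel_dense (polyfun_on_dirder F (A, 0, 0)) (@polyfun_on_detYX _ _) (exists_detYX k m.+2).
apply: (H _ (0, X, Y)) => {X Y H} -[[A' X] Y] /= uZ.
have {}uZ : Y *m X \in unitmx by rewrite unitmxE unitfE.
pose psi M := dirder e F (0, X, Y) (M, 0, 0).
have psiD M M' : psi (M + M') = psi M + psi M'.
  rewrite /psi /dirder -big_split; apply: eq_bigr => j _; rewrite /= -mulrDl -pairingDl.
  by rewrite qelD !addr0.
have psiZ a M : psi (a *: M) = a * psi M.
  rewrite /psi /dirder mulr_sumr; apply: eq_bigr => j _; rewrite mulrA -pairingZl.
  by rewrite qelZ !scaler0.
have psi1 : psi 1%:M = 0.
  apply: big1 => j _; rewrite -/(dualshift _ _ 1) pairing_dualshift ?mul0r //; exact: in_q_basis.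
have psiT v w : psi (X *m w + v *m Y) = 0.
  apply: (@path_invariant_deriv _ _ _ _ _ _ _ 0) => t.
  case: hq => _ hT _; rewrite -(hT 0 X Y (t *: v) (t *: w)); congr (_.@[ev e _]).
  rewrite /quadpath scaler0 addr0; congr (_, _, _) => /=; rewrite ?scaler0 ?addr0 //.
  by rewrite scalerDr -scalemxAr -scalemxAl addrA.
have psiJ B M : B *m B = 0 -> \tr B = 0 -> B *m X = 0 -> Y *m B = 0 ->
    psi ((1%:M - B) *m M *m (1%:M + B)) = psi M.
  move=> B2 tB BX YB.
  have [p [hp hd]] := path_deriv e F (0, X, Y) ((1%:M - B) *m M *m (1%:M + B), 0, 0) 0.
  have [q [hq' hd']] := path_deriv e F (0, X, Y) (M, 0, 0) 0.
  have e0 g1 : quadpath (0, X, Y) g1 0 0 = (0, X, Y) :> qel _ _.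
    by rewrite /quadpath expr0n /= !scale0r !addr0.
  rewrite /psi; have := hd 0; have := hd' 0; rewrite !e0 !scaler0 !addr0 => <- <-.
  congr (_^`().[_]); apply/eqP; rewrite -subr_eq0; apply/eqP/poly_horner0 => t.
  rewrite hornerD hornerN hp hq'; apply/eqP; rewrite subr_eq0; apply/eqP.
  case: hq => _ _ hS; have {}hS := hS B (t *: M) X Y B2 tB.
  rewrite /quadpath !scaler0 !addr0.
  have -> : (0, X, Y) + t *: (M, 0, 0) = (t *: M, X, Y) :> qel _ _.
    by congr (_, _, _) => /=; rewrite ?scaler0 ?addr0 ?add0r.
  have BX1 : (1%:M - B) *m X = X by rewrite mulmxBl mul1mx BX subr0.
  have YB1 : Y *m (1%:M + B) = Y by rewrite mulmxDr mulmx1 YB addr0.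
  rewrite -hS BX1 YB1.
  congr (_.@[ev e _]); congr (_, _, _) => /=; rewrite ?scaler0 ?addr0 ?add0r //.
  by rewrite -scalemxAr -scalemxAl.
have [iota [pi [piX Yi pii ipi]]] := complement_factor uZ.
pose phi d := psi (iota *m d *m pi).
have phiD d d' : phi (d + d') = phi d + phi d' by rewrite /phi mulmxDr mulmxDl psiD.
have phiZ a d : phi (a *: d) = a * phi d by rewrite /phi -scalemxAr -scalemxAl psiZ.
have phi1 : phi 1%:M = 0.
  rewrite /phi mulmx1 ipi; have -> : 1%:M - X *m invmx (Y *m X) *m Y =
     1%:M + (-1) *: (X *m (invmx (Y *m X) *m Y) + 0 *m Y) by rewrite mul0mx addr0 scaleN1r mulmxA.
  by rewrite psiD psi1 psiZ psiT mulr0 addr0.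
have phiJ b d : b *m b = 0 -> \tr b = 0 -> phi ((1%:M - b) *m d *m (1%:M + b)) = phi d.
  move=> b2 tb; pose B := iota *m b *m pi.
  have B2 : B *m B = 0.
    by rewrite /B !mulmxA -(mulmxA (iota *m b)) pii mulmx1 -(mulmxA iota) b2 mulmx0 mul0mx.
  have tB : \tr B = 0 by rewrite mxtrace_mulC mulmxA pii mul1mx.
  have BX : B *m X = 0 by rewrite /B -mulmxA piX mulmx0.
  have YB : Y *m B = 0 by rewrite /B !mulmxA Yi !mul0mx.
  rewrite /phi -(psiJ B (iota *m d *m pi) B2 tB BX YB); congr psi.
  have -> : (1%:M - B) *m (iota *m d *m pi) = iota *m ((1%:M - b) *m d) *m pi.
    rewrite !mulmxBl !mul1mx mulmxBr mulmxBl; congr (_ - _).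
    by rewrite /B !mulmxA -(mulmxA _ pi) pii mulmx1.
  rewrite !mulmxDr !mulmx1 mulmxDl; congr (_ + _).
  by rewrite /B !mulmxA -(mulmxA _ pi) pii mulmx1.
have Ed i j : i != j -> phi (delta_mx i j) = 0 /\ phi (delta_mx i i) = phi (delta_mx j j).
  move=> ij; have D2 : delta_mx i j *m delta_mx i j = 0 :> 'M[CC]_m.+2.
    by rewrite mul_delta_mx_0 // eq_sym.
  have tD : \tr (delta_mx i j : 'M[CC]_m.+2) = 0.
    rewrite /mxtrace big1 // => l _; rewrite mxE; case: eqP => //= ->; by rewrite (negPf ij).
  (* This is the change of E_ji under conjugation by 1 - a E_ij. Taking a = 1 and a = -1 separates
     the terms of degree one and two in a. *)
  have J a : phi (a *: delta_mx j j + (- a) *: delta_mx i i + (- a ^+ 2) *: delta_mx i j) = 0.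
    have := phiJ (a *: delta_mx i j) (delta_mx j i).
    rewrite -scalemxAl -scalemxAr D2 !scaler0 mxtraceZ tD mulr0 => /(_ erefl erefl).
    have -> : (1%:M - a *: delta_mx i j) *m delta_mx j i *m (1%:M + a *: delta_mx i j) =
      delta_mx j i + (a *: delta_mx j j + (- a) *: delta_mx i i + (- a ^+ 2) *: delta_mx i j) :> 'M[CC]_m.+2.
      rewrite mulmxDr mulmx1 mulmxBl mul1mx -!scalemxAl -!scalemxAr mulmxBl -scalemxAl.
      rewrite !mul_delta_mx.
      by apply/matrixP => x y; rewrite !mxE; ring.
    by rewrite phiD => /eqP; rewrite -subr_eq0 addrAC subrr add0r => /eqP.
  have J' a : a * phi (delta_mx j j) + - a * phi (delta_mx i i) + - a ^+ 2 * phi (delta_mx i j) = 0.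
    by rewrite -!phiZ -!phiD J.
  move: (J' 1) (J' (-1)) => {J J' D2 tD}.
  move: (phi (delta_mx j j)) (phi (delta_mx i i)) (phi (delta_mx i j)) => x y z.
  rewrite opprK sqrrN expr1n !mulN1r !mul1r => J1 J2.
  by have [-> ->] := two_relations J2 J1.
have phi0 d : phi d = 0.
  have Dii : phi (delta_mx 0 0) = 0.
    have := phi1; have -> : 1%:M = \sum_i delta_mx i i :> 'M[CC]_m.+2.
      apply/matrixP => x y; rewrite summxE mxE (bigD1 x) //= mxE eqxx big1 => [|i /negPf ix].
        by rewrite addr0 eq_sym.
      by rewrite mxE eq_sym ix.
    rewrite (big_morph phi phiD (_ : phi 0 = 0)); last by rewrite -(scale0r 0) phiZ mul0r.
    rewrite (eq_bigr (fun=> phi (delta_mx 0 0))) => [|i _]; last first.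
      by have [->//|i0] := eqVneq i 0; case: (Ed i 0 i0).
    rewrite sumr_const card_ord -mulr_natr => /eqP; rewrite mulf_eq0 pnatr_eq0 orbF => /eqP //.
  rewrite [d]matrix_sum_delta (big_morph phi phiD (_ : phi 0 = 0)); last by rewrite -(scale0r 0) phiZ mul0r.
  apply: big1 => i _; rewrite (big_morph phi phiD (_ : phi 0 = 0)); last by rewrite -(scale0r 0) phiZ mul0r.
  apply: big1 => j _; rewrite phiZ; have [->|ij] := eqVneq i j; last by case: (Ed i j ij) => -> _; rewrite mulr0.
  by have [->|j0] := eqVneq j 0; [|case: (Ed j 0 j0) => _ ->]; rewrite Dii mulr0.
(* With p = [iota *m pi], this is A = p A p + (1 - p) A + p A (1 - p), and 1 - p = X (Y X)^-1 Y
   makes the last two terms translations. *)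
have -> : A = iota *m (pi *m A *m iota) *m pi + (X *m (invmx (Y *m X) *m Y *m A) +
   (iota *m pi *m A *m X *m invmx (Y *m X)) *m Y).
  have -> : iota *m (pi *m A *m iota) *m pi = (iota *m pi) *m A *m (iota *m pi) by rewrite !mulmxA.
  have -> : iota *m pi *m A *m X *m invmx (Y *m X) *m Y = (iota *m pi) *m A *m (X *m invmx (Y *m X) *m Y).
    by rewrite !mulmxA.
  have -> : X *m (invmx (Y *m X) *m Y *m A) = X *m invmx (Y *m X) *m Y *m A by rewrite !mulmxA.
  rewrite addrA addrAC -mulmxDr ipi subrK mulmx1 -mulmxDl.
  by rewrite subrK mul1mx.
by rewrite -/(psi _) psiD -/(phi _) phi0 psiT addr0.
Qed.
End LinearPart.

(** * The case [k <= n - 3] *)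

(** The inner variable is lambda, the outer one the new variable mu. Putting mu = lambda^2 recovers
    the path and mu = 0 its starting point. Since [eta] keeps its dependence on lambda, nothing is
    assumed about higher terms. *)
Lemma mpoly_comp_path M (t : {mpoly CC[M]}) (q : 'I_M -> {poly CC}) (y : 'I_M -> CC)
  (eta : 'I_M -> {poly CC}) : (forall i, q i = (y i)%:P + eta i * 'X^2) ->
  let z i := ((y i)%:P)%:P + (eta i)%:P * 'X : {poly {poly CC}} in
  (mmap (polyC \o polyC) z t).['X^2] = mmap polyC q t /\
  (mmap (polyC \o polyC) z t)`_0 = (t.@[y])%:P.
Proof.
move=> hq z; split.
  rewrite /mmap horner_sum; apply: eq_bigr => m _; rewrite hornerM hornerC; congr (_ * _).
  rewrite horner_prod; apply: eq_bigr => i _; rewrite horner_exp; congr (_ ^+ _).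
  by rewrite /z hornerD hornerC hornerM hornerC hornerX hq.
rewrite -horner_coef0 /mmap horner_sum mevalE rmorph_sum; apply: eq_bigr => m _.
rewrite hornerM hornerC /= polyCM; congr (_ * _).
rewrite horner_prod rmorph_prod; apply: eq_bigr => i _ /=; rewrite horner_exp polyC_exp; congr (_ ^+ _).
by rewrite /z hornerD hornerC hornerM hornerX mulr0 addr0.
Qed.

Lemma coef0_factor (R : nzRingType) (p : {poly R}) : p`_0 = 0 -> exists q, p = q * 'X.
Proof.
move=> p0; exists (\poly_(i < size p) p`_i.+1); apply/polyP => -[|i]; rewrite coefMX //= coef_poly.
by case: ltnP => // h; rewrite nth_default // (leq_trans h).
Qed.

(** The right side has order at least 3 at zero, and the order of a square in a domain is even. *)
Lemma divisible_of_sqr (R : idomainType) (t h a d : {poly R}) (b b' : R) :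
  t`_0 = 0 -> h`_0 = 0 -> a`_0 = 0 -> d`_0 = 0 ->
  t ^+ 2 = b%:P * h ^+ 3 - b'%:P * a ^+ 2 * d -> exists t', t = t' * 'X^2.
Proof.
move=> /coef0_factor[t1 ->] /coef0_factor[h1 ->] /coef0_factor[a1 ->] /coef0_factor[d1 ->].
set r := b%:P * h1 ^+ 3 - b'%:P * a1 ^+ 2 * d1.
have -> : b%:P * (h1 * 'X) ^+ 3 - b'%:P * (a1 * 'X) ^+ 2 * (d1 * 'X) = r * 'X * 'X^2.
  rewrite /r; ring.
rewrite exprMn => /mulIf; rewrite expf_neq0 ?polyX_eq0 // => /(_ isT) e.
have /coef0_factor[t2 ->] : t1`_0 = 0.
  have := congr1 (fun p : {poly R} => p`_0) e.
  by rewrite /= coefMX /= expr2 coef0M => /eqP; rewrite mulf_eq0 orbb => /eqP.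
by exists t2; rewrite -mulrA -expr2.
Qed.

Section NotPolynomial.
Variables (k m N : nat) (e : 'I_N -> qel (k.+1 + m.+3) k.+1) (c : 'I_N -> 'I_N -> 'I_N -> CC).
Hypotheses (he : is_q_basis e) (hc : struct_consts e c).
Let n_gt0 : (0 < k.+1 + m.+3)%N. Proof. by []. Qed.
Implicit Types g : qel (k.+1 + m.+3) k.+1.

(** Here [chi] has degree at most m + 3, and differentiation commutes with translation of the
    variable, so seminvariants of the derivative are still invariants of q. *)
Definition cubic_part g := (chi g)^`(m).

Lemma size_cubic_part g : (size (cubic_part g) <= 4)%N.
Proof.
apply/leq_sizeP => i i4; rewrite coef_derivn nth_default ?mul0rn //.
by apply: leq_trans (size_chi g) _; rewrite -addn4 leq_add2l.
Qed.

Lemma realize_cubic (phi : {poly CC} -> CC) :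
  (forall (p : {poly CC}) a, (size p <= 4)%N -> phi (p \Po ('X - a%:P)) = phi p) ->
  (forall q (f : ('I_q -> CC) -> {poly CC}), polyfun_coefs f -> polyfun (fun s => phi (f s))) ->
  exists2 F : {mpoly CC[N]}, sym_invariant c F & forall g, F.@[ev e g] = phi (cubic_part g).
Proof.
move=> hphi pphi; apply: (realize_invariant n_gt0 he hc (f := fun g => phi (cubic_part g))).
  apply: (@qinvariant_fun_chi _ _ (fun p : {poly CC} => phi p^`(m))) => g a.
  by rewrite derivn_shift hphi // size_cubic_part.
move=> p G pG; apply: pphi; apply: polyfun_coefs_derivn; exact: polyfun_chi.
Qed.

(** Y0 X0 = 1 - E_00 is singular, which kills the top coefficient of [chi]. The upper right block of
    A0 times the lower block of X0 is E_00, which restores the missing diagonal entry one degree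
    lower, in proportion to the scale of A0. *)
Let A0 : 'M[CC]_(k.+1 + m.+3) := block_mx 0 (delta_mx 0 0) 0 0.
Let X0 : 'M[CC]_(k.+1 + m.+3, k.+1) := col_mx (1%:M - delta_mx 0 0) (delta_mx 0 0).
Let Y0 : 'M[CC]_(k.+1, k.+1 + m.+3) := row_mx 1%:M 0.

Lemma chi_special : exists2 w : CC, w != 0 &
  forall a, chi (a *: A0, X0, Y0) = (w * a) *: 'X^(m.+2).
Proof.
pose w := \det (flip_mx CC k.+1 m.+3); exists w.
  by apply/eqP => w0; have := det_flip_sqr CC k.+1 m.+3; rewrite -/w w0 expr0n => /eqP; rewrite eq_sym oner_eq0.
move=> a; apply: (@mulfI _ 'X^(k.+1)); first by rewrite expf_neq0 ?polyX_eq0.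
rewrite /A0 scale_block_mx !scaler0 chi_degenerate -/w.
have -> : 'X *: map_mx polyC (1%:M - delta_mx 0 0) + map_mx polyC ((a *: delta_mx 0 0 : 'M_(k.+1, m.+3)) *m delta_mx 0 0)
   = diag_mx (\row_(j < k.+1) if j == 0 then a%:P else 'X) :> 'M[{poly CC}]_k.+1.
  rewrite -[in LHS]scalemxAl mul_delta_mx; apply/matrixP => i j; rewrite !mxE.
  have [i0|i0] /= := eqVneq i 0; last by rewrite subr0 mulr0 polyC0 addr0 polyCMn mulrnAr mulr1.
  rewrite i0 [0 == j]eq_sym; case: eqVneq => [_|_] /=; first by rewrite subrr polyC0 mulr0 add0r mulr1 mulr1n.
  by rewrite subrr polyC0 mulr0 mulr0 polyC0 addr0 mulr0n.
rewrite det_diag big_ord_recl !mxE eqxx (eq_bigr (fun=> 'X)) => [|i _]; last by rewrite mxE.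
rewrite prodr_const card_ord -!mul_polyC polyCM !exprS; ring.
Qed.

Lemma sym_inv_not_polynomial : ~ sym_inv_polynomial c.
Proof.
move=> [M [f [finv findep fgen]]].
have [F0 i0 v0] : exists2 F : {mpoly CC[N]}, sym_invariant c F & forall g, F.@[ev e g] = (cubic_part g)`_3.
  apply: (realize_cubic (phi := fun p : {poly CC} => p`_3)) => [p a sp|q p pp]; last exact: pp.
  by case: (cubic_shift_inv a sp).
have [FH iH vH] : exists2 F : {mpoly CC[N]}, sym_invariant c F & forall g, F.@[ev e g] = cubic_H (cubic_part g).
  apply: realize_cubic => [p a sp|q p pp]; first by case: (cubic_shift_inv a sp).
  by rewrite /cubic_H; repeat (apply: polyfunB || apply: polyfunD || apply: polyfunM || apply: polyfunX || apply: pp || apply: polyfun_const).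
have [FT iT vT] : exists2 F : {mpoly CC[N]}, sym_invariant c F & forall g, F.@[ev e g] = cubic_T (cubic_part g).
  apply: realize_cubic => [p a sp|q p pp]; first by case: (cubic_shift_inv a sp).
  by rewrite /cubic_T; repeat (apply: polyfunB || apply: polyfunD || apply: polyfunM || apply: polyfunX || apply: pp || apply: polyfun_const).
have [FD iD vD] : exists2 F : {mpoly CC[N]}, sym_invariant c F & forall g, F.@[ev e g] = cubic_disc (cubic_part g).
  apply: realize_cubic => [p a sp|q p pp]; first by case: (cubic_shift_inv a sp).
  by rewrite /cubic_disc; repeat (apply: polyfunB || apply: polyfunD || apply: polyfunM || apply: polyfunX || apply: pp || apply: polyfun_const).
have [a ea] := fgen _ i0; have [h eh] := fgen _ iH.
have [t et] := fgen _ iT; have [d ed] := fgen _ iD.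
(* Independence of the generators promotes the syzygy between functions to an identity between
   polynomials in free variables. *)
have rel : t ^+ 2 = 4%:R%:MP * h ^+ 3 - 27%:R%:MP * a ^+ 2 * d.
  apply/eqP; rewrite -subr_eq0; apply/eqP; apply: findep.
  rewrite !(rmorphB, rmorphXn, rmorphM) /= !comp_mpolyC -ea -eh -et -ed.
  apply/eqP; rewrite subr_eq0; apply/eqP; apply: (mpoly_ev_eq n_gt0 he) => g.
  have mX (F : {mpoly CC[N]}) j : (F ^+ j).@[ev e g] = F.@[ev e g] ^+ j by rewrite rmorphXn.
  rewrite mX vT cubic_syzygy mevalB [(_ * FH ^+ 3).@[_]]mevalM [(_ * FD).@[_]]mevalM.
  by rewrite [(_ * F0 ^+ 2).@[_]]mevalM !mX !mevalC v0 vH vD.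
have [w w0 chiE] := chi_special.
have cE b : cubic_part (b *: A0, X0, Y0) = (w * b * ((m.+2) ^_ m)%:R) *: 'X^2.
  by rewrite /cubic_part chiE derivnZ derivnXn -scaler_nat scalerA -addn2 addKn.
have path i : exists q, (forall b, q.[b] = (tnth f i).@[ev e (b *: A0, X0, Y0)]) /\ q`_1 = 0.
  have [q [hq hd]] := path_deriv e (tnth f i) (0, X0, Y0) (A0, 0, 0) 0; exists q; split.
    move=> b; rewrite hq /quadpath scaler0 addr0.
    by rewrite qelZ !scaler0 qelD !addr0 add0r.
  have -> : q`_1 = q^`().[0] by rewrite horner_coef0 coef_deriv mulr1n.
  rewrite hd scaler0 addr0 /quadpath scaler0 addr0 scale0r addr0.
  exact: (sym_invariant_linear_part he hc).
have [q hq] := fin_all_exists path.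
pose eta i := \poly_(j < size (q i)) (q i)`_j.+2.
have qE i : q i = ((q i)`_0)%:P + eta i * 'X^2.
  apply/polyP => -[|[|j]]; rewrite coefD coefC coefMXn /= ?addr0 ?add0r //; first by case: (hq i).
  rewrite subSS subSS subn0 coef_poly; case: ltnP => // sj; rewrite nth_default //.
  by rewrite (leq_trans sj) // -addn2 leq_addr.
(* The lifts of the generators with the explicit lambda^2 replaced by mu; [rel] holds for them
   because it is formal. *)
pose z i : {poly {poly CC}} := (((q i)`_0)%:P)%:P + (eta i)%:P * 'X.
have S p := mpoly_comp_path p qE.
pose ph p := mmap (polyC \o polyC) z p.
have val p b : (mmap polyC q p).[b] = (p \mPo f).@[ev e (b *: A0, X0, Y0)].
  rewrite horner_mmap_polyC comp_mpoly_meval; apply: meval_eq => i; by case: (hq i).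
have ph0 p F : F = p \mPo f -> F.@[ev e (0 *: A0, X0, Y0)] = 0 -> (ph p)`_0 = 0.
  move=> eF v; have [_] := S p; rewrite -/z -/(ph p) => ->.
  rewrite -[0 in RHS]polyC0 -[0 in RHS]v eF -val horner_mmap_polyC; congr (_%:P).
  by apply: meval_eq => i; rewrite horner_coef0.
have phT0 : (ph t)`_0 = 0 by apply: (ph0 _ _ et); rewrite vT cE /cubic_T mulr0 mul0r scale0r !coef0; ring.
have phH0 : (ph h)`_0 = 0 by apply: (ph0 _ _ eh); rewrite vH cE /cubic_H mulr0 mul0r scale0r !coef0; ring.
have phA0 : (ph a)`_0 = 0 by apply: (ph0 _ _ ea); rewrite v0 cE mulr0 mul0r scale0r !coef0.
have phD0 : (ph d)`_0 = 0 by apply: (ph0 _ _ ed); rewrite vD cE /cubic_disc mulr0 mul0r scale0r !coef0; ring.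
have relp : ph t ^+ 2 = (4%:R%:P)%:P * ph h ^+ 3 - (27%:R%:P)%:P * ph a ^+ 2 * ph d.
  by rewrite /ph -[LHS]rmorphXn rel !(rmorphB, rmorphXn, rmorphM) /= !mmapC.
have [t' tE] := divisible_of_sqr phT0 phH0 phA0 phD0 relp.
pose K := 2%:R * (w * ((m.+2) ^_ m)%:R) ^+ 3.
have TE : mmap polyC q t = K *: 'X^3.
  apply/eqP; rewrite -subr_eq0; apply/eqP/poly_horner0 => b.
  rewrite hornerD hornerN val -et vT cE /cubic_T !hornerE !coefZ !coefXn /= /K; ring.
(* Putting mu = lambda^2 back, divisibility by mu^2 becomes divisibility by lambda^4, so the
   coefficient [K] of lambda^3 would be zero. *)
have [SE _] := S t; move/(congr1 (fun p : {poly CC} => p`_3)): SE.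
rewrite -/z -/(ph t) tE TE hornerM hornerXn -exprM coefMXn coefZ coefXn /= mulr1 => /eqP.
rewrite eq_sym /K mulf_eq0 pnatr_eq0 expf_eq0 /= mulf_eq0 (negPf w0) pnatr_eq0 /=.
by rewrite -leqn0 leqNgt ffact_gt0 -addn2 leq_addr.
Qed.
End NotPolynomial.

(** * The case [k = n - 1] *)

Lemma qinvariant_mulYX n k i j : qinvariant (fun g : qel n k => (g.2 *m g.1.2) i j).
Proof.
split=> [g a|A X Y v w|B A X Y B2 tB] //=; first by rewrite !addr0.
have inv : (1%:M + B) *m (1%:M - B) = 1%:M.
  by rewrite mulmxBr mulmx1 mulmxDl mul1mx B2 addr0 addrK.
by rewrite mulmxA -(mulmxA Y) inv mulmx1.
Qed.

Definition slice k m (Z : 'M[CC]_k) (d : 'M[CC]_m) : qel (k + m) k :=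
  (block_mx 0 0 0 d, col_mx Z 0, row_mx 1%:M 0).

Lemma slice_mulYX k m (Z : 'M[CC]_k) (d : 'M[CC]_m) : (slice Z d).2 *m (slice Z d).1.2 = Z.
Proof. by rewrite mul_row_col mul1mx mul0mx addr0. Qed.

Lemma polyfun_slice p k m (Z : ('I_p -> CC) -> 'M[CC]_k) (d : ('I_p -> CC) -> 'M[CC]_m) :
  (forall i j, polyfun (fun s => Z s i j)) -> (forall i j, polyfun (fun s => d s i j)) ->
  polyfun_qel (fun s => slice (Z s) (d s)).
Proof.
move=> hZ hd; split=> i j.
- case: (split_ordP i) => i' ->; case: (split_ordP j) => j' ->.
  + by apply: polyfun_ext (polyfun_const _ 0) => s; rewrite block_mxEul mxE.
  + by apply: polyfun_ext (polyfun_const _ 0) => s; rewrite block_mxEur mxE.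
  + by apply: polyfun_ext (polyfun_const _ 0) => s; rewrite block_mxEdl mxE.
  by apply: polyfun_ext (hd i' j') => s; rewrite block_mxEdr.
- case: (split_ordP i) => i' ->.
    by apply: polyfun_ext (hZ i' j) => s; rewrite col_mxEu.
  by apply: polyfun_ext (polyfun_const _ 0) => s; rewrite col_mxEd mxE.
exact: polyfun_const.
Qed.

(** A scalar shift of A also changes the upper left block; a translation v Y repairs that. *)
Lemma qinvariant_slice_shift k m (f : qel (k + m) k -> CC) (Z : 'M[CC]_k) (d : 'M[CC]_m) a :
  qinvariant f -> f (slice Z (d + a%:M)) = f (slice Z d).
Proof.
move=> [hs hT _]; rewrite -(hs (slice Z d) a) -(hT _ _ _ (col_mx a%:M 0) 0).
congr (f (_, _, _)); rewrite /= ?addr0 // mulmx0 addr0 mul_col_row !mul0mx mulmx0 mulmx1.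
by rewrite scalar_mx_block !add_block_mx !addr0 ?add0r.
Qed.

Lemma realize_mulYX n k N (e : 'I_N -> qel n k) (c : 'I_N -> 'I_N -> 'I_N -> CC) :
  (0 < n)%N -> is_q_basis e -> struct_consts e c -> forall l, exists F : {mpoly CC[N]},
  sym_invariant c F /\ forall g, F.@[ev e g] = mxvec (g.2 *m g.1.2) 0 l.
Proof.
move=> n_gt0 he hc l; have [i j] := mxvec_indexP l.
have pf : polyfun_on (fun g : qel n k => (g.2 *m g.1.2) i j).
  by move=> p G [_ hX hY]; apply: polyfun_mulmx.
have [F hF vF] := realize_invariant n_gt0 he hc (@qinvariant_mulYX n k i j) pf.
by exists F; split=> // g; rewrite vF mxvecE.
Qed.

Lemma polyfun_vec_mx p k (h : ('I_p -> CC) -> 'rV[CC]_(k * k)) :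
  (forall l, polyfun (fun s => h s 0 l)) -> forall i j, polyfun (fun s => (vec_mx (h s) : 'M_k) i j).
Proof. by move=> H i j; apply: polyfun_ext (H (mxvec_index i j)) => s; rewrite mxE. Qed.

(** No denominators arise: the slice with d = 0 is parametrised polynomially by Z, so restricting an
    invariant to it gives a polynomial in Y X, correct wherever Y X is invertible and hence
    everywhere. *)
Lemma polynomial_corank1 k N (e : 'I_N -> qel (k + 1) k) (c : 'I_N -> 'I_N -> 'I_N -> CC) :
  is_q_basis e -> struct_consts e c -> sym_inv_polynomial c.
Proof.
move=> he hc; have n_gt0 : (0 < k + 1)%N by rewrite addn1.
have [f hf] := fin_all_exists (realize_mulYX n_gt0 he hc).
exists (k * k)%N, [tuple f l | l < k * k].
pose S (s : 'I_(k * k) -> CC) : qel (k + 1) k := slice (vec_mx (\row_l s l)) (0 : 'M_1).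
have pS : polyfun_qel S.
  apply: polyfun_slice => i j; last exact: polyfun_const.
  by apply: polyfun_vec_mx => l; apply: polyfun_ext (polyfun_var l) => s; rewrite mxE.
have fv P g : (P \mPo [tuple f l | l < k * k]).@[ev e g] = P.@[fun l => mxvec (g.2 *m g.1.2) 0 l].
  rewrite comp_mpoly_meval; apply: meval_eq => l; rewrite tnth_mktuple; by case: (hf l).
split.
- by move=> l; rewrite tnth_mktuple; case: (hf l).
- move=> P P0; apply: mpoly_meval0 => s; have := fv P (S s); rewrite P0 meval0 => ->.
  by apply: meval_eq => l; rewrite slice_mulYX vec_mxK mxE.
move=> F hF.
have [P hP] : polyfun (fun s => F.@[ev e (S s)]).
  apply: (polyfun_comp (f := fun s => F.@[s])); first exact: polyfun_meval.
  by move=> l; apply: polyfun_ev.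
exists P; apply: (mpoly_ev_eq n_gt0 he) => g; rewrite fv; apply/eqP; rewrite -subr_eq0; apply/eqP; move: g.
apply: (qel_dense _ (@polyfun_on_detYX _ _) (exists_detYX k 1)).
  move=> p G pG; apply: polyfunB.
    by apply: (polyfun_comp (f := fun s => F.@[s])) => [|l]; [exact: polyfun_meval|exact: polyfun_ev].
  apply: (polyfun_comp (f := fun s => P.@[s])) => [|l]; first exact: polyfun_meval.
  have [i j] := mxvec_indexP l; apply: polyfun_ext (_ : polyfun (fun s => ((G s).2 *m (G s).1.2) i j)).
    by move=> s; rewrite mxvecE.
  by case: pG => _ hX hY; apply: polyfun_mulmx.
move=> [[A X] Y] /= uZ; have {}uZ : Y *m X \in unitmx by rewrite unitmxE unitfE.
have hq := sym_invariant_qinvariant n_gt0 he hc hF.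
have [d /(_ _ hq) E] := qinvariant_slice A uZ.
rewrite [F.@[_]]E -/(slice _ d) -hP /S.
have -> : vec_mx (\row_l mxvec (Y *m X) 0 l) = Y *m X.
  by rewrite -[RHS]mxvecK; congr vec_mx; apply/rowP => l; rewrite mxE.
have := qinvariant_slice_shift (Y *m X) (0 : 'M_1) (d 0 0) hq.
rewrite add0r -mx11_scalar => /= ->; exact: subrr.
Qed.

(** * Divisibility by the determinant *)

Lemma trigonalization k (Z : 'M[CC]_k.+1) : exists P Q T : 'M[CC]_k.+1,
  [/\ Q *m P = 1%:M, is_trig_mx T & Z = Q *m T *m P].
Proof.
have [P uP] := Schur Z (ltn0Sn k).
have uP' : P \in unitmx by apply: unitarymx_unit.
exists P, (invmx P), (conjmx P Z); split=> //; first by rewrite mulVmx.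
by rewrite conjumx // !mulmxA mulVmx // mul1mx -mulmxA mulVmx // mulmx1.
Qed.

(** The sign makes [char_poly (- Z)] the determinant of the pencil X + Z, with constant coefficient
    [\det Z]. *)
Lemma det_add_scalar_trig k (P Q T : 'M[CC]_k) : Q *m P = 1%:M -> is_trig_mx T ->
  char_poly (- (Q *m T *m P)) = \prod_i ('X + (T i i)%:P).
Proof.
move=> QP tT.
have -> : char_poly (- (Q *m T *m P)) = char_poly (- T).
  rewrite /char_poly /char_poly_mx.
  have PQ : map_mx polyC Q *m map_mx polyC P = 1%:M by rewrite -map_mxM QP map_mx1.
  have -> : 'X%:M - map_mx polyC (- (Q *m T *m P)) =
     map_mx polyC Q *m ('X%:M - map_mx polyC (- T)) *m map_mx polyC P.
    rewrite mulmxBr mulmxBl; congr (_ - _); last by rewrite -!map_mxM mulmxN mulNmx.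
    by rewrite scalar_mxC -mulmxA PQ mulmx1.
  by rewrite !det_mulmx mulrAC -det_mulmx PQ det1 mul1r.
rewrite char_poly_trig; last by apply/is_trig_mxP => i j ij; rewrite mxE (is_trig_mxP tT) ?oppr0.
by apply: eq_bigr => i _; rewrite mxE polyCN opprK.
Qed.

Lemma char_poly_opp_coef0 k (Z : 'M[CC]_k) : (char_poly (- Z))`_0 = \det Z.
Proof. by rewrite char_poly_det -(scaleN1r Z) detZ mulrA -exprMn mulrNN mulr1 expr1n mul1r. Qed.

(* If all cofactors of [Z] vanish, [adj (X + Z)] is divisible by [X], so the relation
   [(X + Z) adj (X + Z) = det (X + Z)] can be divided by [X] and evaluated at [0]. *)
Lemma simple_root_cofactor k (Z : 'M[CC]_k.+1) : \det Z = 0 ->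
  (char_poly (- Z))`_1 != 0 -> exists i j, cofactor Z i j != 0.
Proof.
move=> dZ h.
have [/existsP[i /existsP[j H]]|/existsPn H] := boolP [exists i, [exists j, cofactor Z i j != 0]].
  by exists i, j.
have cof0 i j : cofactor Z i j = 0.
  by apply/eqP; move/existsPn/(_ j): (H i); rewrite negbK.
pose M := char_poly_mx (- Z).
have evM : map_mx (horner_eval 0) M = Z.
  by apply/matrixP => i j; rewrite !mxE /= /horner_eval hornerD hornerN hornerC hornerMn hornerX mul0rn add0r opprK.
have adjE i j : exists q, (\adj M) i j = q * 'X.
  have : ((\adj M) i j).[0] = 0.
    rewrite mxE -[_.[0]]/(horner_eval 0 _) -cofactor_map_mx evM; exact: cof0.
  move/eqP; rewrite -rootE => /factor_theorem [q ->]; exists q; by rewrite subr0.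
have {}adjE i := fin_all_exists (adjE i).
have [b hb] := fin_all_exists adjE.
pose B := \matrix_(i, j) b i j.
have adjB : \adj M = 'X *: B by apply/matrixP => i j; rewrite hb !mxE mulrC.
have d0 : (char_poly (- Z)).[0] = 0.
  by rewrite -[_.[0]]/(horner_eval 0 _) -det_map_mx evM dZ.
have /factor_theorem[d1] : root (char_poly (- Z)) 0 by apply/eqP.
rewrite subr0 => dE.
have MB : M *m B = d1%:M.
  have := mul_mx_adj M; rewrite -/(char_poly _) dE adjB -scalemxAr => E.
  apply/matrixP => i j; have := congr1 (fun K : 'M_k.+1 => K i j) E.
  rewrite mxE [in RHS]mxE mulrC -mulrnAl => /mulIf; rewrite polyX_eq0 => /(_ isT) ->.
  by rewrite !mxE.
have := congr1 (map_mx (horner_eval 0)) MB; rewrite map_mxM evM map_scalar_mx /= /horner_eval.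
move/(congr1 determinant); rewrite det_mulmx dZ mul0r det_scalar => /esym/eqP.
by rewrite expf_eq0 /= horner_coef0; move: h; rewrite dE coefMX /= => /negPf ->.
Qed.

Section DetDivides.
Variable k : nat.
Let q := (k.+1 * k.+1 + 1)%N.

Definition point (Z : 'M[CC]_k.+1) (s : CC) : 'I_q -> CC :=
  fun l => match split l with inl a => mxvec Z 0 a | inr _ => s end.

Lemma pointE (v : 'I_q -> CC) :
  v =1 point (vec_mx (\row_a v (lshift 1 a))) (v (rshift _ 0)).
Proof.
move=> l; rewrite /point; case: splitP => [a e|a e].
  by rewrite vec_mxK mxE; congr v; apply: val_inj.
by congr v; apply: val_inj; rewrite /= e ord1.
Qed.

Lemma vec_mx_point Z s : vec_mx (\row_a point Z s (lshift 1 a)) = Z.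
Proof.
apply: (can_inj mxvecK); rewrite vec_mxK.
by apply/rowP => a; rewrite mxE /point (unsplitK (inl _)).
Qed.

Lemma point_last Z s : point Z s (rshift _ 0) = s.
Proof. by rewrite /point (unsplitK (inr _)). Qed.

Lemma pointD Z W s t : (fun l => point Z s l + t * point W 0 l) =1 point (Z + t *: W) s.
Proof.
move=> l; rewrite /point; case: (split l) => [a|_]; last by rewrite mulr0 addr0.
by rewrite linearD linearZ /= !mxE.
Qed.

Definition generic_mx : 'M[{mpoly CC[q]}]_k.+1 :=
  \matrix_(i, j) 'X_(lshift 1 (mxvec_index i j)).

Lemma meval_generic_mx Z s : map_mx (meval (point Z s)) (- generic_mx) = - Z.
Proof.
apply/matrixP => i j; rewrite !mxE mevalN mevalXU /point.
have -> : split (lshift 1 (mxvec_index i j)) = inl (mxvec_index i j) by rewrite (unsplitK (inl _)).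
by rewrite mxvecE.
Qed.

Definition pencil (P : {mpoly CC[q]}) : {poly {mpoly CC[q]}} :=
  mmap (polyC \o @mpolyC q CC) (fun l => ('X_l)%:P + ((point 1%:M 0 l)%:MP)%:P * 'X) P.

Lemma pencilE P Z s t : (map_poly (meval (point Z s)) (pencil P)).[t] = P.@[point (Z + t%:M) s].
Proof.
rewrite /pencil /mmap rmorph_sum horner_sum mevalE; apply: eq_bigr => m _.
rewrite rmorphM hornerM /= map_polyC hornerC /= mevalC; congr (_ * _).
rewrite rmorph_prod horner_prod; apply: eq_bigr => l _; rewrite rmorphXn horner_exp; congr (_ ^+ _).
rewrite rmorphD rmorphM /= !map_polyC map_polyX hornerD hornerM !hornerC hornerX /= mevalXU mevalC.
by rewrite mulrC pointD scalemx1.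
Qed.

(** Modulo det (Z + t), monic in t, the remainder of P (Z + t) has degree at most k. For distinct
    eigenvalues it has k + 1 roots, their negatives, where Z + t is singular with a nonzero
    cofactor. It is therefore zero, and t = 0 gives the quotient. *)
Lemma det_dvd (P : {mpoly CC[q]}) :
  (forall Z s, \det Z = 0 -> (exists i j, cofactor Z i j != 0) -> P.@[point Z s] = 0) ->
  exists Q : {mpoly CC[q]}, forall Z s, P.@[point Z s] = \det Z * Q.@[point Z s].
Proof.
move=> H; pose D := char_poly (- generic_mx).
pose R := Pdiv.Ring.rmodp (pencil P) D; pose W := Pdiv.Ring.rdivp (pencil P) D.
have E : pencil P = W * D + R by apply: Pdiv.RingMonic.rdivp_eq; apply: char_poly_monic.
have DE Z s : map_poly (meval (point Z s)) D = char_poly (- Z).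
  by rewrite map_char_poly meval_generic_mx.
have sR : (size R <= k.+1)%N.
  by rewrite -ltnS -(size_char_poly (- generic_mx)) Pdiv.Ring.ltn_rmodpN0 // monic_neq0 // char_poly_monic.
have R_good Z s (P1 Q1 T : 'M[CC]_k.+1) : Q1 *m P1 = 1%:M -> is_trig_mx T -> Z = Q1 *m T *m P1 ->
    injective (fun i => T i i) -> map_poly (meval (point Z s)) R = 0.
  move=> QP tT ZE inj; apply/eqP; apply/negPn/negP => R0.
  have Hu : uniq [seq - T i i | i <- enum 'I_k.+1].
    by rewrite map_inj_uniq ?enum_uniq // => i j /oppr_inj /inj.
  suff Ha : all (root (map_poly (meval (point Z s)) R)) [seq - T i i | i <- enum 'I_k.+1].
    have := max_poly_roots R0 Ha Hu.
    by rewrite size_map size_enum_ord ltnNge (leq_trans (size_poly _ _) sR).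
  apply/allP => _ /mapP[a _ ->]; rewrite rootE.
  have CZ : char_poly (- Z) = \prod_i ('X + (T i i)%:P) by rewrite ZE det_add_scalar_trig.
  have -> : (map_poly (meval (point Z s)) R).[- T a a] = P.@[point (Z + (- T a a)%:M) s].
    rewrite -pencilE E rmorphD rmorphM hornerD hornerM /= DE CZ [(\prod_i _).[_]]horner_prod.
    by rewrite (bigD1 a) //= hornerD hornerX hornerC addNr mul0r mulr0 add0r.
  have ZaE : Z + (- T a a)%:M = Q1 *m (T + (- T a a)%:M) *m P1.
    by rewrite mulmxDr mulmxDl -ZE mul_mx_scalar -scalemxAl QP scalemx1.
  have CZa : char_poly (- (Z + (- T a a)%:M)) = \prod_i ('X + (T i i - T a a)%:P).
    rewrite ZaE det_add_scalar_trig //; last first.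
      by apply/is_trig_mxP => i j ij; rewrite !mxE (is_trig_mxP tT) // -val_eqE ltn_eqF // addr0.
    by apply: eq_bigr => i _; rewrite !mxE eqxx.
  have dZa : \det (Z + (- T a a)%:M) = 0.
    have : (char_poly (- (Z + (- T a a)%:M))).[0] = 0.
      by rewrite CZa horner_prod (bigD1 a) //= hornerD hornerX hornerC subrr addr0 mul0r.
    by rewrite horner_coef0 char_poly_opp_coef0.
  (* Distinct eigenvalues make zero a simple root of the shifted characteristic polynomial. *)
  apply/eqP; apply: H => //; apply: simple_root_cofactor => //.
  rewrite CZa (bigD1 a) //= subrr addr0 mulrC coefMX /= -horner_coef0 horner_prod prodf_seq_neq0.
  apply/allP => i _; apply/implyP => ia; rewrite hornerD hornerX hornerC add0r subr_eq0.
  by apply: contra ia => /eqP/inj ->.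
have rem0 : R = 0.
  apply/polyP => i; rewrite coef0; apply: mpoly_meval0 => v.
  rewrite (meval_eq _ (pointE v)); move: (vec_mx _) (v _) => Z s {v}.
  have [P1 [Q1 [T [QP tT ZE]]]] := trigonalization Z.
  (* Adding u diag(0, 1, 2, ...) to the triangular form separates the eigenvalues for all but
     finitely many u, since every factor of [disc] has a nonzero linear coefficient. The remainder
     vanishes for these u, hence at u = 0. *)
  pose G l := (point Z s l)%:P + (point (Q1 *m diag_mx (\row_a a%:R) *m P1) 0 l) *: 'X.
  pose disc := \prod_(ab : 'I_k.+1 * 'I_k.+1 | ab.1 != ab.2)
    ((T ab.1 ab.1 - T ab.2 ab.2)%:P + (ab.1%:R - ab.2%:R) *: 'X) : {poly CC}.
  have disc0 : disc != 0.
    rewrite prodf_seq_neq0; apply/allP => -[a b] _; apply/implyP => /= ab.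
    apply/eqP => /(congr1 (fun p : {poly CC} => p`_1)); rewrite coefD coefC coefZ coefX mulr1 add0r coef0.
    by move/eqP; rewrite subr_eq0 eqr_nat; apply/negP.
  have : mmap polyC G R`_i * disc = 0.
    apply: poly_horner0 => u; rewrite hornerM horner_mmap_polyC.
    have [->|du] := eqVneq disc.[u] 0; first by rewrite mulr0.
    have GE : (fun l => (G l).[u]) =1 point (Z + u *: (Q1 *m diag_mx (\row_a a%:R) *m P1)) s.
      by move=> l; rewrite -pointD /G hornerD hornerC hornerZ hornerX mulrC.
    rewrite (meval_eq _ GE) -coef_map (R_good _ _ P1 Q1 (T + u *: diag_mx (\row_a a%:R))) ?coef0 ?mul0r //.
    - apply/is_trig_mxP => a b ab; rewrite !mxE (is_trig_mxP tT) // -val_eqE ltn_eqF //= mulr0n mulr0 addr0 //.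
    - by rewrite ZE mulmxDr mulmxDl -scalemxAr -scalemxAl.
    move=> a b; rewrite !mxE !eqxx !mulr1n => eab; apply/eqP/negPn/negP => ab.
    move/negP: du; apply; rewrite horner_prod (bigD1 (a, b)) //=.
    rewrite hornerD hornerC hornerZ hornerX mulf_eq0; apply/orP; left.
    by rewrite mulrC mulrBr addrACA -opprD eab subrr.
  move/eqP; rewrite mulf_eq0 (negPf disc0) orbF => /eqP /(congr1 (horner^~ 0)).
  rewrite horner0 horner_mmap_polyC => <-; apply: meval_eq => l.
  by rewrite /G hornerD hornerC hornerZ hornerX mulr0 addr0.
exists W`_0 => Z s; have := pencilE P Z s 0; rewrite rmorph0 addr0 => <-.
rewrite E rem0 addr0 rmorphM hornerM /= DE mulrC !horner_coef0 coef_map; congr (_ * _).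
exact: char_poly_opp_coef0.
Qed.
End DetDivides.

(** * The case [k = n - 2] *)

Definition quad_disc (p : {poly CC}) := p`_1 ^+ 2 - 4%:R * p`_2 * p`_0.

Lemma quad_disc_shift (p : {poly CC}) a : (size p <= 3)%N -> quad_disc (p \Po ('X - a%:P)) = quad_disc p.
Proof.
move=> sp; have [] := cubic_shift a (leq_trans sp (leqnSn 3)).
rewrite (nth_default 0 sp) /quad_disc => _ -> -> ->; ring.
Qed.

Lemma quad_discZ a (p : {poly CC}) : quad_disc (a *: p) = a ^+ 2 * quad_disc p.
Proof. rewrite /quad_disc !coefZ; ring. Qed.

Lemma quad_disc_char_poly (d : 'M[CC]_2) : quad_disc (char_poly d) = \tr d ^+ 2 - 4%:R * \det d.
Proof.
have c2 : (char_poly d)`_2 = 1.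
  by have /monicP := char_poly_monic d; rewrite /lead_coef size_char_poly.
rewrite /quad_disc c2 char_poly_det.
have -> : (char_poly d)`_1 = - \tr d by rewrite -(@char_poly_trace _ 2).
by rewrite sqrrN sqrrN expr1n mulr1 mul1r.
Qed.

Lemma qinvariant_quad_disc k : qinvariant (fun g : qel (k + 2) k => quad_disc (chi g)).
Proof. by apply: qinvariant_fun_chi => g a; rewrite quad_disc_shift // size_chi. Qed.

Lemma polyfun_on_quad_disc n k : polyfun_on (fun g : qel n k => quad_disc (chi g)).
Proof.
move=> p G pG; have H := polyfun_chi pG.
by apply: polyfunB; [apply: polyfunX|apply: polyfunM => //; apply: polyfunM => //; exact: polyfun_const].
Qed.

(** Traceless with determinant -s: the normal form of a 2 x 2 matrix modulo scalars whose
    discriminant 4 s is nonzero. *)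
Definition companion2 (s : CC) : 'M[CC]_2 :=
  \matrix_(i, j) if (i == 0) && (j == 1) then s else if (i == 1) && (j == 0) then 1 else 0.

Lemma quad_disc_slice k (Z : 'M[CC]_k) (d : 'M[CC]_2) :
  quad_disc (chi (slice Z d)) = \det Z ^+ 2 * (\tr d ^+ 2 - 4%:R * \det d).
Proof. by rewrite chi_slice quad_discZ quad_disc_char_poly exprMn det_flip_sqr mul1r. Qed.

Lemma det2 (R : comNzRingType) (M : 'M[R]_2) : \det M = M 0 0 * M 1 1 - M 0 1 * M 1 0.
Proof.
rewrite (expand_det_row _ 0) !big_ord_recl big_ord0 addr0 /cofactor !det_mx11 !mxE /= expr0 expr1 mul1r mulN1r mulrN.
by congr (_ * M _ _ - M _ _ * M _ _); apply: val_inj.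
Qed.

Lemma trace2 (R : pzSemiRingType) (M : 'M[R]_2) : \tr M = M 0 0 + M 1 1.
Proof. by rewrite /mxtrace !big_ord_recl big_ord0 addr0; congr (_ + M _ _); apply: val_inj. Qed.

Lemma mulmx2E (R : pzSemiRingType) m p (A : 'M[R]_(m, 2)) (B : 'M[R]_(2, p)) i j : (A *m B) i j = A i 0 * B 0 j + A i 1 * B 1 j.
Proof.
rewrite mxE !big_ord_recl big_ord0 addr0; congr (_ + A _ _ * B _ _); exact: val_inj.
Qed.

Lemma mx2P (R : Type) (A B : 'M[R]_2) :
  A 0 0 = B 0 0 -> A 0 1 = B 0 1 -> A 1 0 = B 1 0 -> A 1 1 = B 1 1 -> A = B.
Proof.
move=> h1 h2 h3 h4; apply/matrixP => i j.
have o2 (x : 'I_2) : x = 0 \/ x = 1 by case: x => -[|[|//]] p; [left|right]; apply: val_inj.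
by case: (o2 i) => ->; case: (o2 j) => ->.
Qed.

(** The traceless [d0] satisfies d0^2 = s, so it becomes the companion matrix in the basis x, d0 x
    for a cyclic vector x. The determinant of that basis is quadratic in x, and a square root
    normalises it to 1. *)
Lemma conj_companion2 (d : 'M[CC]_2) s : 4%:R * s = \tr d ^+ 2 - 4%:R * \det d -> s != 0 ->
  exists g h a, [/\ g *m h = 1%:M, \det g = 1 & g *m (d + a%:M) *m h = companion2 s].
Proof.
move=> hs s0; pose a := - (\tr d / 2%:R); pose d0 := d + a%:M.
have n2 : 2%:R != 0 :> CC by rewrite pnatr_eq0.
have n4 : 4%:R != 0 :> CC by rewrite pnatr_eq0.
set p := d0 0 0; set q := d0 0 1; set r := d0 1 0.
have d11 : d0 1 1 = - p.
  by rewrite /p /d0 !mxE /= !mulr1n /a trace2; field.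
have sE : s = p ^+ 2 + q * r.
  by apply: (mulfI n4); rewrite hs trace2 det2 /p /q /r /d0 !mxE /= !mulr1n !mulr0n /a trace2; field.
(* Coordinates of the cyclic vector: one of (1, 0), (0, 1), (1, 1) works because s != 0 forces d0 !=
   0. *)
have [v [w hvw]] : exists v w, v * (v * r - w * p) - w * (v * p + w * q) != 0.
  have [r0|r0] := eqVneq r 0; last by exists 1, 0; rewrite !mul0r mul1r !subr0 mul1r.
  have [q0|q0] := eqVneq q 0; last by exists 0, 1; rewrite !mul0r mul1r !add0r oppr_eq0 mul1r.
  exists 1, 1; rewrite r0 q0 !mul1r sub0r addr0 -opprD oppr_eq0 -mulr2n mulrn_eq0 /=.
  by apply: contra s0 => /eqP p0; rewrite sE p0 q0 expr0n mul0r addr0.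
set D := v * (v * r - w * p) - w * (v * p + w * q) in hvw.
pose cc := (sqrtC D)^-1; have cc0 : cc != 0 by rewrite invr_eq0 sqrtC_eq0.
have ccD : cc ^+ 2 * D = 1 by rewrite exprVn sqrtCK mulVf.
pose K : 'M[CC]_2 := \matrix_(i, j) (cc * (if j == 0 then (if i == 0 then v else w) else
   (if i == 0 then v * p + w * q else v * r - w * p))).
have dK : \det K = 1 by rewrite det2 !mxE /= -ccD /D; ring.
have uK : K \in unitmx by rewrite unitmxE dK unitr1.
have dKK : d0 *m K = K *m companion2 s.
  by apply: mx2P; rewrite !mulmx2E -/p -/q -/r ?d11 !mxE /= ?sE; ring.
exists (invmx K), K, a; split; rewrite ?mulVmx //; first by rewrite det_inv dK invr1.
by rewrite -mulmxA dKK mulmxA mulVmx // mul1mx.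
Qed.

Section CorankTwo.
Variables (k N : nat) (e : 'I_N -> qel (k.+1 + 2) k.+1) (c : 'I_N -> 'I_N -> 'I_N -> CC).
Hypotheses (he : is_q_basis e) (hc : struct_consts e c).
Let n_gt0 : (0 < k.+1 + 2)%N. Proof. by []. Qed.
Let q := (k.+1 * k.+1 + 1)%N.
Implicit Types g : qel (k.+1 + 2) k.+1.

Lemma companion_slice g : \det (g.2 *m g.1.2) != 0 -> quad_disc (chi g) != 0 ->
  exists s, quad_disc (chi g) = 4%:R * \det (g.2 *m g.1.2) ^+ 2 * s /\
  forall f : qel (k.+1 + 2) k.+1 -> CC, qinvariant f -> f g = f (slice (g.2 *m g.1.2) (companion2 s)).
Proof.
case: g => -[A X] Y /= dZ hD; have uZ : Y *m X \in unitmx by rewrite unitmxE unitfE.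
have [d hd] := qinvariant_slice A uZ.
have n4 : 4%:R != 0 :> CC by rewrite pnatr_eq0.
have E := hd _ (@qinvariant_quad_disc _); rewrite -/(slice _ d) quad_disc_slice in E.
pose s := (\tr d ^+ 2 - 4%:R * \det d) / 4%:R.
have hs : 4%:R * s = \tr d ^+ 2 - 4%:R * \det d by rewrite mulrC divfK.
have s0 : s != 0 by apply: contra hD => /eqP s0; rewrite E -hs s0 !mulr0.
have [g [h [a [gh dg gdh]]]] := conj_companion2 hs s0.
exists s; split; first by rewrite E -hs; ring.
move=> f hf; rewrite (hd f hf) -/(slice _ d) -(qinvariant_slice_shift _ _ a hf) -gdh.
have GH : block_mx 1%:M 0 0 g *m block_mx 1%:M 0 0 h = 1%:M :> 'M[CC]_(k.+1 + 2).
  by rewrite mulmx_block !mul1mx !mul0mx !mulmx0 gh !addr0 add0r -scalar_mx_block.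
have dG : \det (block_mx 1%:M 0 0 g : 'M[CC]_(k.+1 + 2)) = 1 by rewrite det_lblock det1 mul1r.
rewrite /slice -(qinvariant_conj _ _ _ hf GH dG); congr (f (_, _, _)).
- by rewrite mulmx_block !(mul1mx, mul0mx, mulmx0, addr0, add0r) mulmx_block !(mul1mx, mul0mx, mulmx0, mulmx1, addr0, add0r).
- by rewrite mul_block_col mul1mx !mul0mx mulmx0 !addr0.
by rewrite mul_row_block mul1mx !mul0mx mulmx0 !addr0.
Qed.

(** Blocks are chosen so that A12 X2 = a E_ij. Then det (t Z + a E_ij) = a t^k times the cofactor,
    as det Z = 0, and [chi] is linear in t with discriminant (a x)^2. Hence the discriminant is free
    over corank-one Z. *)
Lemma exists_disc (Z : 'M[CC]_k.+1) s : \det Z = 0 -> (exists i j, cofactor Z i j != 0) ->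
  exists g, g.2 *m g.1.2 = Z /\ quad_disc (chi g) = s.
Proof.
move=> dZ [i [j cij]]; set x := cofactor Z i j in cij.
pose a := sqrtC s / x; pose w := \det (flip_mx CC k.+1 2).
exists (block_mx 0 (a *: delta_mx i 0) 0 0, col_mx Z (delta_mx 0 j), row_mx 1%:M 0).
split; first by rewrite /= mul_row_col mul1mx mul0mx addr0.
have -> : chi (block_mx 0 (a *: delta_mx i 0 : 'M_(_, 2)) 0 0, col_mx Z (delta_mx 0 j), row_mx 1%:M 0) = (w * (a * x)) *: 'X.
  apply: (@mulfI {poly CC} 'X^(k.+1)); first by rewrite expf_neq0 ?polyX_eq0.
  rewrite chi_degenerate -/w; set M := _ + _.
  have ME i' j' : M i' j' = 'X * (Z i' j')%:P + (a * ((i' == i) && (j' == j))%:R)%:P.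
    by rewrite /M -scalemxAl mul_delta_mx !mxE.
  have dM : \det M = \sum_j' ('X * (Z i j')%:P) * cofactor M i j' + a%:P * cofactor M i j.
    rewrite (expand_det_row _ i); under eq_bigr do rewrite ME eqxx mulrDl.
    rewrite big_split /=; congr (_ + _); rewrite (bigD1 j) //= eqxx mulr1 big1 ?addr0 // => j' /negPf ->.
    by rewrite mulr0 polyC0 mul0r.
  have cM j' : cofactor M i j' = 'X^k * (cofactor Z i j')%:P.
    rewrite /cofactor rmorphM rmorphXn rmorphN1 mulrCA; congr (_ * _).
    rewrite -det_map_mx -detZ; congr (\det _); apply/matrixP => u v; rewrite [LHS]mxE [LHS]mxE ME !mxE.
    by rewrite eq_sym (negPf (neq_lift _ _)) mulr0 polyC0 addr0.
  rewrite dM; under eq_bigr do rewrite cM.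
  have -> : \sum_j' 'X * (Z i j')%:P * ('X^k * (cofactor Z i j')%:P) = 'X^(k.+1) * (\det Z)%:P.
    rewrite (expand_det_row _ i) rmorph_sum mulr_sumr; apply: eq_bigr => j' _.
    by move: (cofactor Z i j') => b /=; rewrite polyCM exprS; ring.
  rewrite dZ polyC0 mulr0 add0r cM -/x; clearbody x; rewrite -!mul_polyC !polyCM !exprS; ring.
rewrite quad_discZ /quad_disc !coefX /= ?mulr0 ?mul0r subr0 expr1n mulr1 exprMn det_flip_sqr mul1r.
by rewrite /a divfK // sqrtCK.
Qed.

Lemma polyfun_point p (h : ('I_p -> CC) -> 'M[CC]_k.+1) (s : ('I_p -> CC) -> CC) :
  (forall i j, polyfun (fun v => h v i j)) -> polyfun s ->
  forall l, polyfun (fun v => point (h v) (s v) l).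
Proof.
move=> hh hs l; rewrite /point; case: (split l) => [a|_] //.
have [i j] := mxvec_indexP a; by apply: polyfun_ext (hh i j) => v; rewrite mxvecE.
Qed.

(** On the slice the discriminant is 4 det(Z)^2 s. Expressing s through it creates powers of that
    factor in the denominator, which are cleared here. *)
Lemma homogenize (Q : {mpoly CC[q]}) : exists a (P : {mpoly CC[q]}), forall Z s,
  (4%:R * \det Z ^+ 2) ^+ a * Q.@[point Z s] = P.@[point Z (4%:R * \det Z ^+ 2 * s)].
Proof.
pose del (Z : 'M[CC]_k.+1) := 4%:R * \det Z ^+ 2.
have [T hT] : exists T : {mpoly CC[q]}, forall Z s, T.@[point Z s] = del Z.
  have [T hT] : polyfun (fun v : 'I_q -> CC => del (vec_mx (\row_a v (lshift 1 a)))).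
    apply: polyfunM; first exact: polyfun_const.
    apply/polyfunX/polyfun_det; apply: polyfun_vec_mx => l.
    by apply: polyfun_ext (polyfun_var (lshift 1 l)) => v; rewrite mxE.
  by exists T => Z s; rewrite -hT vec_mx_point.
pose D Q := exists a (P : {mpoly CC[q]}), forall Z s,
  del Z ^+ a * Q.@[point Z s] = P.@[point Z (del Z * s)].
have Dc x : D x%:MP by exists 0%N, x%:MP => Z s; rewrite expr0 mul1r !mevalC.
have DD Q1 Q2 : D Q1 -> D Q2 -> D (Q1 + Q2).
  move=> [a1 [P1 h1]] [a2 [P2 h2]]; exists (a1 + a2)%N, (T ^+ a2 * P1 + T ^+ a1 * P2) => Z s.
  rewrite !mevalD !mevalM !rmorphXn /= !hT -h1 -h2 exprD; ring.
have DM Q1 Q2 : D Q1 -> D Q2 -> D (Q1 * Q2).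
  move=> [a1 [P1 h1]] [a2 [P2 h2]]; exists (a1 + a2)%N, (P1 * P2) => Z s.
  rewrite !mevalM -h1 -h2 exprD; ring.
have DX l : D 'X_l.
  have [l1 lE|l1 lE] := splitP l.
    exists 0%N, 'X_l => Z s; rewrite expr0 mul1r !mevalXU /point.
    by have -> : l = lshift 1 l1 by [apply: val_inj]; rewrite (unsplitK (inl _)).
  exists 1%N, 'X_l => Z s; rewrite expr1 !mevalXU /point.
  by have -> : l = rshift _ l1 by [apply: val_inj]; rewrite (unsplitK (inr _)).
suff : D Q by [].
clearbody D; elim/mpolyind: Q => [|a m Q _ _ IH]; first by rewrite -mpolyC0.
apply: (DD) IH; rewrite -mul_mpolyC; apply: (DM) => //.
rewrite mpolyXE_id; elim/big_rec: _ => [|i x _ hx]; first by rewrite -mpolyC1.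
apply: (DM) => //; elim: (m i) => [|l IH]; first by rewrite expr0 -mpolyC1.
by rewrite exprS; apply: (DM).
Qed.

Lemma polynomial_corank2 : sym_inv_polynomial c.
Proof.
have [fz hz] := fin_all_exists (realize_mulYX n_gt0 he hc).
have [FD iD vD] := realize_invariant n_gt0 he hc (@qinvariant_quad_disc k.+1) (@polyfun_on_quad_disc _ _).
pose f (l : 'I_q) := match split l with inl a => fz a | inr _ => FD end.
have fi l : sym_invariant c (f l).
  by rewrite /f; case: (split l) => [a|_]; [case: (hz a)|exact: iD].
have fv P g : (P \mPo [tuple f l | l < q]).@[ev e g] = P.@[point (g.2 *m g.1.2) (quad_disc (chi g))].
  rewrite comp_mpoly_meval; apply: meval_eq => l; rewrite tnth_mktuple /f /point.
  by case: (split l) => // a; case: (hz a).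
have n4 : 4%:R != 0 :> CC by rewrite pnatr_eq0.
have slice_disc Z s : quad_disc (chi (slice (Z : 'M_k.+1) (companion2 s))) = 4%:R * \det Z ^+ 2 * s.
  by rewrite quad_disc_slice trace2 det2 !mxE /=; ring.
exists q, [tuple f l | l < q]; split.
- by move=> l; rewrite tnth_mktuple; exact: fi.
- move=> P P0; apply: mpoly_meval0 => v.
  have pd : polyfun (fun v : 'I_q -> CC => \det (vec_mx (\row_a v (lshift 1 a)) : 'M_k.+1)).
    apply/polyfun_det; apply: polyfun_vec_mx => l.
    by apply: polyfun_ext (polyfun_var (lshift 1 l)) => w; rewrite mxE.
  apply: (polyfun_dense (polyfun_meval P) pd) => {v} [|v].
    by exists (point 1%:M 0); rewrite vec_mx_point det1 oner_neq0.
  rewrite (meval_eq _ (pointE v)); move: (vec_mx _) (v _) => Z s {v} dZ.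
  (* The slice parameter for which the discriminant equals s; so the generators take every pair (Z,
     s) with Z invertible. *)
  pose s' := s / (4%:R * \det Z ^+ 2).
  have := fv P (slice Z (companion2 s')); rewrite P0 meval0 slice_mulYX slice_disc => ->.
  by rewrite /s' mulrC divfK // mulf_neq0 // expf_neq0.
move=> F hF; have hq := sym_invariant_qinvariant n_gt0 he hc hF.
have pF : polyfun_on (fun g => F.@[ev e g]).
  by move=> p G pG; apply: (polyfun_comp (f := fun s => F.@[s])) => [|l]; [exact: polyfun_meval|exact: polyfun_ev].
have pP P : polyfun_on (fun g => P.@[point (g.2 *m g.1.2) (quad_disc (chi g))]).
  move=> p G pG; apply: (polyfun_comp (f := fun s => P.@[s])) => [|l]; first exact: polyfun_meval.
  apply: polyfun_point => [i j|]; last exact: polyfun_on_quad_disc.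
  by case: pG => _ hX hY; apply: polyfun_mulmx.
pose Good a := exists P : {mpoly CC[q]}, forall g,
  \det (g.2 *m g.1.2) ^+ a * F.@[ev e g] = P.@[point (g.2 *m g.1.2) (quad_disc (chi g))].
have pdet a : polyfun_on (fun g => \det (g.2 *m g.1.2) ^+ a).
  by move=> p G pG; apply: polyfunX; apply: polyfun_on_detYX.
have [a Ga] : exists a, Good a.
  pose S (v : 'I_q -> CC) := slice (vec_mx (\row_a v (lshift 1 a)) : 'M_k.+1) (companion2 (v (rshift _ 0))).
  have pS : polyfun_qel S.
    apply: polyfun_slice => i j.
      apply: polyfun_vec_mx => l.
      by apply: polyfun_ext (polyfun_var (lshift 1 l)) => w; rewrite mxE.
    apply: polyfun_ext (_ : polyfun (fun v : 'I_q -> CC => if (i == 0) && (j == 1) then v (rshift (k.+1 * k.+1) 0)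
      else if (i == 1) && (j == 0) then 1 else 0)); first by move=> v; rewrite mxE.
    case: ((i == 0) && (j == 1)); first exact: polyfun_var.
    by case: ifP => _; exact: polyfun_const.
  have [Q hQ] := pF _ _ pS.
  have {}hQ Z s : Q.@[point Z s] = F.@[ev e (slice Z (companion2 s))].
    by rewrite -hQ /S vec_mx_point point_last.
  have [a [P hP]] := homogenize Q.
  exists (2 * a)%N, (((4%:R ^+ a)^-1)%:MP * P) => g; apply/eqP; rewrite -subr_eq0; apply/eqP; move: g.
  apply: (@qel_dense _ _ _ (fun g => \det (g.2 *m g.1.2) * quad_disc (chi g))).
  - move=> p G pG; apply: polyfunB; last exact: pP.
    by apply: polyfunM; [exact: pdet|exact: pF].
  - move=> p G pG; apply: polyfunM; [exact: polyfun_on_detYX|exact: polyfun_on_quad_disc].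
  - exists (slice 1%:M (companion2 1)); rewrite slice_disc slice_mulYX det1 expr1n !mulr1 mul1r //.
  move=> g; rewrite mulf_eq0 negb_or => /andP[h1 h2].
  have [s [hs hsl]] := companion_slice h1 h2.
  rewrite (hsl _ hq) -hQ mevalM mevalC hs -hP exprMn exprM; apply/eqP.
  by rewrite subr_eq0 !mulrA mulVf ?mul1r // expf_neq0.
elim: a Ga => [[P hP]|a IH [P hP]].
  exists P; apply: (mpoly_ev_eq n_gt0 he) => g; by rewrite fv -hP mul1r.
apply: IH.
(* Over each corank-one Z and each s there is a point at which the left side of [hP] vanishes. Thus
   the determinant divides P, and the exponent drops by one. *)
have [Q hQ] : exists Q : {mpoly CC[q]}, forall Z s, P.@[point Z s] = \det Z * Q.@[point Z s].
  apply: det_dvd => Z s dZ cZ; have [g [gZ <-]] := exists_disc s dZ cZ.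
  by rewrite -{1}gZ -hP gZ dZ exprS !mul0r.
exists Q => g; apply/eqP; rewrite -subr_eq0; apply/eqP; move: g.
apply: (qel_dense _ (@polyfun_on_detYX _ _) (exists_detYX _ _)).
  by move=> p G pG; apply: polyfunB; [apply: polyfunM; [exact: pdet|exact: pF]|exact: pP].
move=> g dg; apply: (mulfI dg); rewrite mulr0 mulrBr mulrA -exprS hP hQ; exact: subrr.
Qed.
End CorankTwo.

(** * Pfaffians of skew-symmetric matrices *)

Section PairedPfaffian.
Variable R : comNzRingType.

(** The Pfaffian up to sign and the factor 2^m m!, with j paired to m + j so as to match the block
    form of the symplectic matrix. *)
Definition pfpair m (M : 'M[R]_(m + m)) : R :=
  \sum_(s : 'S_(m + m)) (-1) ^+ s * \prod_(j < m) M (s (lshift m j)) (s (rshift m j)).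

Lemma sum_perm_rows n (P : 'M[R]_n) (g : 'I_n -> 'I_n) :
  \sum_(s : 'S_n) (-1) ^+ s * \prod_l P (s l) (g l) = \det (\matrix_(i, j) P j (g i)).
Proof.
apply: eq_bigr => s _; congr (_ * _).
by apply: eq_bigr => l _; rewrite mxE.
Qed.

(** As for the multiplicativity of determinants: expanding P M P^T gives a sum over all index maps,
    the sum over permutations becomes a determinant with repeated rows unless the map is injective,
    and injective maps are permutations. *)
Lemma pfpair_congr m (P M : 'M[R]_(m + m)) : pfpair (P *m M *m P^T) = \det P * pfpair M.
Proof.
pose n := (m + m)%N; pose F := {ffun 'I_n -> 'I_n}.
pose W (g : 'I_n -> 'I_n) := \prod_(j < m) M (g (lshift m j)) (g (rshift m j)).
transitivity (\sum_(g : F) W g * \det (\matrix_(i, j) P j (g i))).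
  under [RHS]eq_bigr do rewrite -sum_perm_rows big_distrr /=.
  rewrite exchange_big; apply: eq_bigr => s _ /=.
  under [RHS]eq_bigr do rewrite mulrCA.
  rewrite -big_distrr /=; congr (_ * _).
  pose T j (xy : 'I_n * 'I_n) := P (s (lshift m j)) xy.1 * M xy.1 xy.2 * P (s (rshift m j)) xy.2.
  transitivity (\prod_(j < m) \sum_xy T j xy).
    apply: eq_bigr => j _; rewrite mxE.
    rewrite (eq_bigr (fun y => \sum_x T j (x, y))) => [|y _]; last first.
      by rewrite !mxE big_distrl.
    by rewrite exchange_big pair_big_dep /=; apply: eq_bigr => -[x y].
  rewrite bigA_distr_bigA (reindex (fun g : F => [ffun j => (g (lshift m j), g (rshift m j))])) /=.
    apply: eq_bigr => g _; rewrite big_split_ord /= /W -!big_split /=.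
    by apply: eq_bigr => j _; rewrite /T ffunE /= mulrA [M _ _ * _]mulrC.
  exists (fun f : {ffun 'I_m -> 'I_n * 'I_n} =>
    [ffun l => match split l with inl j => (f j).1 | inr j => (f j).2 end]) => [g _|f _].
    apply/ffunP => l; rewrite ffunE; case: splitP => j e; rewrite ffunE /=; congr (g _); exact: val_inj.
  apply/ffunP => j; rewrite !ffunE (unsplitK (inl _)) (unsplitK (inr _)); by case: (f j).
rewrite (bigID (fun f : F => injectiveb f)) /= addrC big1 ?add0r => [|f Uf]; last first.
  case/injectivePn: Uf => i1 [i2 Di12 Ef12].
  by rewrite (determinant_alternate Di12) ?mulr0 // => j; rewrite !mxE Ef12.
rewrite (reindex (@pval _)) /=; last first.
  pose in_Sn := insubd (1%g : 'S_n).
  by exists in_Sn => /= f Uf; first apply: val_inj; apply: insubdK.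
rewrite /pfpair big_distrr /=; apply: eq_big => /= [s | s _]; rewrite ?(valP s) //.
have -> : \matrix_(i, j) P j (pval s i) = row_perm s P^T.
  by apply/matrixP => i j; rewrite !mxE pvalE.
rewrite row_permE det_mulmx det_perm det_tr mulrC -mulrA mulrCA; congr (_ * (_ * _)).
by apply: eq_bigr => j _; rewrite !pvalE.
Qed.

Definition symplectic_mx m : 'M[R]_(m + m) := block_mx 0 1%:M (- 1%:M) 0.
End PairedPfaffian.

(** Only nonvanishing is wanted, so the terms are not counted. Over the integers each is zero or a
    square, and the identity contributes 1. A permutation with nonzero product carries pairs to
    pairs up to flips. *)
Lemma pfpair_symplectic_int m : 0 < pfpair (symplectic_mx int m).
Proof.
have nonneg (s : 'S_(m + m)) :
    0 <= (-1) ^+ s * \prod_(j < m) symplectic_mx int m (s (lshift m j)) (s (rshift m j)).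
  have [/prodf_eq0[j _ /eqP j0]|nz] := boolP (\prod_(j < m) symplectic_mx int m (s (lshift m j)) (s (rshift m j)) == 0).
    by rewrite (bigD1 j) //= j0 mul0r mulr0.
  pose eps (i : 'I_(m + m)) : int := if split i is inl _ then 1 else -1.
  pose p (i : 'I_(m + m)) : 'I_m := match split i with inl j => j | inr j => j end.
  have epsl j : eps (lshift m j) = 1 by rewrite /eps (unsplitK (inl _)).
  have epsr j : eps (rshift m j) = -1 by rewrite /eps (unsplitK (inr _)).
  have pl j : p (lshift m j) = j by rewrite /p (unsplitK (inl _)).
  have pr j : p (rshift m j) = j by rewrite /p (unsplitK (inr _)).
  have Jnz a b : symplectic_mx int m a b != 0 ->
      [/\ symplectic_mx int m a b = eps a, p b = p a & eps b = - eps a].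
    case: (split_ordP a) => a' ->; case: (split_ordP b) => b' ->; rewrite ?(epsl, epsr, pl, pr).
    - by rewrite block_mxEul mxE eqxx.
    - by rewrite block_mxEur mxE; case: (a' =P b') => [->|_]; rewrite ?eqxx.
    - by rewrite block_mxEdl !mxE; case: (a' =P b') => [->|_]; rewrite ?oppr0 ?eqxx ?opprK.
    by rewrite block_mxEdr mxE eqxx.
  have {}nz j : symplectic_mx int m (s (lshift m j)) (s (rshift m j)) != 0.
    by move/prodf_neq0: nz; apply.
  (* In sums and differences over each pair, s acts as [Q] on sums and as [E *m Q] on differences.
     So its sign is det(Q)^2 det(E), while the product of entries is det(E). *)
  pose K : 'M[int]_(m + m) := block_mx 1%:M 1%:M 1%:M (- 1%:M).
  pose Q : 'M[int]_m := \matrix_(j, l) (p (s (lshift m j)) == l)%:R.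
  pose E : 'M[int]_m := diag_mx (\row_j eps (s (lshift m j))).
  have KE a : row a K = row_mx (delta_mx 0 (p a)) (eps a *: delta_mx 0 (p a)).
    rewrite /K; case: (split_ordP a) => a' ->; rewrite ?(epsl, epsr, pl, pr).
      rewrite scale1r -[block_mx _ _ _ _]/(col_mx _ _) rowKu row_row_mx row1 //.
    by rewrite scaleN1r -[block_mx _ _ _ _]/(col_mx _ _) rowKd row_row_mx linearN /= row1.
  have KK : row_perm s K = K *m block_mx Q 0 0 (E *m Q).
    rewrite {2}/K mulmx_block !mul1mx !mulmx0 !addr0 !add0r mulNmx mul1mx.
    have rQ j : row j Q = delta_mx 0 (p (s (lshift m j))).
      by apply/rowP => l; rewrite !mxE eqxx eq_sym.
    have rEQ j : row j (E *m Q) = eps (s (lshift m j)) *: delta_mx 0 (p (s (lshift m j))).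
      by rewrite row_mul row_diag_mx mxE -scalemxAl -rowE rQ.
    apply/row_matrixP => l; rewrite row_permEsub row_rowsub KE.
    case: (split_ordP l) => j ->.
      by rewrite -[block_mx _ _ _ _]/(col_mx _ _) rowKu row_row_mx rQ rEQ.
    rewrite -[block_mx _ _ _ _]/(col_mx _ _) rowKd row_row_mx linearN /= rQ rEQ.
    by have [_ -> ->] := Jnz _ _ (nz j); rewrite scaleNr.
  have dK : \det K != 0.
    have KKT : K *m K = (2%:R)%:M.
      rewrite /K mulmx_block !mul1mx !mulmx1 mulmxN mulmx1 opprK subrr.
      by rewrite -raddfD /= -scalar_mx_block.
    have := congr1 determinant KKT; rewrite det_mulmx det_scalar => e.
    by apply/eqP => d0; move/eqP: e; rewrite d0 mul0r eq_sym expf_eq0 /= andbF.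
  have sg : (-1) ^+ s = \det Q * (\det E * \det Q) :> int.
    apply: (mulfI dK); have := congr1 determinant KK.
    by rewrite row_permE !det_mulmx det_perm det_lblock det_mulmx mulrC.
  have -> : \prod_(j < m) symplectic_mx int m (s (lshift m j)) (s (rshift m j)) = \det E.
    by rewrite det_diag; apply: eq_bigr => j _; have [-> _ _] := Jnz _ _ (nz j); rewrite [RHS]mxE.
  have -> : (-1) ^+ s * \det E = (\det Q * \det E) ^+ 2 by rewrite sg; ring.
  exact: sqr_ge0.
rewrite /pfpair (bigD1 1%g) //= ltr_pwDl //; last by apply: sumr_ge0.
rewrite odd_perm1 expr0 mul1r big1 // => j _.
by rewrite !perm1 block_mxEur mxE eqxx.
Qed.

Lemma pfpair_symplectic m : pfpair (symplectic_mx CC m) != 0.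
Proof.
have -> : pfpair (symplectic_mx CC m) = (pfpair (symplectic_mx int m))%:~R.
  rewrite /pfpair rmorph_sum; apply: eq_bigr => s _; rewrite rmorphM rmorphXn /= rmorphN1.
  congr (_ * _); rewrite rmorph_prod; apply: eq_bigr => j _.
  have -> : symplectic_mx CC m = map_mx intr (symplectic_mx int m).
    by rewrite /symplectic_mx map_block_mx !map_mx0 map_mxN map_mx1.
  by rewrite mxE.
by rewrite intr_eq0 lt0r_neq0 // pfpair_symplectic_int.
Qed.

Lemma symplectic_mx_unit (R : comNzRingType) m : symplectic_mx R m *m (- symplectic_mx R m) = 1%:M.
Proof.
rewrite mulmxN /symplectic_mx mulmx_block !mul0mx !mulmx0 !mul1mx !mulmx1 !addr0 !add0r.
by rewrite opp_block_mx !opprK !oppr0 -scalar_mx_block.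
Qed.

(** Symplectic Gram-Schmidt by strong induction: split off a hyperbolic pair x, y and pass to its
    orthogonal complement, spanned by the rows of [B]. Evenness of r is part of the conclusion and
    later yields evenness of ranks. *)
Lemma darboux r (M : 'M[CC]_r) : M^T = - M -> M \in unitmx ->
  exists m (P : 'M_(m + m, r)), r = (m + m)%N /\ P *m M *m P^T = symplectic_mx CC m.
Proof.
have [n] := ubnP r; elim: n => // n IH in r M *; rewrite ltnS => rn skew uM.
have alt (v : 'rV_r) : v *m M *m v^T = 0.
  have E : (v *m M *m v^T)^T = - (v *m M *m v^T).
    by rewrite !trmx_mul trmxK skew mulNmx mulmxN mulmxA.
  have : (v *m M *m v^T) *+ 2 = 0.
    by rewrite mulr2n -[X in X + _]opprK -E [X in X^T]mx11_scalar tr_scalar_mx -mx11_scalar addNr.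
  by move/eqP; rewrite -scaler_nat scaler_eq0 pnatr_eq0 /= => /eqP.
have sk p q (v : 'M_(p, r)) (w : 'M_(q, r)) : v *m M *m w^T = - (w *m M *m v^T)^T.
  by rewrite !trmx_mul trmxK skew mulNmx mulmxN opprK mulmxA.
case: r => [|r] in M rn skew uM alt sk *.
  by exists 0%N, 0; split=> //; apply/matrixP => -[].
pose x : 'rV[CC]_r.+1 := delta_mx 0 0.
(* Chosen so that [M *m y^T = x^T]; then x and y pair to 1. *)
pose y := (invmx M *m x^T)^T.
have xy : x *m M *m y^T = 1%:M.
  by rewrite /y trmxK mulmxA mulmxK // -[x *m _]/(_ *m _) trmx_delta mul_delta_mx; apply/matrixP => i j; rewrite !ord1 !mxE.
pose K := row_mx (M *m x^T) (M *m y^T) : 'M_(r.+1, 1 + 1).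
have [B [fB sB]] : exists B : 'M_(\rank (kermx K), r.+1), row_free B /\ (B :=: kermx K)%MS.
  by exists (row_base (kermx K)); split; [exact: row_base_free | exact: eq_row_base].
have BK : B *m K = 0.
  by apply/sub_kermxP; rewrite sB.
have [Bx By] : B *m M *m x^T = 0 /\ B *m M *m y^T = 0.
  by move: BK; rewrite mul_mx_row -row_mx0 => /eq_row_mx; rewrite !mulmxA.
have yx : y *m M *m x^T = - 1%:M by rewrite sk xy trmx1.
clearbody y.
have rB : (\rank (kermx K) < r.+1)%N.
  rewrite mxrank_ker ltn_subrL lt0n mxrank_eq0 andbT; apply/eqP => K0.
  have : y *m K = 0 by rewrite K0 mulmx0.
  rewrite mul_mx_row mulmxA yx -row_mx0 => /eq_row_mx[/matrixP/(_ 0 0)].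
  by rewrite !mxE => /eqP; rewrite oppr_eq0 oner_eq0.
pose M' := B *m M *m B^T.
have skew' : M'^T = - M' by rewrite /M' [in RHS]sk opprK.
(* A vector in the radical of the restricted form is orthogonal to x, to y and to their complement,
   hence to the whole space. *)
have uM' : M' \in unitmx.
  rewrite -row_free_unit; apply: inj_row_free => v vM'.
  pose w := v *m B.
  have wB : w *m M *m B^T = 0 by rewrite /w -!mulmxA (mulmxA B) -/M'.
  have wx : w *m M *m x^T = 0 by rewrite /w -!mulmxA (mulmxA B) Bx mulmx0.
  have wy : w *m M *m y^T = 0 by rewrite /w -!mulmxA (mulmxA B) By mulmx0.
  have w0 : w *m M = 0.
    apply/rowP => l; rewrite [RHS]mxE; pose z := delta_mx 0 l : 'rV[CC]_r.+1.
    have -> : (w *m M) 0 l = (w *m M *m z^T) 0 0 by rewrite /z trmx_delta -colE [RHS]mxE.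
    clearbody z; pose z' := z - (z *m M *m y^T) *m x + (z *m M *m x^T) *m y.
    have z'K : z' *m K = 0.
      have lin (t : 'cV_r.+1) : z' *m M *m t = z *m M *m t - z *m M *m y^T *m (x *m M *m t)
          + z *m M *m x^T *m (y *m M *m t) by rewrite /z' !mulmxDl !mulNmx !mulmxA.
      rewrite mul_mx_row !mulmxA !lin (alt x) (alt y) xy yx.
      by rewrite !mulmx0 mulmxN !mulmx1 subr0 addr0 !subrr row_mx0.
    have /submxP[t z't] : (z' <= B)%MS by rewrite sB; apply/sub_kermxP.
    have -> : z = z' + (z *m M *m y^T) *m x - (z *m M *m x^T) *m y by rewrite /z' addrAC addrK subrK.
    have trD (u v1 : 'rV[CC]_r.+1) : (u + v1)^T = u^T + v1^T by apply/matrixP => i j; rewrite !mxE.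
    have trN (u : 'rV[CC]_r.+1) : (- u)^T = - u^T by apply/matrixP => i j; rewrite !mxE.
    rewrite z't !trD trN !trmx_mul mulmxDr mulmxDr mulmxN !mulmxA wB wx wy !mul0mx addr0 subr0.
    by rewrite mxE.
  have : w = 0 by rewrite -[w](mulmxK uM) w0 mul0mx.
  by move=> w00; apply: (row_free_inj fB); rewrite mul0mx.
have [m [P [rm PP]]] := IH _ M' (leq_trans rB rn) skew' uM'.
pose P' := col_mx (col_mx x (usubmx P *m B)) (col_mx y (dsubmx P *m B)) : 'M_((1 + m) + (1 + m), r.+1).
have PE : usubmx P *m M' *m (usubmx P)^T = 0 /\ usubmx P *m M' *m (dsubmx P)^T = 1%:M
   /\ dsubmx P *m M' *m (usubmx P)^T = - 1%:M /\ dsubmx P *m M' *m (dsubmx P)^T = 0.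
  move: PP; rewrite -{1 2}[P]vsubmxK tr_col_mx mul_col_mx mul_col_row => /eq_block_mx.
  by case=> -> -> -> ->.
case: PE => e1 [e2 [e3 e4]].
have EP : P' *m M *m P'^T = symplectic_mx CC (1 + m).
  have xB : x *m M *m B^T = 0 by rewrite sk Bx trmx0 oppr0.
  have yB : y *m M *m B^T = 0 by rewrite sk By trmx0 oppr0.
  have BB p q (a : 'M_(p, _)) (b : 'M_(q, _)) : a *m B *m M *m (b *m B)^T = a *m M' *m b^T.
    by rewrite trmx_mul /M' !mulmxA.
  have cB p q (a : 'M_(p, _)) (b : 'M_(q, r.+1)) : B *m M *m b^T = 0 -> a *m B *m M *m b^T = 0.
    by move=> h; rewrite -!mulmxA (mulmxA B) h mulmx0.
  have Bc p q (a : 'M_(p, r.+1)) (b : 'M_(q, _)) : a *m M *m B^T = 0 -> a *m M *m (b *m B)^T = 0.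
    by move=> h; rewrite trmx_mul mulmxA h mul0mx.
  rewrite /P' /symplectic_mx tr_col_mx mul_col_mx mul_col_row; congr block_mx.
  - rewrite tr_col_mx mul_col_mx mul_col_row BB e1 (cB _ _ _ _ Bx) (Bc _ _ _ _ xB) (alt x).
    by rewrite -[RHS]block_mx0.
  - rewrite tr_col_mx mul_col_mx mul_col_row BB e2 (cB _ _ _ _ By) (Bc _ _ _ _ xB) xy.
    by rewrite -scalar_mx_block.
  - rewrite tr_col_mx mul_col_mx mul_col_row BB e3 (cB _ _ _ _ Bx) (Bc _ _ _ _ yB) yx.
    by rewrite scalar_mx_block opp_block_mx !oppr0.
  rewrite tr_col_mx mul_col_mx mul_col_row BB e4 (cB _ _ _ _ By) (Bc _ _ _ _ yB) (alt y).
  by rewrite -[RHS]block_mx0.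
(* The complement loses at most two dimensions, which bounds the size above; independence of the
   rows of P' bounds it below. *)
exists (1 + m)%N, P'; split=> //; apply/eqP; rewrite eqn_leq; apply/andP; split.
  have rK : (\rank K <= 2)%N by rewrite (leq_trans (rank_leq_col _)).
  have : (r.+1 - \rank K)%N = (m + m)%N by rewrite -mxrank_ker.
  move=> h; rewrite addnACA -h -leq_subLR; exact: leq_sub2l.
have fP' : row_free P'.
  apply: inj_row_free => v vP; rewrite -[v]mulmx1 -(symplectic_mx_unit CC (1 + m)) -EP.
  by rewrite !mulmxA vP !mul0mx.
by rewrite -(eqP fP') rank_leq_col.
Qed.

Lemma pfpair_neq0 m (M : 'M[CC]_(m + m)) : M^T = - M -> M \in unitmx -> pfpair M != 0.
Proof.
move=> sk uM; have [m' [P [mm PP]]] := darboux sk uM.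
have {}mm : m = m' by apply/double_inj; rewrite -!addnn.
case: m' / mm P PP => P PP.
apply/eqP => M0; have := pfpair_congr P M; rewrite PP M0 mulr0 => /eqP.
by rewrite (negPf (pfpair_symplectic m)).
Qed.

(** * Pfaffians of principal submatrices *)

Section PfaffianSum.
Variable R : comNzRingType.

Definition pfsum r (M : 'M[R]_r) : R :=
  \sum_(s : 'S_r) ((-1) ^+ s * \prod_(i < r | ~~ odd i) M (s i) (s (insubd i i.+1))).

(** The permutation t interleaves the halves, sending j to 2j and m + j to 2j + 1; composing with it
    costs only a sign. *)
Lemma pfsum_pfpair m (M : 'M[R]_(m + m)) : exists t : 'S_(m + m), pfsum M = (-1) ^+ t * pfpair M.
Proof.
case: m M => [|m] M.
  exists 1%g; rewrite odd_perm1 mul1r; apply: eq_bigr => s _; congr (_ * _).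
  by rewrite !big1 // => -[].
pose n := (m.+1 + m.+1)%N.
have he (j : 'I_m.+1) : (j.*2 < n)%N by rewrite /n addnn ltn_double.
have ho (j : 'I_m.+1) : (j.*2.+1 < n)%N by rewrite /n addnn ltn_Sdouble.
pose h (i : 'I_n) : 'I_n := match split i with inl j => Ordinal (he j) | inr j => Ordinal (ho j) end.
have hl j : h (lshift _ j) = Ordinal (he j) by rewrite /h (unsplitK (inl _)).
have hr j : h (rshift _ j) = Ordinal (ho j) by rewrite /h (unsplitK (inr _)).
have hinj : injective h.
  move=> a b; case: (split_ordP a) => a' ->; case: (split_ordP b) => b' ->; rewrite ?(hl, hr) => /(congr1 val) /= E.
  - by congr lshift; apply: val_inj; apply: double_inj.
  - by move/(congr1 odd): E; rewrite /= !odd_double.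
  - by move/(congr1 odd): E; rewrite /= !odd_double.
  by congr rshift; apply: val_inj; apply: double_inj; case: E.
pose t := perm hinj; exists t.
rewrite /pfpair big_distrr /= (reindex_inj (mulgI t)) /=; apply: eq_bigr => s _.
rewrite odd_permM signr_addb !mulrA -signr_addb addbb mul1r; congr (_ * _).
rewrite (reindex_onto (fun j => Ordinal (he j)) (fun i => inord i./2)) /=.
  apply: eq_big => [j|j _].
    by rewrite odd_double /= -val_eqE /= doubleK inordK ?eqxx.
  rewrite !permM !permE hl hr; congr (M _ (s _)); apply: val_inj.
  by rewrite /= val_insubd /= ho.
move=> i oi; apply: val_inj; have i2 : (i./2 < m.+1)%N.
  by rewrite -divn2 ltn_divLR // muln2 -addnn ltn_ord.
by rewrite /= inordK // -{2}[val i]odd_double_half (negPf oi).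
Qed.
End PfaffianSum.

(** Rows spanning the row space also give, by skewness, spanning columns, so the principal block on
    these indices has full rank. The indices are listed increasingly because the Pfaffians are taken
    over increasing [f] only. *)
Lemma skew_principal_submx N (M : 'M[CC]_N) : M^T = - M ->
  exists f : 'I_(\rank M) -> 'I_N, {mono f : a b / (a < b)%N} /\ principal_submx M f \in unitmx.
Proof.
move=> sk; pose f0 := maxrankfun M; pose S := [set f0 i | i : 'I_(\rank M)].
have cS : #|S| = \rank M by rewrite card_imset ?card_ord //; apply: maxrankfun_inj.
pose f (i : 'I_(\rank M)) : 'I_N := enum_val (cast_ord (esym cS) i).
have homof : {homo f : a b / (a < b)%N}.
  move=> a b ab; rewrite /f.
  have s0 : sorted (relpre val ltn) (enum S).
    rewrite /enum_mem sorted_filter //; first by move=> x y z; apply: ltn_trans.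
    by rewrite -sorted_map -enumT val_enum_ord iota_ltn_sorted.
  have x0 := f0 a; rewrite !(enum_val_nth x0).
  apply: (sorted_ltn_nth _ x0 s0) => //=; first by move=> x y z; apply: ltn_trans.
  - by rewrite inE -cardE cS.
  by rewrite inE -cardE cS.
exists f; split.
  move=> a b; case: (ltngtP a b) => ab; [exact: homof| |].
    by apply/negbTE; rewrite -leqNgt ltnW // homof.
  by rewrite (val_inj ab) ltnn.
pose D := principal_submx M f; pose Rf := rowsub f M.
have MR : (M <= Rf)%MS.
  rewrite -(eq_maxrowsub M); apply/row_subP => i; rewrite row_rowsub.
  have : f0 i \in S by apply: imset_f.
  move=> iS; have -> : maxrankfun M i = f (cast_ord cS (enum_rank_in iS (f0 i))).
    by rewrite /f cast_ordK enum_rankK_in.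
  by rewrite -row_rowsub row_sub.
have [C MC] := submxP MR.
have RfE : Rf = - (D^T *m C^T).
  apply/matrixP => i j; rewrite [LHS]mxE.
  have -> : M (f i) j = - M j (f i) by have /matrixP/(_ j (f i)) := sk; rewrite !mxE.
  have /matrixP/(_ j (f i)) -> := MC; rewrite !mxE; congr (- _).
  by apply: eq_bigr => l _; rewrite !mxE mulrC.
rewrite -row_free_unit /row_free eqn_leq rank_leq_row /=.
have rR : \rank Rf = \rank M by apply/eqP; rewrite eqn_leq mxrankS ?rowsub_sub // mxrankS.
by rewrite -{1}rR RfE mxrank_opp (leq_trans (mxrankM_maxl _ _)) // mxrank_tr.
Qed.

Lemma pfsum_principal_neq0 N (M : 'M[CC]_N) : M^T = - M ->
  exists f : 'I_(\rank M) -> 'I_N, {mono f : a b / (a < b)%N} /\ pfsum (principal_submx M f) != 0.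
Proof.
move=> sk; have [f [hf uf]] := skew_principal_submx sk; exists f; split=> //.
have skD : (principal_submx M f)^T = - principal_submx M f.
  by apply/matrixP => i j; have /matrixP/(_ (f i) (f j)) := sk; rewrite !mxE.
have [m [_ [rm _]]] := darboux skD uf.
move: (principal_submx M f) skD uf; rewrite rm => D skD uD.
by have [t ->] := pfsum_pfpair D; rewrite mulf_neq0 ?signr_eq0 ?pfpair_neq0.
Qed.

Lemma skew_rank_even N (M : 'M[CC]_N) : M^T = - M -> ~~ odd (\rank M).
Proof.
move=> sk; have [f [hf uf]] := skew_principal_submx sk.
have skD : (principal_submx M f)^T = - principal_submx M f.
  by apply/matrixP => i j; have /matrixP/(_ (f i) (f j)) := sk; rewrite !mxE.
by have [m [_ [rm _]]] := darboux skD uf; rewrite rm addnn odd_double.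
Qed.

Lemma meval_pfaffian N r (M : 'M[{mpoly CC[N]}]_r) (g : 'I_N -> CC) :
  exists2 a : CC, a != 0 & (pfaffian M).@[g] = a * pfsum (map_mx (meval g) M).
Proof.
exists ((2 ^ r./2 * r./2 `!)%:R)^-1.
  by rewrite invr_eq0 pnatr_eq0 muln_eq0 negb_or expn_eq0 /= -lt0n fact_gt0.
rewrite /pfaffian mevalZ rmorph_sum; congr (_ * _); apply: eq_bigr => s _.
rewrite rmorphM rmorphXn rmorphN1 rmorph_prod; congr (_ * _).
by apply: eq_bigr => i _; rewrite mxE.
Qed.

(** * Regular points for [k = n - 2] *)

Section LineArguments.
Variables (N : nat) (d : {mpoly CC[N]}).
Implicit Types g h : 'I_N -> CC.

Lemma mpoly_line g h : exists p : {poly CC}, forall t, p.[t] = d.@[fun l => g l + t * h l].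
Proof.
exists (mmap polyC (fun l => (g l)%:P + h l *: 'X) d) => t.
rewrite horner_mmap_polyC; apply: meval_eq => l.
by rewrite hornerD hornerC hornerZ hornerX mulrC.
Qed.

Lemma mpoly_line_noroot g h : (forall t, d.@[fun l => g l + t * h l] != 0) ->
  forall t, d.@[fun l => g l + t * h l] = d.@[g].
Proof.
move=> H t; have [p hp] := mpoly_line g h.
have pE : p = (p`_0)%:P by apply: poly_noroot => s; rewrite hp.
rewrite -hp pE hornerC -horner_coef0 hp; apply: meval_eq => l; by rewrite mul0r addr0.
Qed.

(* A polynomial without zeros on [C^2 \ {0}] is a nonzero constant, hence does not vanish at the origin. *)
Lemma mpoly_plane_origin g h :
  (forall u t, (u != 0) || (t != 0) -> d.@[fun l => u * g l + t * h l] != 0) ->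
  d.@[fun=> 0] != 0.
Proof.
move=> H.
have H1 u t : u != 0 -> d.@[fun l => u * g l + t * h l] = d.@[fun l => u * g l].
  by move=> u0; apply: (@mpoly_line_noroot (fun l => u * g l)) => t'; apply: H; rewrite u0.
have H2 u : d.@[fun l => 1 * h l + u * g l] = d.@[fun l => 1 * h l].
  apply: (@mpoly_line_noroot (fun l => 1 * h l)) => u'.
  by rewrite (@meval_eq _ _ _ (fun l => u' * g l + 1 * h l)) => [|l]; [apply: H; rewrite oner_neq0 orbT|exact: addrC].
have [p hp] := mpoly_line (fun=> 0) g.
set C := d.@[fun l => 1 * h l] in H2.
have pC u : u != 0 -> p.[u] = C.
  move=> u0; rewrite hp -(H2 u) -[RHS](@meval_eq _ _ (fun l => u * g l + 1 * h l)) => [|l]; last exact: addrC.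
  by rewrite (H1 u 1 u0); apply: meval_eq => l; rewrite add0r.
have pE : (p - C%:P) * 'X = 0.
  apply: poly_horner0 => u; rewrite hornerM hornerX hornerD hornerN hornerC.
  by have [->|u0] := eqVneq u 0; rewrite ?mulr0 // pC // subrr mul0r.
move/eqP: pE; rewrite mulf_eq0 polyX_eq0 orbF subr_eq0 => /eqP pE.
have -> : d.@[fun=> 0] = C.
  rewrite -(hornerC C 0) -pE hp; apply: meval_eq => l; by rewrite mul0r addr0.
have := H 0 1; rewrite oner_neq0 orbT => /(_ isT).
by rewrite (@meval_eq _ _ _ (fun l => 1 * h l)) // => l; rewrite mul0r add0r.
Qed.

Lemma mpoly_const_of_cone (reg : ('I_N -> CC) -> Prop) :
  d.@[fun=> 0] != 0 -> (forall g, reg g -> d.@[g] != 0) ->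
  (forall g t, t != 0 -> reg g -> reg (fun l => t * g l)) ->
  (exists2 h, polyfun h & (exists g, h g != 0) /\ forall g, h g != 0 -> reg g) ->
  exists a, a != 0 /\ d = a%:MP.
Proof.
move=> d0 dreg sreg [h ph [nh hreg]]; exists d.@[fun=> 0]; split=> //.
have E g : reg g -> d.@[g] = d.@[fun=> 0].
  move=> rg; have := @mpoly_line_noroot (fun=> 0) g _ 1 => <-; last first.
    move=> t; have [->|t0] := eqVneq t 0.
      by rewrite (@meval_eq _ _ _ (fun=> 0)) // => l; rewrite mul0r addr0.
    rewrite (@meval_eq _ _ _ (fun l => t * g l)) => [|l]; last by rewrite add0r.
    by apply: dreg; apply: sreg.
  by apply: meval_eq => l; rewrite add0r mul1r.
apply/eqP; rewrite -subr_eq0; apply/eqP; apply: mpoly_meval0.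
apply: (polyfun_dense (polyfun_meval _) ph nh) => g /hreg/E Eg.
by rewrite mevalB mevalC Eg subrr.
Qed.
End LineArguments.

(** * Bounds for the rank of the structure matrix *)

Section RankBounds.
Variables (n k N : nat) (e : 'I_N -> qel n k) (c : 'I_N -> 'I_N -> 'I_N -> CC).
Hypotheses (n_gt0 : (0 < n)%N) (he : is_q_basis e) (hc : struct_consts e c).
Implicit Types g : qel n k.

(** The flattened basis spans the kernel of the trace, a nonzero linear form on all triples. *)
Lemma basis_card : N.+1 = (n * n + n * k + k * n)%N.
Proof.
pose D := (n * n + n * k + k * n)%N.
pose phi (x : qel n k) : 'rV[CC]_D := row_mx (row_mx (mxvec x.1.1) (mxvec x.1.2)) (mxvec x.2).
pose psi (v : 'rV[CC]_D) : qel n k :=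
  (vec_mx (lsubmx (lsubmx v)), vec_mx (rsubmx (lsubmx v)), vec_mx (rsubmx v)).
have phiK v : phi (psi v) = v by rewrite /phi /psi /= !vec_mxK !hsubmxK.
have phi_inj x : phi x = 0 -> x = 0.
  case: x => -[A X] Y; rewrite /phi /= -!row_mx0 => /eq_row_mx[/eq_row_mx[hA hX] hY].
  by congr (_, _, _); apply: (can_inj mxvecK); rewrite linear0.
have phiD x y : phi (x + y) = phi x + phi y.
  by rewrite /phi /= !linearD /= !add_row_mx.
have phiZ a x : phi (a *: x) = a *: phi x.
  by rewrite /phi /= !linearZ /= !scale_row_mx.
have phiS (a : 'rV[CC]_N) : phi (\sum_i a 0 i *: e i) = a *m \matrix_i phi (e i).
  rewrite (big_morph phi phiD (id1 := 0)); last by rewrite -(scale0r 0) phiZ scale0r.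
  rewrite mulmx_sum_row; apply: eq_bigr => i _; by rewrite phiZ rowK.
pose Eb := \matrix_i phi (e i).
pose T : 'cV[CC]_D := col_mx (col_mx (mxvec 1%:M)^T 0) 0.
have phiT x : phi x *m T = (\tr x.1.1)%:M.
  rewrite /phi /T !mul_row_col !mulmx0 !addr0; apply/matrixP => i j; rewrite !ord1 !mxE mulr1n.
  have [q _ qK] := curry_mxvec_bij n n.
  rewrite (reindex _ (curry_mxvec_bij n n)) /= [RHS](eq_bigr (fun i => \sum_j x.1.1 i j * (i == j)%:R)).
    by rewrite pair_bigA; apply: eq_bigr => -[a b] _; rewrite !mxE !mxvecE !mxE.
  move=> a _; rewrite (bigD1 a) //= eqxx mulr1 big1 ?addr0 // => b; rewrite eq_sym => /negPf ->.
  by rewrite mulr0.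
have fE : row_free Eb.
  apply: inj_row_free => v; rewrite -phiS => /phi_inj h; apply/rowP => i; rewrite [RHS]mxE.
  by case: he => _ hf _; apply: (hf (fun i => v 0 i)); rewrite qcombE h.
have EK : (Eb :=: kermx T)%MS.
  apply/eqmxP/andP; split.
    apply/sub_kermxP/row_matrixP => i; rewrite row_mul rowK phiT row0.
    by rewrite (in_q_basis he) raddf0.
  apply/row_subP => i; set v := row i _.
  have hv : v *m T = 0 by apply/sub_kermxP; apply: row_sub.
  have hq : in_q (psi v).
    by have := phiT (psi v); rewrite phiK hv => /matrixP/(_ 0 0); rewrite !mxE mulr1n.
  have [a [ha _]] := evP he 0 hq.
  rewrite -[v]phiK ha; have -> : \sum_i0 a i0 *: e i0 = \sum_i0 (\row_l a l) 0 i0 *: e i0.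
    by apply: eq_bigr => l _; rewrite mxE.
  by rewrite phiS submxMl.
have := congr1 (fun=> \rank Eb) (erefl tt); rewrite [in RHS](eqP fE) EK mxrank_ker => <-.
have -> : \rank T = 1%N.
  apply/eqP; rewrite eqn_leq rank_leq_col lt0n mxrank_eq0; apply/eqP => T0.
  have := phiT (1%:M, 0, 0); rewrite T0 mulmx0 /= mxtrace1 => /matrixP/(_ 0 0)/eqP.
  by rewrite !mxE mulr1n eq_sym pnatr_eq0 -leqn0 leqNgt n_gt0.
by rewrite subn1 prednK // /D !addn_gt0 muln_gt0 n_gt0.
Qed.

Lemma struct_mx_skew s : (struct_mx_at c s)^T = - struct_mx_at c s.
Proof.
have [ga [hga _]] := ev_surj n_gt0 he.
have E i j : struct_mx_at c s i j = pairing (ga s) (qbr (e i) (e j)).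
  rewrite -(struct_mx_ev hc); rewrite !mxE; apply/esym; exact: meval_eq.
apply/matrixP => i j; rewrite mxE [RHS]mxE !E.
have -> : qbr (e j) (e i) = (-1) *: qbr (e i) (e j) :> qel n k.
  by rewrite /qbr qelZ !scaleN1r !opprB.
by rewrite pairingZr mulN1r.
Qed.

Lemma struct_mx_mul g (a : 'rV[CC]_N) j :
  (a *m struct_mx_at c (ev e g)) 0 j = pairing (coad (\sum_i a 0 i *: e i) g) (e j).
Proof.
rewrite -pairing_coad mxE; under eq_bigr do rewrite (struct_mx_ev hc).
have qD x y z : qbr (x + y) z = qbr x z + qbr y z :> qel n k.
  by rewrite /qbr qelD; congr (_, _, _); rewrite ?mulmxDl ?mulmxDr opprD addrACA.
have qZ b x z : qbr (b *: x) z = b *: qbr x z :> qel n k.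
  by rewrite /qbr qelZ; congr (_, _, _); rewrite -!scalemxAl -!scalemxAr -scalerBr.
rewrite (big_morph (fun x => pairing g (qbr x (e j))) (id1 := 0) (op1 := +%R)) => [|x y|].
- by apply: eq_bigr => i _; rewrite qZ pairingZr.
- by rewrite qD pairingDr.
by rewrite -(scale0r 0) qZ scale0r pairing0r.
Qed.

(** The left kernel is the stabiliser. A functional vanishing on q is only a scalar shift, hence the
    unknown scalar b in all later stabiliser equations. *)
Lemma coad_scalar (a : 'rV[CC]_N) g : a *m struct_mx_at c (ev e g) = 0 ->
  exists b, coad (\sum_i a 0 i *: e i) g = dualshift n k b.
Proof.
move=> h; have [|b hb] := ev_inj n_gt0 he (g := coad (\sum_i a 0 i *: e i) g) (g' := 0).
  by move=> j; rewrite /ev pairing0l -struct_mx_mul h mxE.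
by exists b; rewrite hb add0r.
Qed.
End RankBounds.

Lemma rank_principal_submx (F : fieldType) N r (M : 'M[F]_N) (f : 'I_r -> 'I_N) :
  (\rank (principal_submx M f) <= \rank M)%N.
Proof.
have -> : principal_submx M f = rowsub f (colsub f M) by apply/matrixP => i j; rewrite !mxE.
apply: leq_trans (mxrankS (rowsub_sub _ _)) _.
rewrite -mxrank_tr trmx_mxsub -[in leqRHS]mxrank_tr; exact: mxrankS (rowsub_sub _ _).
Qed.

Lemma polyfun_struct_mx N (c : 'I_N -> 'I_N -> 'I_N -> CC) i j :
  polyfun (fun s => struct_mx_at c s i j).
Proof. by apply: polyfun_ext (polyfun_meval (struct_mx c i j)) => s; rewrite [RHS]mxE. Qed.

Lemma polyfun_principal_det N (c : 'I_N -> 'I_N -> 'I_N -> CC) r (f : 'I_r -> 'I_N) :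
  polyfun (fun s => \det (principal_submx (struct_mx_at c s) f)).
Proof.
apply: polyfun_det => i j; apply: polyfun_ext (polyfun_struct_mx c (f i) (f j)) => s.
by rewrite [RHS]mxE.
Qed.

Section UpperBound.
Variables (n k N : nat) (e : 'I_N -> qel n k) (c : 'I_N -> 'I_N -> 'I_N -> CC).
Hypotheses (n_gt0 : (0 < n)%N) (he : is_q_basis e) (hc : struct_consts e c).

(* The abelian ideal contributes the elements [(0, X E, E Y)] to the stabiliser of [(A, X, Y)]. *)
Lemma struct_mx_rank_ideal (W : 'M[CC]_(k, n)) (g : qel n k) : W *m g.1.2 = 1%:M ->
  (k * k + \rank (struct_mx_at c (ev e g)) <= N)%N.
Proof.
move=> WX.
pose x (v : 'rV[CC]_(k * k)) : qel n k := (0, g.1.2 *m vec_mx v, vec_mx v *m g.2).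
have xq v : in_q (x v) by rewrite /in_q /= mxtrace0.
have ex s : exists a : 'I_N -> CC, x (delta_mx 0 s) = \sum_i a i *: e i.
  by have [a [ha _]] := evP he 0 (xq (delta_mx 0 s)); exists a.
have [a ha] := fin_all_exists ex.
pose K := \matrix_(s, l) a s l.
have xD v w : x (v + w) = x v + x w.
  by rewrite /x qelD addr0 !linearD /= mulmxDl.
have xZ b v : x (b *: v) = b *: x v.
  by rewrite /x qelZ scaler0 !linearZ /= -scalemxAl.
have xK v : \sum_l (v *m K) 0 l *: e l = x v.
  rewrite {2}[v]row_sum_delta (big_morph x xD (id1 := 0)); last by rewrite -(scale0r 0) xZ scale0r.
  under [RHS]eq_bigr do rewrite xZ ha scaler_sumr.
  rewrite exchange_big; apply: eq_bigr => l _; rewrite mxE scaler_suml.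
  by apply: eq_bigr => s _; rewrite mxE scalerA.
have Kf : row_free K.
  apply: inj_row_free => v vK; have := xK v; rewrite vK.
  under eq_bigr do rewrite mxE scale0r.
  rewrite big1 // => -[h _]; apply: (can_inj vec_mxK); rewrite linear0.
  by rewrite -[LHS]mul1mx -WX -mulmxA -h mulmx0.
rewrite -(eqP Kf); apply: mulmx0_rank_max; apply/row_matrixP => s.
rewrite row_mul row0; apply/rowP => j; rewrite (struct_mx_mul hc) mxE.
rewrite rowE xK /coad /x /= !(mul0mx, mulmx0, subrr, oppr0) sub0r mulmxA addNr.
exact: pairing0l.
Qed.
End UpperBound.

(** The rank at [s] is witnessed by a nonzero minor. Some point satisfies both this open condition
    and the full column rank of X; its rank is no smaller, and the ideal bounds it. *)
Lemma struct_mx_rank_le k m N (e : 'I_N -> qel (k + m.+1) k) c s :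
  is_q_basis e -> struct_consts e c -> (k * k + \rank (struct_mx_at c s) <= N)%N.
Proof.
move=> he hc; have n0 : (0 < k + m.+1)%N by rewrite addnS.
have [f [_ fu]] := skew_principal_submx (struct_mx_skew n0 he hc s).
have [ga [hga [_ gX _]]] := ev_surj n0 he.
pose W : 'M[CC]_(k, k + m.+1) := row_mx 1%:M 0.
have pW : polyfun (fun s => \det (W *m (ga s).1.2)).
  by apply: polyfun_det; apply: polyfun_mulmx => // i j; exact: polyfun_const.
have [||s0 [h1 h2]] := polyfun_common_nonzero (polyfun_principal_det c f) pW.
- by exists s; move: fu; rewrite unitmxE unitfE.
- exists (ev e (0, col_mx 1%:M 0, 0)); set s' := ev _ _.
  have [b ->] := ev_inj n0 he (hga s').
  by rewrite /= addr0 mul_row_col mul1mx mul0mx addr0 det1 oner_neq0.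
have hr : (\rank (struct_mx_at c s) <= \rank (struct_mx_at c s0))%N.
  apply: leq_trans (rank_principal_submx _ f).
  by rewrite [leqRHS]mxrank_unit // unitmxE unitfE.
apply: leq_trans (leq_add (leqnn _) hr) _.
have -> : struct_mx_at c s0 = struct_mx_at c (ev e (ga s0)).
  apply/matrixP => i j; rewrite !mxE; apply: meval_eq => l; by rewrite hga.
apply: (struct_mx_rank_ideal he hc (W := invmx (W *m (ga s0).1.2) *m W)).
by rewrite -mulmxA mulVmx // unitmxE unitfE.
Qed.

(** Equality in the previous bound would give rank N - k^2 = 2 k^2 + 8 k + 3, which is odd. *)
Lemma struct_mx_rank_corank2 k N (e : 'I_N -> qel (k + 2) k) c s :
  is_q_basis e -> struct_consts e c -> (k * k + (\rank (struct_mx_at c s)).+1 <= N)%N.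
Proof.
move=> he hc; have n0 : (0 < k + 2)%N by rewrite addnS.
have := struct_mx_rank_le s he hc; rewrite addnS leq_eqVlt => /orP[/eqP E|//].
have /negP[] := skew_rank_even (struct_mx_skew n0 he hc s).
move: (\rank _) E => r E; have := congr1 odd (basis_card n0 he).
by rewrite -E /= !oddD !oddM /= !oddD /=; case: (odd k); case: (odd r).
Qed.

Lemma rank_lower_bound (F : fieldType) N q (M : 'M[F]_N) (L : 'M[F]_(N, q)) :
  (forall a : 'rV_N, a *m M = 0 -> a *m L = 0 -> a = 0) -> (N <= \rank M + q)%N.
Proof.
move=> h; have := mxrank_mul_ker (kermx M) L.
have /eqP -> : (kermx M :&: kermx L)%MS == 0.
  apply/rowV0P => v; rewrite sub_capmx => /andP[/sub_kermxP hM /sub_kermxP hL].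
  exact: h.
rewrite mxrank0 addn0 mxrank_ker => E.
by rewrite -leq_subLR -E rank_leq_col.
Qed.

Section LowerBound.
Variables (n k N : nat) (e : 'I_N -> qel n k) (c : 'I_N -> 'I_N -> 'I_N -> CC).
Hypotheses (n_gt0 : (0 < n)%N) (he : is_q_basis e) (hc : struct_consts e c).
Variables (A : 'M[CC]_n) (X : 'M[CC]_(n, k)) (Y : 'M[CC]_(k, n)) (i0 j0 : 'I_n).

(* Besides the [k ^ 2] parameters of the abelian part, the stabiliser is cut out by the vanishing
   of one entry of its matrix component. *)
Lemma struct_mx_rank_ge : row_free X^T -> row_free Y ->
  (forall B v w b, \tr B = 0 -> A *m B - B *m A - v *m Y + X *m w = b%:M ->
     B *m X = 0 -> Y *m B = 0 -> B i0 j0 = 0 -> B = 0 /\ b = 0) ->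
  (N <= \rank (struct_mx_at c (ev e (A, X, Y))) + (1 + k * k))%N.
Proof.
move=> /row_freeP[Wt hW] /row_freeP[V hV] H.
have {Wt hW}[W hW] : exists W, W *m X = 1%:M.
  by exists Wt^T; apply: trmx_inj; rewrite trmx_mul trmxK hW trmx1.
pose L := \matrix_i (row_mx ((e i).1.1 i0 j0)%:M (mxvec (W *m (e i).1.2)) : 'rV_(1 + k * k)).
apply: (rank_lower_bound (L := L)) => a hM hL.
have [b hb] := coad_scalar n_gt0 he hc hM.
have hq : in_q (\sum_i a 0 i *: e i).
  rewrite /in_q (big_morph (fun x : qel n k => \tr x.1.1) (id1 := 0) (op1 := +%R)).
  - apply: big1 => i _; by rewrite mxtraceZ (in_q_basis he) mulr0.
  - by move=> x y; rewrite mxtraceD.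
  by rewrite mxtrace0.
pose phi (x : qel n k) : 'rV[CC]_(1 + k * k) := row_mx (x.1.1 i0 j0)%:M (mxvec (W *m x.1.2)).
have phiL : a *m L = phi (\sum_i a 0 i *: e i).
  rewrite mulmx_sum_row (big_morph phi (id1 := 0) (op1 := +%R)).
  - apply: eq_bigr => i _; rewrite rowK /phi scale_row_mx; congr row_mx; first by rewrite mxE -scale_scalar_mx.
    by rewrite -scalemxAr linearZ.
  - by move=> x y; rewrite /phi /= add_row_mx mxE raddfD mulmxDr linearD.
  by rewrite /phi mxE raddf0 mulmx0 linear0 row_mx0.
rewrite {}hL in phiL.
suff x0 : \sum_i a 0 i *: e i = 0.
  apply/rowP => i; rewrite [RHS]mxE; case: he => _ hf _.
  by apply: (hf (fun i => a 0 i)); rewrite qcombE x0.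
case: (\sum_i _) hq phiL hb => -[B v] w /= hq phiL [E EX EY].
rewrite -row_mx0 in phiL; case/eq_row_mx: phiL => hB hv.
have hBX : B *m X = 0 by apply/eqP; rewrite -oppr_eq0 EX.
have hB0 : B i0 j0 = 0 by move/matrixP/(_ 0 0): hB; rewrite !mxE mulr1n => <-.
have hWv : W *m v = 0 by apply: (can_inj mxvecK); rewrite -hv linear0.
have [B0 b0] := H B v w b hq E hBX EY hB0.
move: E; rewrite B0 b0 mulmx0 mul0mx subrr sub0r raddf0 => /eqP.
rewrite addrC subr_eq0 => /eqP E.
have w0 : w = 0 by rewrite -[w]mul1mx -hW -mulmxA E mulmxA hWv mul0mx.
have v0 : v = 0 by rewrite -[v]mulmx1 -hV mulmxA -E w0 mulmx0 mul0mx.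
by congr (_, _, _).
Qed.
End LowerBound.

(** * A plane whose nonzero points are regular *)

Section Plane.
Variable k : nat.
Implicit Types (u t : CC) (j : 'I_2) (l : 'I_k).

(** Linear in (u, t). Away from the origin at most one weight t + u l vanishes, and the extra column
    of u's keeps the rows independent when one does. X and Y use different extra columns, so that Y
    X is the diagonal matrix of squared weights. *)
Definition plane_frame u t j0 : 'M[CC]_(k, k + 2) :=
  row_mx (diag_mx (\row_l (t + u * l%:R))) (\matrix_(i, j) ((j == j0)%:R * u)).

(** Rows (0, t) and (u, 0): for (u, t) != 0 never scalar, hence regular modulo scalars. *)
Definition plane_mx u t : 'M[CC]_2 :=
  \matrix_(i, j) ((i == 0)%:R * (j == 1)%:R * t + (i == 1)%:R * (j == 0)%:R * u).

Definition plane u t : qel (k + 2) k :=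
  (block_mx 0 0 0 (plane_mx u t), (plane_frame u t 0)^T, plane_frame u t 1).

Lemma plane_mx_mul1 m (C : 'M[CC]_(2, m)) u t a : (plane_mx u t *m C) 1 a = u * C 0 a.
Proof.
rewrite mxE (bigD1 0) //= big1 ?addr0 => [|j /negPf j0]; rewrite !mxE ?j0 /=; ring.
Qed.

Lemma mul_plane_mx0 m (C : 'M[CC]_(m, 2)) u t a : (C *m plane_mx u t) a 0 = u * C a 1.
Proof.
rewrite mxE (bigD1 1) //= big1 ?addr0 => [|j j1]; rewrite !mxE ?(negPf j1) /=; ring.
Qed.

Lemma mul_plane_framel m (v : 'M[CC]_(m, k)) u t j0 a l :
  (v *m plane_frame u t j0) a (lshift 2 l) = v a l * (t + u * l%:R).
Proof. by rewrite mul_mx_row row_mxEl mul_mx_diag !mxE. Qed.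

Lemma mul_plane_framer m (v : 'M[CC]_(m, k)) u t j0 a j :
  (v *m plane_frame u t j0) a (rshift k j) = (j == j0)%:R * u * \sum_l v a l.
Proof.
rewrite mul_mx_row row_mxEr !mxE mulr_sumr; apply: eq_bigr => l _.
by rewrite !mxE mulrC.
Qed.

Lemma plane_frame_mul m (B : 'M[CC]_(k + 2, m)) u t j0 l a :
  (plane_frame u t j0 *m B) l a = (t + u * l%:R) * B (lshift 2 l) a + u * B (rshift k j0) a.
Proof.
rewrite -{1}[B]vsubmxK mul_row_col mul_diag_mx !mxE; congr (_ + _).
rewrite (bigD1 j0) //= big1 => [|j /negPf jj]; first by rewrite !mxE eqxx mul1r addr0.
by rewrite !mxE jj !mul0r.
Qed.

Lemma mul_plane_frame_tr m (B : 'M[CC]_(m, k + 2)) u t j0 a l :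
  (B *m (plane_frame u t j0)^T) a l = (t + u * l%:R) * B a (lshift 2 l) + u * B a (rshift k j0).
Proof.
have -> : (B *m (plane_frame u t j0)^T) a l = (plane_frame u t j0 *m B^T) l a.
  by rewrite -[plane_frame u t j0 *m _]trmxK trmx_mul trmxK [RHS]mxE.
by rewrite plane_frame_mul !mxE.
Qed.

Lemma plane_weight_inj u t l l' : u != 0 -> t + u * l%:R = 0 -> t + u * l'%:R = 0 -> l = l'.
Proof.
move=> u0 h h'; apply/ord_inj/eqP; rewrite -(eqr_nat CC) -(inj_eq (mulfI u0)).
by rewrite -(inj_eq (addrI t)) h h'.
Qed.

Lemma plane_frame_free u t j0 : (u != 0) || (t != 0) -> row_free (plane_frame u t j0).
Proof.
move=> ut; apply: inj_row_free => v hv.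
have h1 l : v 0 l * (t + u * l%:R) = 0 by rewrite -(mul_plane_framel v u t j0) hv mxE.
have h2 : u * \sum_l v 0 l = 0.
  by have := mul_plane_framer v u t j0 0 j0; rewrite hv mxE eqxx mul1r.
apply/rowP => l; rewrite [RHS]mxE; apply/eqP.
have := h1 l; move/eqP; rewrite mulf_eq0 => /orP[//|/eqP pl].
have u0 : u != 0.
  by move: ut; apply: contraTneq => u0; move: pl; rewrite u0 mul0r addr0 => ->; rewrite eqxx.
move/eqP: h2; rewrite mulf_eq0 (negPf u0) /= (bigD1 l) //= big1 ?addr0 // => l' ll'.
apply/eqP; have := h1 l'; move/eqP; rewrite mulf_eq0 => /orP[//|/eqP pl'].
by rewrite (plane_weight_inj u0 pl' pl) eqxx in ll'.
Qed.
End Plane.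

Section PlaneRegular.
Variables (k : nat) (u t : CC).
Let F := @plane_frame k u t.
Let A : 'M[CC]_(k + 2) := block_mx 0 0 0 (plane_mx u t).
Variables (B : 'M[CC]_(k + 2)) (v : 'M[CC]_(k + 2, k)) (w : 'M[CC]_(k, k + 2)) (b : CC).
Hypotheses (trB : \tr B = 0) (stab : A *m B - B *m A - v *m F 1 + (F 0)^T *m w = b%:M)
  (BX : B *m (F 0)^T = 0) (YB : F 1 *m B = 0).

Let r (j : 'I_2) : 'I_(k + 2) := rshift k j.
Let d (l : 'I_k) : 'I_(k + 2) := lshift 2 l.

Implicit Types (l : 'I_k) (a : 'I_(k + 2)).
Let BXE a l : (t + u * l%:R) * B a (d l) + u * B a (r 0) = 0.
Proof. by rewrite -mul_plane_frame_tr BX mxE. Qed.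

Let YBE l a : (t + u * l%:R) * B (d l) a + u * B (r 1) a = 0.
Proof. by rewrite -plane_frame_mul YB mxE. Qed.

(** One weight vanishes, at i. Then BX = 0 and YB = 0 leave only the entries of B in rows i, r 0 and
    columns i, r 1. The stabiliser equation where the frames contribute nothing gives b = 0 and
    kills two of them, the trace kills (i, i), and the hypothesis kills the last. *)
Lemma plane_stabilizer_degenerate (i : 'I_k) : u != 0 -> t + u * i%:R = 0 ->
  B (r 0) (r 1) = 0 -> B = 0 /\ b = 0.
Proof.
move=> u0 pi B01.
have pl l : l != i -> t + u * l%:R != 0.
  by apply: contraNneq => pl; apply/eqP; apply: (plane_weight_inj u0 pl pi).
have B_0 a : B a (r 0) = 0.
  by apply/eqP; have /eqP := BXE a i; rewrite pi mul0r add0r mulf_eq0 (negPf u0).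
have B1_ a : B (r 1) a = 0.
  by apply/eqP; have /eqP := YBE i a; rewrite pi mul0r add0r mulf_eq0 (negPf u0).
have B_l a l : l != i -> B a (d l) = 0.
  move=> /pl p0; apply/eqP; have /eqP := BXE a l.
  by rewrite B_0 mulr0 addr0 mulf_eq0 (negPf p0).
have Bl_ a l : l != i -> B (d l) a = 0.
  move=> /pl p0; apply/eqP; have /eqP := YBE l a.
  by rewrite B1_ mulr0 addr0 mulf_eq0 (negPf p0).
have E a a' : (A *m B) a a' - (B *m A) a a' - (v *m F 1) a a' + (w^T *m F 0) a' a = b *+ (a == a').
  have -> : (w^T *m F 0) a' a = ((F 0)^T *m w) a a' by rewrite -[F 0]trmxK -trmx_mul mxE trmxK.
  by move/matrixP/(_ a a'): stab; rewrite !mxE.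
have AL l a' : (A *m B) (d l) a' = 0.
  by rewrite -[B]vsubmxK mul_block_col !mul0mx addr0 col_mxEu mxE.
have AR a' : (A *m B) (r 1) a' = u * B (r 0) a'.
  by rewrite -{1}[B]vsubmxK mul_block_col !mul0mx !add0r col_mxEd plane_mx_mul1 mxE.
have LA a l : (B *m A) a (d l) = 0.
  by rewrite -[B]hsubmxK mul_row_block !mulmx0 addr0 row_mxEl mxE.
have RA a : (B *m A) a (r 0) = u * B a (r 1).
  by rewrite -{1}[B]hsubmxK mul_row_block !mulmx0 !add0r row_mxEr mul_plane_mx0 mxE.
have FL m (C : 'M[CC]_(m, k)) j (a : 'I_m) : (C *m F j) a (d i) = 0.
  by rewrite mul_plane_framel pi mulr0.
have FR m (C : 'M[CC]_(m, k)) j j' (a : 'I_m) : j != j' -> (C *m F j) a (r j') = 0.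
  by rewrite eq_sym => /negPf jj; rewrite mul_plane_framer jj !mul0r.
have b0 : b = 0.
  by have := E (d i) (d i); rewrite AL LA !FL eqxx mulr1n !subrr addr0.
have B0i : B (r 0) (d i) = 0.
  have := E (r 1) (d i); rewrite AR LA FL FR // b0 mul0rn !subr0 addr0 => /eqP.
  by rewrite mulf_eq0 (negPf u0) => /eqP.
have Bi1 : B (d i) (r 1) = 0.
  have := E (d i) (r 0); rewrite AL RA FL FR // b0 mul0rn sub0r subr0 addr0 => /eqP.
  by rewrite oppr_eq0 mulf_eq0 (negPf u0) => /eqP.
have Bii : B (d i) (d i) = 0.
  rewrite -[RHS]trB /mxtrace big_split_ord /= (bigD1 i) //= big1 => [|l li]; last exact: B_l.
  by rewrite addr0 big_ord_recl big_ord1 /= -/(r _) B_0 add0r -/(r _) [lift _ _](_ : _ = 1) ?B1_ ?addr0 //; apply: val_inj.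
have o2 (x : 'I_2) : x = 0 \/ x = 1 by case: x => -[|[|//]] ?; [left|right]; apply: val_inj.
split=> //; apply/matrixP => a a'; rewrite [RHS]mxE.
case: (split_ordP a') => [l ->|j ->]; last first.
  have [->|->] := o2 j; first exact: B_0.
  case: (split_ordP a) => [l' ->|j' ->]; first by have [->|/Bl_] := eqVneq l' i.
  by have [->|->] := o2 j'; [exact: B01|exact: B1_].
have [->|/B_l//] := eqVneq l i.
case: (split_ordP a) => [l' ->|j' ->]; first by have [->|/Bl_] := eqVneq l' i.
by have [->|->] := o2 j'; [exact: B0i|exact: B1_].
Qed.

(* With [z = 1 + s E01] the matrix of [annihX *m annihY], the trace and the stabiliser equation for
   [beta] read [tr (beta z) = 0] and [a beta z - z beta a = b z], where [a = plane_mx u t]. *)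
Lemma plane_stabilizer_nondegenerate : (u != 0) || (t != 0) -> (forall l, t + u * l%:R != 0) ->
  (u != 0 -> B (r 1) (r 0) = 0) -> (u = 0 -> B (r 0) (r 1) = 0) -> B = 0 /\ b = 0.
Proof.
move=> ut pl hu h0; pose p l := t + u * (l : 'I_k)%:R.
pose beta : 'M[CC]_2 := dsubmx (rsubmx B).
have betaE i j : beta i j = B (r i) (r j) by rewrite !mxE.
pose annihX : 'M[CC]_(2, k + 2) := row_mx (\matrix_(i, l) (- (i == 0)%:R * u / p l)) 1%:M.
pose annihY : 'M[CC]_(k + 2, 2) := col_mx (\matrix_(l, j) (- (j == 1)%:R * u / p l)) 1%:M.
have o2 (x : 'I_2) : x = 0 \/ x = 1 by case: x => -[|[|//]] ?; [left|right]; apply: val_inj.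
have annX : annihX *m (F 0)^T = 0.
  apply/matrixP => i l; rewrite mul_plane_frame_tr row_mxEl row_mxEr !mxE -/(p l).
  by have [->|->] := o2 i; rewrite /=; field; exact: pl.
have annY : F 1 *m annihY = 0.
  apply/matrixP => l j; rewrite plane_frame_mul col_mxEu col_mxEd !mxE -/(p l).
  by have [->|->] := o2 j; rewrite /=; field; exact: pl.
have BE : B = annihY *m beta *m annihX.
  have -> : annihY *m beta = rsubmx B.
    rewrite -[RHS]vsubmxK mul_col_mx mul1mx; congr col_mx; apply/matrixP => l j.
    rewrite mulmx2E betaE !mxE /= oppr0 !mul0r add0r.
    by apply: (mulfI (pl l)); rewrite -[RHS]subr0 -(YBE l (r j)) -/(p l); field; exact: pl.
  rewrite -[LHS]hsubmxK mul_mx_row mulmx1; congr row_mx; apply/matrixP => a l.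
  rewrite mulmx2E !mxE /= oppr0 !mul0r mulr0 addr0.
  by apply: (mulfI (pl l)); rewrite -[LHS]subr0 -(BXE a l) -/(p l); field; exact: pl.
pose z := annihX *m annihY; pose s := \sum_l (u / p l) ^+ 2.
have zE i j : z i j = (i == j)%:R + (i == 0)%:R * (j == 1)%:R * s.
  rewrite /z mul_row_col mulmx1 !mxE addrC; congr (_ + _).
  by rewrite mulr_sumr; apply: eq_bigr => l _; rewrite !mxE; ring.
have aE : annihX *m A *m annihY = plane_mx u t.
  by rewrite mul_row_block !mulmx0 !add0r !mul_row_col mul0mx add0r mul1mx mulmx1.
have tr0 : \tr (beta *m z) = 0 by rewrite /z mulmxA mxtrace_mulC mulmxA -BE.
have := congr1 (fun M => annihX *m M *m annihY) stab.
rewrite mulmxDr !mulmxBr !mulmxDl !mulNmx.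
rewrite [annihX *m (v *m _)]mulmxA -[_ *m F 1 *m _]mulmxA annY mulmx0 subr0.
rewrite [annihX *m (_^T *m w)]mulmxA annX !mul0mx addr0.
have -> : annihX *m (A *m B) *m annihY = plane_mx u t *m beta *m z.
  by rewrite BE -aE /z !mulmxA.
have -> : annihX *m (B *m A) *m annihY = z *m beta *m plane_mx u t.
  by rewrite BE -aE /z !mulmxA.
rewrite mul_mx_scalar -scalemxAl -/z => /matrixP E.
have {}E i j : (plane_mx u t *m beta *m z) i j - (z *m beta *m plane_mx u t) i j = b * z i j.
  by have := E i j; rewrite [LHS]mxE [X in _ + X]mxE [RHS]mxE.
have pE i j : plane_mx u t i j = (i == 0)%:R * (j == 1)%:R * t + (i == 1)%:R * (j == 0)%:R * u.
  by rewrite mxE.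
have := E 0 0; have := E 0 1; have := E 1 0; have := E 1 1; move: tr0.
rewrite trace2 !mulmx2E !zE !pE /= !(mul0r, mulr0, mul1r, mulr1, add0r, addr0).
move: (betaE 0 1) (betaE 1 0) {E}.
set b00 := beta 0 0; set b01 := beta 0 1; set b10 := beta 1 0; set b11 := beta 1 1.
move=> h01 h10 tr0 e11 e10 e01 e00.
have b0 : b = 0.
  have /eqP : b *+ 2 = 0 by rewrite mulr2n -{1}e11 -e00 -(mul0r s) -e10; ring.
  by rewrite mulrn_eq0 => /eqP.
rewrite b0 ?mul0r in e11 e01 e00.
suff [[z00 z01] [z10 z11]] : (b00 = 0 /\ b01 = 0) /\ (b10 = 0 /\ b11 = 0).
  by split=> //; rewrite BE (_ : beta = 0) ?mulmx0 ?mul0mx //; apply: mx2P; rewrite [RHS]mxE.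
have [u0|u0] := eqVneq u 0; last first.
  have b10' : b10 = 0 by rewrite h10 hu.
  have b01' : b00 = b11 by apply: (mulfI u0); rewrite [RHS]mulrC; apply/eqP; rewrite -subr_eq0 e10.
  have b00' : b00 = 0.
    move: tr0; rewrite b10' mul0r add0r -b01' -mulr2n => /eqP; by rewrite mulrn_eq0 => /eqP.
  split; split=> //; last by rewrite -b01'.
  apply: (mulfI u0); rewrite mulr0 -e11 b00' b10'; ring.
have t0 : t != 0 by move: ut; rewrite u0 eqxx.
have s0 : s = 0 by apply: big1 => l _; rewrite u0 mul0r expr0n.
have b10' : b10 = 0.
  apply: (mulfI t0); rewrite mulr0 -e00 u0; ring.
have b11' : b00 = b11.
  by apply/esym/(mulfI t0)/eqP; rewrite -subr_eq0 -e01 s0; apply/eqP; ring.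
have b00' : b00 = 0.
  move: tr0; rewrite b10' mul0r add0r -b11' -mulr2n => /eqP; by rewrite mulrn_eq0 => /eqP.
by split; split=> //; [rewrite h01 h0|rewrite -b11'].
Qed.
End PlaneRegular.

Lemma planeE k u t : plane k u t = u *: plane k 1 0 + t *: plane k 0 1.
Proof.
rewrite /plane !qelZ qelD; congr (_, _, _).
- rewrite !scale_block_mx add_block_mx !scaler0 !addr0; congr block_mx.
  by apply/matrixP => i j; rewrite !mxE; ring.
- rewrite -!linearZ -linearD /=; congr _^T.
  rewrite /plane_frame !scale_row_mx add_row_mx; congr row_mx; apply/matrixP => i j; rewrite !mxE.
    by case: eqP => _; rewrite ?mulr1n ?mulr0n; ring.
  by ring.
rewrite /plane_frame !scale_row_mx add_row_mx; congr row_mx; apply/matrixP => i j; rewrite !mxE.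
  by case: eqP => _; rewrite ?mulr1n ?mulr0n; ring.
by ring.
Qed.

Lemma struct_mx_atZ N (c : 'I_N -> 'I_N -> 'I_N -> CC) s t :
  struct_mx_at c (fun l => t * s l) = t *: struct_mx_at c s.
Proof.
apply/matrixP => i j; rewrite !mxE !rmorph_sum mulr_sumr; apply: eq_bigr => l _.
by rewrite /= !mevalZ !mevalXU mulrCA.
Qed.

Section Codim2.
Variables (k N : nat) (e : 'I_N -> qel (k + 2) k) (c : 'I_N -> 'I_N -> 'I_N -> CC).
Hypotheses (he : is_q_basis e) (hc : struct_consts e c).

Lemma plane_regular u t : (u != 0) || (t != 0) ->
  (N <= \rank (struct_mx_at c (ev e (plane k u t))) + (1 + k * k))%N.
Proof.
move=> ut; have n0 : (0 < k + 2)%N by rewrite addnS.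
have fX : row_free (plane_frame k u t 0)^T^T by rewrite trmxK plane_frame_free.
have fY := plane_frame_free k 1 ut.
case: (pickP (fun i : 'I_k => t + u * i%:R == 0)) => [i /eqP pi|np].
  have u0 : u != 0 by move: ut; apply: contraTneq => u0; move: pi; rewrite u0 mul0r addr0 => ->; rewrite eqxx.
  apply: (struct_mx_rank_ge n0 he hc (i0 := rshift k 0) (j0 := rshift k 1) fX fY).
  move=> B v w b trB E BX YB; by move=> h; apply: (plane_stabilizer_degenerate trB E BX YB u0 pi h).
have pl l : t + u * (l : 'I_k)%:R != 0 by rewrite np.
(* The remaining direction of the stabiliser is detected in a position where [plane_mx] is nonzero:
   entry (1, 0) if u != 0, otherwise (0, 1). *)
apply: (struct_mx_rank_ge n0 he hc (i0 := rshift k (u != 0)%:R) (j0 := rshift k (u == 0)%:R) fX fY).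
move=> B v w b trB E BX YB h; apply: (plane_stabilizer_nondegenerate trB E BX YB ut pl).
  by move=> u0; move: h; rewrite (negPf u0).
by move=> u0; move: h; rewrite u0 eqxx.
Qed.

Lemma codim2_corank2 : fund_semi_inv_trivial c.
Proof.
have n0 : (0 < k + 2)%N by rewrite addnS.
move=> r [[g0 hg0] hmax] d hd.
pose reg s := \rank (struct_mx_at c s) = r.
have dreg s : reg s -> d.@[s] != 0.
  (* At a regular point some principal Pfaffian of size r is nonzero, and it is a multiple of
     [d]. *)
  move=> rs; have [f [fm pf0]] := pfsum_principal_neq0 (struct_mx_skew n0 he hc s).
  rewrite /reg in rs; case: r / rs hd {hg0 hmax reg} => /(_ f fm)[g /(congr1 (meval s))].
  have [a a0 ->] := meval_pfaffian (principal_submx (struct_mx c) f) s.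
  rewrite mevalM (_ : map_mx _ _ = principal_submx (struct_mx_at c s) f); last first.
    by apply/matrixP => i j; rewrite !mxE.
  by move=> E; apply/eqP => d0; move/eqP: E; rewrite d0 mul0r mulf_eq0 (negPf a0) (negPf pf0).
apply: (mpoly_const_of_cone (reg := reg)) => //.
- apply: (mpoly_plane_origin (g := ev e (plane k 1 0)) (h := ev e (plane k 0 1))) => u t ut.
  rewrite (@meval_eq _ _ _ (ev e (plane k u t))) => [|l]; last first.
    by rewrite /ev [in RHS]planeE pairingDl !pairingZl.
  (* The parity bound at [g0] and the stabiliser bound on the plane meet: both compare the rank with
     N - 1 - k^2. *)
  apply: dreg; apply/eqP; rewrite /reg eqn_leq hmax -hg0 /=.
  have := leq_trans (struct_mx_rank_corank2 g0 he hc) (plane_regular ut).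
  by rewrite addnS addnC add1n addnS ltnS leq_add2r.
- by move=> g t t0; rewrite /reg struct_mx_atZ mxrank_scale_nz.
(* A nonzero minor of maximal size at [g0] cuts out a dense open set of regular points. *)
have [f [_ fu]] := skew_principal_submx (struct_mx_skew n0 he hc g0).
exists (fun s => \det (principal_submx (struct_mx_at c s) f)); first exact: polyfun_principal_det.
split; first by exists g0; move: fu; rewrite unitmxE unitfE.
move=> s hs; apply/eqP; rewrite /reg eqn_leq hmax -hg0 /=.
apply: leq_trans (rank_principal_submx _ f).
by rewrite [leqRHS]mxrank_unit // unitmxE unitfE.
Qed.
End Codim2.

Theorem theorem4p4 (n k : nat) (hn : (2 <= n)%N) (hk1 : (1 <= k)%N)
  (hk2 : (k <= n - 1)%N)
  (N : nat) (e : 'I_N -> qel n k) (c : 'I_N -> 'I_N -> 'I_N -> CC)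
  (he : is_q_basis e) (hc : struct_consts e c) :
  (sym_inv_polynomial c <-> (k = n - 2)%N \/ (k = n - 1)%N) /\
  ((k = n - 2)%N -> fund_semi_inv_trivial c).
Proof.
split; last first.
  move=> hk; have nE : n = (k + 2)%N by rewrite hk subnK.
  by move: e he hc; rewrite {}nE => e he hc; apply: codim2_corank2 he hc.
split=> [hp|[hk|hk]].
- have [hk|k2] := eqVneq k (n - 2)%N; first by left.
  have [hk|k1] := eqVneq k (n - 1)%N; first by right.
  have [m nE] : exists m, n = (k + m.+3)%N.
    have h : (k < n - 1)%N by rewrite ltn_neqAle k1.
    have {}h : (k < n - 2)%N by rewrite ltn_neqAle k2 -ltnS -subSn.
    by exists (n - 2 - k.+1)%N; rewrite -(addn2 (_ - _).+1) addnA -(addSnnS k) subnKC // subnK.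
  case: k hk1 {hk2 k2 k1} e he hc hp nE => // k _ e he hc hp nE; exfalso.
  by move: e he hc hp; rewrite nE => e he hc; apply: sym_inv_not_polynomial he hc.
- have nE : n = (k + 2)%N by rewrite hk subnK.
  case: k hk1 {hk hk2} e he hc nE => // k _ e he hc nE.
  by move: e he hc; rewrite nE => e he hc; apply: polynomial_corank2 he hc.
have nE : n = (k + 1)%N by rewrite hk subnK // ltnW.
by move: e he hc; rewrite {}nE => e he hc; apply: polynomial_corank1 he hc.
Qed.
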